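(* For an algebra $R$ over a field $\mathbf{k}$ of characteristic zero, the following conditions are equivalent: (a) $R \in \mathfrak{D}(\mathbf{k})$; (b) $\mathrm{ML}(R) \neq R$ and there exists a field extension $K/\mathbf{k}$ such that $K \otimes_{\mathbf{k}} R \in \mathfrak{D}(K)$.
   Context: All rings and algebras are commutative, associative and unital. A derivation $D : R \to R$ of a ring $R$ of characteristic zero is locally nilpotent if for each $r \in R$ there is $n \in \mathbb{N}$ (depending on $r$) with $D^n(r) = 0$. The Makar-Limanov invariant is $\mathrm{ML}(R) = \bigcap_D \ker(D)$, the intersection over all locally nilpotent derivations $D : R \to R$. For a field $F$ of characteristic zero, $\mathfrak{D}(F)$ denotes the class of $F$-algebras isomorphic (as $F$-algebras) to $F[X,Y,Z]/(XY - \varphi(Z))$ for some nonconstant polynomial in one variable $\varphi(Z) \in F[Z] \setminus F$, where $X,Y,Z$ are indeterminates over $F$. *)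

(* Defs.v *)
From HB Require Import structures.
From mathcomp Require Import all_boot all_algebra.
From mathcomp Require Import boolp classical_sets.
From mathcomp Require Import mpoly.

Set Implicit Arguments.
Unset Strict Implicit.
Unset Printing Implicit Defensive.

Import GRing.Theory.
Local Open Scope ring_scope.
Local Open Scope quotient_scope.

(* The comAlgType of MathComp excludes the zero ring; here an F-algebra is a  *)
(* commutative ring, possibly zero, together with a ring morphism from F.     *)
Record calg (F : fieldType) := CAlg {
  calg_ring :> comPzRingType;
  calg_str : {rmorphism F -> calg_ring}
}.

Arguments calg_str {F} c.

Definition calg_iso (F : fieldType) (A B : calg F) : Prop :=
  exists f : {rmorphism A -> B},
    bijective f /\ forall c : F, f (calg_str A c) = calg_str B c.

Section LocallyNilpotent.
Variable R : comPzRingType.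

Definition is_derivation (D : {additive R -> R}) : Prop :=
  forall x y : R, D (x * y) = D x * y + x * D y.

Definition locally_nilpotent (D : {additive R -> R}) : Prop :=
  forall r : R, exists n : nat, iter n D r = 0.

Definition ML : set R :=
  [set r | forall D : {additive R -> R},
      is_derivation D -> locally_nilpotent D -> D r = 0].

End LocallyNilpotent.

Arguments ML : clear implicits.

Section Danielewski.
Variables (F : fieldType) (phi : {poly F}).

Definition varX : {mpoly F[3]} := 'X_(inord 0).
Definition varY : {mpoly F[3]} := 'X_(inord 1).
Definition varZ : {mpoly F[3]} := 'X_(inord 2).

Definition XYphi : {mpoly F[3]} :=
  varX * varY - (map_poly (@mpolyC 3 F) phi).[varZ].

Definition XYphi_ideal : {pred {mpoly F[3]}} :=
  fun p => `[< exists q : {mpoly F[3]}, p = q * XYphi >].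

(* The ideal is proper: XYphi vanishes at (1, phi(0), 0).                     *)
Lemma XYphi_ideal_closed : idealr_closed XYphi_ideal.
Proof.
split.
- by apply/asboolP; exists 0; rewrite mul0r.
- apply/negP => /asboolP[q] /(congr1 (meval
    (fun i : 'I_3 => if i == inord 0 then 1 else
                     if i == inord 1 then phi.[0] else 0))).
  rewrite rmorph1 rmorphM /= rmorphB rmorphM /= !mevalXU eqxx.
  have -> : (inord 1 == inord 0 :> 'I_3) = false.
    by apply/negbTE; rewrite -val_eqE /= !inordK.
  rewrite eqxx -horner_map /= -map_poly_comp /=.
  rewrite (eq_map_poly (g := id)) => [|c]; last by rewrite /= mevalC.
  rewrite map_poly_id // mevalXU.
  have -> : (inord 2 == inord 0 :> 'I_3) = false.
    by apply/negbTE; rewrite -val_eqE /= !inordK.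
  have -> : (inord 2 == inord 1 :> 'I_3) = false.
    by apply/negbTE; rewrite -val_eqE /= !inordK.
  by rewrite mul1r subrr mulr0 => /eqP; rewrite oner_eq0.
- move=> a x y /asboolP[p ->] /asboolP[q ->]; apply/asboolP.
  by exists (a * p + q); rewrite mulrDl mulrA.
Qed.

HB.instance Definition _ :=
  isIdealr.Build {mpoly F[3]} XYphi_ideal XYphi_ideal_closed.

Local Notation XYphi_ring := {ideal_quot XYphi_ideal}.

Definition XYphi_str (c : F) : XYphi_ring := \pi_XYphi_ring c%:MP.

Lemma XYphi_str_zmod : zmod_morphism XYphi_str.
Proof. by move=> a b; rewrite /XYphi_str !rmorphB. Qed.

Lemma XYphi_str_monoid : monoid_morphism XYphi_str.
Proof. by split=> [|a b]; rewrite /XYphi_str ?rmorph1 // !rmorphM. Qed.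

HB.instance Definition _ :=
  GRing.isZmodMorphism.Build F XYphi_ring XYphi_str XYphi_str_zmod.
HB.instance Definition _ :=
  GRing.isMonoidMorphism.Build F XYphi_ring XYphi_str XYphi_str_monoid.

Definition XYphi_calg : calg F := @CAlg F XYphi_ring XYphi_str.

End Danielewski.

(* size phi <= 1 exactly when phi is constant.                                *)
Definition classD (F : fieldType) (A : calg F) : Prop :=
  exists phi : {poly F}, (1 < size phi)%N /\ calg_iso A (XYphi_calg phi).

(* K (x)_k R: finite formal sums of pairs (a, r), modulo the congruence       *)
(* generated by the balanced biadditive relations.                            *)
Section Tensor.
Variables (k K : fieldType) (iota : {rmorphism k -> K}) (R : calg k).

Local Notation fsum := (seq (K * R)).

Inductive tens_eq : fsum -> fsum -> Prop :=
| tens_refl s : tens_eq s s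
| tens_sym s t : tens_eq s t -> tens_eq t s
| tens_trans s t u : tens_eq s t -> tens_eq t u -> tens_eq s u
| tens_cat s1 s2 t1 t2 :
    tens_eq s1 s2 -> tens_eq t1 t2 -> tens_eq (s1 ++ t1) (s2 ++ t2)
| tens_catC s t : tens_eq (s ++ t) (t ++ s)
| tens_0l r : tens_eq [:: (0, r)] [::]
| tens_Dl a b r : tens_eq [:: (a + b, r)] [:: (a, r); (b, r)]
| tens_Dr a r s : tens_eq [:: (a, r + s)] [:: (a, r); (a, s)]
| tens_bal a c r : tens_eq [:: (a * iota c, r)] [:: (a, calg_str R c * r)].

Definition tens_eqb : rel fsum := fun s t => `[< tens_eq s t >].

Lemma tens_eqb_equiv : equiv_class_of tens_eqb.
Proof.
split.
- by move=> s; apply/asboolP; apply: tens_refl.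
- by move=> s t; apply/asboolP/asboolP; apply: tens_sym.
- by move=> t s u /asboolP st /asboolP tu; apply/asboolP; apply: tens_trans tu.
Qed.

Canonical tens_eqb_rel := EquivRelPack tens_eqb_equiv.

Definition tens := {eq_quot tens_eqb}.

HB.instance Definition _ := Choice.on tens.
HB.instance Definition _ : EqQuotient fsum tens_eqb tens := EqQuotient.on tens.

Lemma tensP (s t : fsum) : reflect (tens_eq s t) (s == t %[mod tens]).
Proof. by rewrite piE; apply: asboolP. Qed.

Lemma tens_piP (s t : fsum) : tens_eq s t -> \pi_tens s = \pi_tens t.
Proof. by move=> st; apply/eqP/tensP. Qed.

Definition fopp (s : fsum) : fsum := [seq (- p.1, p.2) | p <- s].
Definition fmul (s t : fsum) : fsum :=
  [seq (p.1 * q.1, p.2 * q.2) | p <- s, q <- t].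

Lemma fopp_eq s t : tens_eq s t -> tens_eq (fopp s) (fopp t).
Proof.
elim=> {s t} /=.
- by move=> s; apply: tens_refl.
- by move=> s t _; apply: tens_sym.
- by move=> s t u _ st _; apply: tens_trans.
- by move=> s1 s2 t1 t2 _ h1 _ h2; rewrite /fopp !map_cat; apply: tens_cat.
- by move=> s t; rewrite /fopp !map_cat; apply: tens_catC.
- by move=> r; rewrite /fopp /= oppr0; apply: tens_0l.
- by move=> a b r; rewrite /fopp /= opprD; apply: tens_Dl.
- by move=> a r s; apply: tens_Dr.
- by move=> a c r; rewrite /fopp /= -mulNr; apply: tens_bal.
Qed.

Lemma cat_interl (s1 s2 t1 t2 : fsum) :
  tens_eq ((s1 ++ s2) ++ (t1 ++ t2)) ((s1 ++ t1) ++ (s2 ++ t2)).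
Proof.
rewrite -!catA; apply: tens_cat; first exact: tens_refl.
by rewrite !catA; apply: tens_cat; [exact: tens_catC | exact: tens_refl].
Qed.

Lemma fopp_cat s : tens_eq (fopp s ++ s) [::].
Proof.
elim: s => [|[a r] s IHs]; first exact: tens_refl.
have := cat_interl [:: (- a, r)] (fopp s) [:: (a, r)] s.
move=> /tens_trans; apply.
apply: (@tens_cat _ [::] _ [::]) IHs.
apply: tens_trans (tens_0l r); apply: tens_sym.
by have := tens_Dl (- a) a r; rewrite addNr.
Qed.

Lemma fmul_cons p s t : fmul (p :: s) t = fmul [:: p] t ++ fmul s t.
Proof. by rewrite /fmul /= cats0. Qed.

Lemma fmul_catl s1 s2 t : fmul (s1 ++ s2) t = fmul s1 t ++ fmul s2 t.
Proof. by rewrite /fmul allpairs_cat. Qed.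

Lemma fmul1_cat p t1 t2 : fmul [:: p] (t1 ++ t2) = fmul [:: p] t1 ++ fmul [:: p] t2.
Proof. by rewrite /fmul /= !cats0 map_cat. Qed.

Lemma fmulC s t : tens_eq (fmul s t) (fmul t s).
Proof.
have fmuls0 u : fmul u [::] = [::] by elim: u.
have consr u q v : tens_eq (fmul u (q :: v)) (fmul u [:: q] ++ fmul u v).
  elim: u => [|p u IHu]; first exact: tens_refl.
  rewrite fmul_cons (fmul_cons p u [:: q]) (fmul_cons p u v) -[q :: v]cat1s.
  rewrite fmul1_cat.
  apply: tens_trans (cat_interl _ _ _ _).
  by apply: tens_cat; [exact: tens_refl | exact: IHu].
elim: s t => [|p s IHs] t; first by rewrite fmuls0; apply: tens_refl.
rewrite fmul_cons; apply: tens_trans (tens_sym (consr t p s)).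
apply: tens_cat => //.
have -> : fmul t [:: p] = fmul [:: p] t; last exact: tens_refl.
by rewrite /fmul /= cats0; elim: t => //= q t <-; rewrite mulrC [q.2 * _]mulrC.
Qed.

Lemma fmul_eqr s t1 t2 : tens_eq t1 t2 -> tens_eq (fmul s t1) (fmul s t2).
Proof.
move=> t12; elim: s => [|[a r] s IHs]; first exact: tens_refl.
rewrite !(fmul_cons _ s); apply: tens_cat => // {s IHs}.
elim: t12 => {t1 t2}.
- by move=> s; apply: tens_refl.
- by move=> s t _; apply: tens_sym.
- by move=> s t u _ st _; apply: tens_trans.
- by move=> s1 s2 t1 t2 _ h1 _ h2; rewrite !fmul1_cat; apply: tens_cat.
- by move=> s t; rewrite !fmul1_cat; apply: tens_catC.
- by move=> x; rewrite /fmul /= mulr0; apply: tens_0l.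
- by move=> b c x; rewrite /fmul /= mulrDr; apply: tens_Dl.
- by move=> b x y; rewrite /fmul /= mulrDr; apply: tens_Dr.
- by move=> b c x; rewrite /fmul /= mulrA mulrCA; apply: tens_bal.
Qed.

Lemma fmul_eq s1 s2 t1 t2 :
  tens_eq s1 s2 -> tens_eq t1 t2 -> tens_eq (fmul s1 t1) (fmul s2 t2).
Proof.
move=> h1 h2; apply: tens_trans (fmul_eqr s2 h2).
apply: tens_trans (fmulC _ _); apply: tens_trans (fmul_eqr t1 h1).
exact: fmulC.
Qed.

Lemma fmulA s t u : fmul s (fmul t u) = fmul (fmul s t) u.
Proof.
elim: s => //= p s IHs.
rewrite (fmul_cons p s (fmul t u)) (fmul_cons p s t) fmul_catl -IHs; congr (_ ++ _).
elim: t {IHs} => //= q t IHt.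
rewrite (fmul_cons q t) fmul1_cat IHt -[q :: t]cat1s.
rewrite (fmul1_cat p [:: q] t) (fmul_catl _ (fmul [:: p] t)).
congr (_ ++ _); rewrite /fmul /= !cats0 -map_comp.
by apply: eq_map => x /=; rewrite !mulrA.
Qed.

Definition tens_zero : tens := lift_cst tens [::].
Definition tens_add := lift_op2 tens (fun s t : fsum => s ++ t).
Definition tens_opp := lift_op1 tens fopp.
Definition tens_one : tens := lift_cst tens [:: (1, 1)].
Definition tens_mul := lift_op2 tens fmul.

Lemma repr_eq (s : fsum) : tens_eq (repr (\pi_tens s)) s.
Proof. by apply/tensP; rewrite reprK. Qed.

Lemma pi_tens_add s t : \pi_tens (s ++ t) = tens_add (\pi s) (\pi t).
Proof. by unlock tens_add; apply/tens_piP/tens_sym/tens_cat; apply: repr_eq. Qed.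

Lemma pi_tens_opp s : \pi_tens (fopp s) = tens_opp (\pi s).
Proof. by unlock tens_opp; apply/tens_piP/tens_sym/fopp_eq/repr_eq. Qed.

Lemma pi_tens_mul s t : \pi_tens (fmul s t) = tens_mul (\pi s) (\pi t).
Proof. by unlock tens_mul; apply/tens_piP/tens_sym/fmul_eq; apply: repr_eq. Qed.

Lemma pi_tens_zero : \pi_tens [::] = tens_zero.
Proof. by unlock tens_zero. Qed.

Lemma pi_tens_one : \pi_tens [:: (1, 1)] = tens_one.
Proof. by unlock tens_one. Qed.

Lemma tens_addA : associative tens_add.
Proof.
elim/quotW=> s; elim/quotW=> t; elim/quotW=> u.
by rewrite -!pi_tens_add catA.
Qed.

Lemma tens_addC : commutative tens_add.
Proof.
elim/quotW=> s; elim/quotW=> t; rewrite -!pi_tens_add.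
exact/tens_piP/tens_catC.
Qed.

Lemma tens_add0 : left_id tens_zero tens_add.
Proof. by elim/quotW=> s; rewrite -pi_tens_zero -pi_tens_add. Qed.

Lemma tens_addN : left_inverse tens_zero tens_opp tens_add.
Proof.
elim/quotW=> s; rewrite -pi_tens_opp -pi_tens_add -pi_tens_zero.
exact/tens_piP/fopp_cat.
Qed.

Lemma tens_mulA : associative tens_mul.
Proof.
elim/quotW=> s; elim/quotW=> t; elim/quotW=> u.
by rewrite -!pi_tens_mul fmulA.
Qed.

Lemma tens_mulC : commutative tens_mul.
Proof.
elim/quotW=> s; elim/quotW=> t; rewrite -!pi_tens_mul.
exact/tens_piP/fmulC.
Qed.

Lemma tens_mul1 : left_id tens_one tens_mul.
Proof.
elim/quotW=> s; rewrite -pi_tens_one -pi_tens_mul /fmul /= cats0.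
by congr \pi; rewrite -[RHS]map_id; apply: eq_map => -[a r]; rewrite !mul1r.
Qed.

Lemma tens_mulDl : left_distributive tens_mul tens_add.
Proof.
elim/quotW=> s; elim/quotW=> t; elim/quotW=> u.
by rewrite -!pi_tens_mul -!pi_tens_add -!pi_tens_mul fmul_catl.
Qed.

HB.instance Definition _ :=
  GRing.isZmodule.Build tens tens_addA tens_addC tens_add0 tens_addN.
HB.instance Definition _ :=
  GRing.Zmodule_isComPzRing.Build tens tens_mulA tens_mulC tens_mul1 tens_mulDl.

Definition tens_str (a : K) : tens := \pi_tens [:: (a, 1)].

Lemma tens_str_zmod : zmod_morphism tens_str.
Proof.
move=> a b; rewrite /tens_str.
rewrite -[RHS]/(tens_add _ (tens_opp _)) -pi_tens_opp -pi_tens_add.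
exact/tens_piP/tens_Dl.
Qed.

Lemma tens_str_monoid : monoid_morphism tens_str.
Proof.
split=> [|a b]; rewrite /tens_str; first exact: pi_tens_one.
by rewrite -[RHS]/(tens_mul _ _) -pi_tens_mul /fmul /= mulr1.
Qed.

HB.instance Definition _ :=
  GRing.isZmodMorphism.Build K tens tens_str tens_str_zmod.
HB.instance Definition _ :=
  GRing.isMonoidMorphism.Build K tens tens_str tens_str_monoid.

Definition tensor : calg K := @CAlg K tens tens_str.

End Tensor.

(* Main.v *)
(* Let S = K (x) R be given by coordinates x, y, z with xy = phi(z), deg phi = d,
   and let D be a nonzero locally nilpotent derivation of R, extended to S.

   Straightening.  Write S in K[u, v] via x = u^d, y = v^d, z = uv, and give
   x, y, z the weights equal to their D-degrees.  The leading form of D is then a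
   locally nilpotent homogeneous vector field on the plane; if D x and D y are
   nonzero, divisibility properties of its components show that, up to exchanging
   x and y, the leading coefficient of z is a scalar multiple of a power of that
   of x.  So z can be replaced by z - l x^s, of smaller D-degree, and after
   finitely many steps D x = 0.

   Descent.  A k-linear functional K -> k fixing 1 induces an R-linear retraction
   pi : S -> R commuting with D.  When D x = 0, the kernel of D is K[x] and the
   kernel of D^2 is K[x] + K[x] z (with y in place of z if d = 1); both are stable
   under pi.  A trace argument on the quotients of K[X] by two polynomials differing
   by a constant shows that K[x] contains a pi-fixed polynomial of degree 1, i.e.
   a x + b is in R; likewise c z + A(x) is in R for some c, A.  The conductor into
   K[x, z] of an element of R outside K[x, z] is generated by a power of x, which
   forces b to lie in k; the new y and the coefficients of phi then descend too.

   Conversely, the derivation X d/dZ + phi'(Z) d/dY shows that the Makar-Limanov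
   invariant of XY = phi(Z) is not the whole ring. *)
Require Import Defs.
From HB Require Import structures.
From mathcomp Require Import all_boot all_algebra.
From mathcomp Require Import boolp classical_sets.
From mathcomp Require Import mpoly.
From mathcomp Require Import ring zify.

Set Implicit Arguments.
Unset Strict Implicit.
Unset Printing Implicit Defensive.

Import GRing.Theory.
Local Open Scope ring_scope.

(** * Degrees with respect to a derivation *)

Section DerivationDegree.

Variables (K : fieldType) (charK : [pchar K] =i pred0).
Variables (A : idomainType) (str : {rmorphism K -> A}).
Variables (D : {additive A -> A}) (derD : is_derivation D).

Definition dle n (a : A) := iter n.+1 D a = 0.

(** Dividing by the factorial makes leading coefficients multiplicative: it cancels the binomial in
    the top term of the Leibniz formula. *)
Definition lead n (a : A) : A := str (n`!%:R^-1) * iter n D a.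

Lemma natrK_neq0 n : n.+1%:R != 0 :> K.
Proof. by move/pcharf0P: charK => ->. Qed.

Lemma factK_neq0 n : n`!%:R != 0 :> K.
Proof. by have := fact_gt0 n; case: n`! => // m _; exact: natrK_neq0. Qed.

Lemma str_eq0 c : (str c == 0) = (c == 0).
Proof. exact: fmorph_eq0. Qed.

Lemma natrA_neq0 n : n.+1%:R != 0 :> A.
Proof. by rewrite -(rmorph_nat str) str_eq0 natrK_neq0. Qed.

Lemma iterD0 n : iter n D 0 = 0.
Proof. by elim: n => //= n ->; rewrite raddf0. Qed.

Lemma iterDD n a b : iter n D (a + b) = iter n D a + iter n D b.
Proof. by elim: n => //= n ->; rewrite raddfD. Qed.

Lemma iterDM n a b :
  iter n D (a * b) =
  \sum_(i < n.+1) (iter i D a * iter (n - i) D b) *+ 'C(n, i).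
Proof.
elim: n => [|n IHn]; first by rewrite big_ord1 /= bin0 mulr1n.
rewrite iterS IHn raddf_sum /=.
rewrite (eq_bigr (fun i : 'I_n.+1 =>
    (iter i.+1 D a * iter (n - i) D b) *+ 'C(n, i)
    + (iter i D a * iter (n.+1 - i) D b) *+ 'C(n, i))); last first.
  by move=> i _; rewrite raddfMn derD mulrnDl subSn // -ltnS ltn_ord.
rewrite big_split /= [X in X + _ = _]big_ord_recr [X in _ + X = _]big_ord_recl.
rewrite [RHS]big_ord_recl [in RHS]big_ord_recr /= !subnn !bin0 !binn.
rewrite /bump /= ?add1n ?subnn ?binn ?add0n.
set S1 := \sum_(i < n) _; set S2 := \sum_(i < n) _; set S3 := \sum_(i < n) _.
have -> : S3 = S1 + S2.
  rewrite -big_split; apply: eq_bigr => i _ /=.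
  by rewrite add0n add1n subSS binS mulrnDr addrC.
by rewrite !mulr1n; ring.
Qed.

Lemma dleD n a b : dle n a -> dle n b -> dle n (a + b).
Proof. by rewrite /dle iterDD => -> ->; rewrite addr0. Qed.

Lemma dle0 n : dle n 0. Proof. exact: iterD0. Qed.

Lemma iterD_gt n m a : dle n a -> (n < m)%N -> iter m D a = 0.
Proof. by move=> an nm; rewrite -(subnK nm) iterD an iterD0. Qed.

Lemma dle_mono n m a : dle n a -> (n <= m)%N -> dle m a.
Proof. by move=> an nm; apply: iterD_gt an _. Qed.

Lemma iterDM_top n m a b : dle n a -> dle m b ->
  iter (n + m) D (a * b) = (iter n D a * iter m D b) *+ 'C(n + m, n).
Proof.
move=> an bm; rewrite iterDM.
have lt_n : (n < (n + m).+1)%N by rewrite ltnS leq_addr.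
rewrite (bigD1 (Ordinal lt_n)) //= addKn big1 ?addr0 // => i.
rewrite -val_eqE /= => ni; case: (ltngtP n i) ni => // lt_ni _.
  by rewrite (iterD_gt an lt_ni) mul0r mul0rn.
by rewrite (iterD_gt bm) ?mulr0 ?mul0rn //; have := ltn_ord i; lia.
Qed.

Lemma dleM n m a b : dle n a -> dle m b -> dle (n + m) (a * b).
Proof.
move=> an bm; rewrite /dle iterDM big1 // => i _.
case: (ltnP n i) => lt_ni; first by rewrite (iterD_gt an lt_ni) mul0r mul0rn.
by rewrite (iterD_gt bm) ?mulr0 ?mul0rn //; have := ltn_ord i; lia.
Qed.

Lemma lead0 n : lead n 0 = 0.
Proof. by rewrite /lead iterD0 mulr0. Qed.

Lemma leadD n a b : lead n (a + b) = lead n a + lead n b.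
Proof. by rewrite /lead iterDD mulrDr. Qed.

Lemma lead_sum n I (r : seq I) (P : pred I) F :
  lead n (\sum_(i <- r | P i) F i) = \sum_(i <- r | P i) lead n (F i).
Proof. by apply: (big_morph (lead n) (leadD n) (lead0 n)). Qed.

Lemma lead_gt n m a : dle n a -> (n < m)%N -> lead m a = 0.
Proof. by move=> an nm; rewrite /lead (iterD_gt an nm) mulr0. Qed.

Lemma lead_eq0 n a : (lead n a == 0) = (iter n D a == 0).
Proof.
by rewrite /lead mulf_eq0 str_eq0 invr_eq0 (negbTE (factK_neq0 n)).
Qed.

Lemma leadM n m a b : dle n a -> dle m b ->
  lead (n + m) (a * b) = lead n a * lead m b.
Proof.
move=> an bm; rewrite /lead iterDM_top // mulrACA -rmorphM /= -[(_ * _) *+ _]mulr_natl.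
rewrite -(rmorph_nat str) mulrA -rmorphM /=; congr (str _ * _).
apply: (mulfI (factK_neq0 (n + m))).
rewrite mulrA divff ?factK_neq0 // mul1r.
have -> : (n + m)`!%:R = 'C(n + m, n)%:R * (n`!%:R * m`!%:R) :> K.
  by rewrite -!natrM -(@bin_fact (n + m) n) ?leq_addr // addKn.
by field; rewrite !factK_neq0.
Qed.

Lemma dle_pred n a : dle n.+1 a -> lead n.+1 a = 0 -> dle n a.
Proof. by move=> _ /eqP; rewrite lead_eq0 => /eqP. Qed.

Lemma D1 : D 1 = 0.
Proof.
have := derD 1 1; rewrite mulr1 mulr1 mul1r => /eqP.
by rewrite -subr_eq0 opprD addrA subrr sub0r oppr_eq0 => /eqP.
Qed.

Lemma dle1 : dle 0 1. Proof. exact: D1. Qed.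

Lemma lead1 : lead 0 1 = 1.
Proof. by rewrite /lead /= fact0 invr1 rmorph1 mulr1. Qed.

Lemma dleX n a k : dle n a -> dle (k * n) (a ^+ k).
Proof.
move=> an; elim: k => [|k IHk]; first exact: dle1.
by rewrite exprS mulSn; apply: dleM.
Qed.

Lemma leadX n a k : dle n a -> lead (k * n) (a ^+ k) = lead n a ^+ k.
Proof.
move=> an; elim: k => [|k IHk]; first exact: lead1.
by rewrite !exprS mulSn leadM ?IHk //; apply: dleX.
Qed.

Lemma dle_ker a : D a = 0 -> dle 0 a. Proof. by []. Qed.

Lemma lead_D n a : lead n (D a) = n.+1%:R * lead n.+1 a.
Proof.
have E : n`!%:R^-1 = n.+1%:R * (n.+1)`!%:R^-1 :> K.
  by rewrite factS natrM invfM mulrA divff ?mul1r ?natrK_neq0.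
by rewrite /lead -iterSr E rmorphM rmorph_nat mulrA.
Qed.

Lemma lead_0 a : lead 0 a = a.
Proof. by rewrite /lead /= fact0 invr1 rmorph1 mul1r. Qed.


(** Exact degree, as a relation: 0 has no degree, and local nilpotency is only needed for
    existence. *)
Definition dg n a := dle n a /\ lead n a != 0.

Lemma dg_neq0 n a : dg n a -> a != 0.
Proof. by case=> _; apply: contraNneq => ->; rewrite lead0. Qed.

Lemma dg_exists n a : iter n D a = 0 -> a != 0 -> exists m, dg m a.
Proof.
elim: n => [/= ->|n IHn]; first by rewrite eqxx.
move=> an a0; case: (eqVneq (iter n D a) 0) => [/IHn/(_ a0) //|nz].
by exists n; split=> //; rewrite lead_eq0.
Qed.

Lemma dg_leq n m a : dg n a -> dle m a -> (n <= m)%N.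
Proof.
case=> _ nz am; rewrite leqNgt; apply: contra nz => lt_mn.
by rewrite (lead_gt am).
Qed.

Lemma dg_uniq n m a : dg n a -> dg m a -> n = m.
Proof.
move=> an am; apply/eqP; rewrite eqn_leq.
by rewrite (dg_leq an am.1) (dg_leq am an.1).
Qed.

Lemma dgM n m a b : dg n a -> dg m b -> dg (n + m) (a * b).
Proof.
case=> an nza [bm nzb]; split; first exact: dleM.
by rewrite leadM // mulf_neq0.
Qed.

Lemma dgX n a k : dg n a -> dg (k * n) (a ^+ k).
Proof.
by case=> an nz; split; [apply: dleX | rewrite leadX // expf_neq0].
Qed.

Lemma dg1 : dg 0 1.
Proof. by split; [exact: dle1 | rewrite lead1 oner_neq0]. Qed.

Lemma dg_D n a : dg n.+1 a -> dg n (D a).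
Proof.
case=> an nz; split; first by rewrite /dle -iterSr.
by move: nz; rewrite !lead_eq0 iterSr.
Qed.

Lemma dle_dg n a : dle n a -> a != 0 -> exists2 m, (m <= n)%N & dg m a.
Proof.
by move=> an /(dg_exists an)[m am]; exists m => //; apply: dg_leq an.
Qed.

Lemma dg0_ker a : dg 0 a -> D a = 0. Proof. by case. Qed.

(* Units have degree 0. *)
Lemma D_str : locally_nilpotent D -> forall c, D (str c) = 0.
Proof.
move=> lnD c; case: (eqVneq c 0) => [->|nz]; first by rewrite !raddf0.
have [n dgn] : exists n, dg n (str c).
  by have [n] := lnD (str c); move/dg_exists; apply; rewrite str_eq0.
have [m dgm] : exists m, dg m (str c^-1).
  by have [m] := lnD (str c^-1); move/dg_exists; apply; rewrite str_eq0 invr_eq0.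
have := dgM dgn dgm; rewrite -rmorphM divff // rmorph1 => /dg_uniq/(_ dg1)/eqP.
by rewrite addn_eq0 => /andP[/eqP n0 _]; apply: dg0_ker; rewrite -n0.
Qed.

(** Nilpotency is kept element by element because the plane fields below are only known to be
    nilpotent on polynomials in [u^d], [v^d] and [uv]. *)
Definition nilp a := exists n, iter n D a = 0.

Lemma nilp_dle a : nilp a <-> exists n, dle n a.
Proof.
split=> [][n an]; last by exists n.+1.
by exists n; rewrite /dle iterS an raddf0.
Qed.

Lemma nilpD a b : nilp a -> nilp b -> nilp (a + b).
Proof.
move=> /nilp_dle[n an] /nilp_dle[m bm]; apply/nilp_dle; exists (maxn n m).
by apply: dleD; [apply: dle_mono an _ | apply: dle_mono bm _];
  rewrite ?leq_maxl ?leq_maxr.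
Qed.

Lemma nilp0 : nilp 0. Proof. by exists 0%N. Qed.

Lemma nilpM a b : nilp a -> nilp b -> nilp (a * b).
Proof.
move=> /nilp_dle[n an] /nilp_dle[m bm]; apply/nilp_dle; exists (n + m)%N.
exact: dleM.
Qed.

Lemma nilp1 : nilp 1. Proof. by apply/nilp_dle; exists 0%N; exact: dle1. Qed.

Lemma nilpX a n : nilp a -> nilp (a ^+ n).
Proof.
by move=> na; elim: n => [|n IHn]; [exact: nilp1 | rewrite exprS; apply: nilpM].
Qed.

Lemma nilp_sum I (r : seq I) (P : pred I) F :
  (forall i, P i -> nilp (F i)) -> nilp (\sum_(i <- r | P i) F i).
Proof. by move=> nF; apply: big_ind => //; [exact: nilp0 | exact: nilpD]. Qed.

Lemma nilp_ker a : D a = 0 -> nilp a. Proof. by exists 1%N. Qed.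

Lemma derX a n : D (a ^+ n) = a ^+ n.-1 * D a *+ n.
Proof.
elim: n => [|[|n] IHn]; first by rewrite expr0 D1 mulr0n.
  by rewrite expr1 expr0 mul1r.
rewrite exprS derD IHn /= [in RHS]mulrS [D a * _]mulrC; congr (_ + _).
by rewrite mulrnAr mulrA exprS.
Qed.

End DerivationDegree.

(** * Algebraic closedness of the base field *)

Section Homogenization.

Variables (K : fieldType) (A : idomainType) (str : {rmorphism K -> A}).

Definition hform M (F : {poly K}) (u v : A) : A :=
  \sum_(l < M.+1) str F`_l * u ^+ l * v ^+ (M - l).

(** Since [hform M F u v] is [v^M F(u/v)], this says that [K] is algebraically closed in the
    fraction field of [A], without forming fractions. *)
Definition alg_closed_in :=
  forall M (F : {poly K}) (u v : A), v != 0 -> F != 0 ->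
    (size F <= M.+1)%N -> hform M F u v = 0 -> exists l : K, u = str l * v.

Lemma hform_factor M (G : {poly K}) l u v : (size G <= M.+1)%N ->
  hform M.+1 (('X - l%:P) * G) u v = (u - str l * v) * hform M G u v.
Proof.
move=> sG; rewrite /hform.
rewrite (eq_bigr (fun i : 'I_M.+2 =>
   str ('X * G)`_i * u ^+ i * v ^+ (M.+1 - i)
   - str l * (str G`_i * u ^+ i * v ^+ (M.+1 - i)))); last first.
  by move=> i _; rewrite mulrBl coefB coefCM rmorphB rmorphM /=; ring.
rewrite sumrB big_ord_recl coefXM /= rmorph0 !mul0r add0r.
rewrite -mulr_sumr [X in _ - _ * X]big_ord_recr /= (nth_default _ sG) rmorph0 !mul0r addr0.
rewrite mulrBl; congr (_ - _).
  rewrite mulr_sumr; apply: eq_bigr => i _.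
  by rewrite coefXM /= /bump /= add1n subSS exprS /=; ring.
rewrite -mulrA; congr (_ * _); rewrite mulr_sumr; apply: eq_bigr => i _.
rewrite subSn -1?ltnS ?ltn_ord // exprS; ring.
Qed.

Lemma hform_top M (F : {poly K}) u v : (size F <= M.+1)%N ->
  hform M.+1 F u v = v * hform M F u v.
Proof.
move=> sF; rewrite /hform big_ord_recr /= (nth_default _ sF) rmorph0 !mul0r addr0.
rewrite mulr_sumr; apply: eq_bigr => i _.
by rewrite subSn -1?ltnS ?ltn_ord // exprS; ring.
Qed.

Lemma hform_scale M (F : {poly K}) l v :
  hform M F (str l * v) v = str (\sum_(i < M.+1) F`_i * l ^+ i) * v ^+ M.
Proof.
rewrite /hform rmorph_sum mulr_suml; apply: eq_bigr => i _.
have le_iM : (i <= M)%N by rewrite -ltnS ltn_ord.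
have -> : v ^+ M = v ^+ i * v ^+ (M - i) by rewrite -exprD subnKC.
by rewrite exprMn !rmorphM rmorphXn /=; ring.
Qed.

Lemma hform_sumX M I (r : seq I) (k : I -> K) (e : I -> nat) u v :
  (forall i, e i <= M)%N ->
  hform M (\sum_(i <- r) k i *: 'X^(e i)) u v =
  \sum_(i <- r) str (k i) * u ^+ e i * v ^+ (M - e i).
Proof.
move=> eM; rewrite /hform; under eq_bigr => l _ do
  rewrite coef_sum rmorph_sum !mulr_suml.
rewrite exchange_big /=; apply: eq_bigr => i _.
have lt_e : (e i < M.+1)%N by rewrite ltnS.
rewrite (bigD1 (Ordinal lt_e)) //= coefZ coefXn eqxx mulr1 big1 ?addr0 // => l.
rewrite -val_eqE /= => ne; rewrite coefZ coefXn (negbTE ne) mulr0 rmorph0.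
by rewrite !mul0r.
Qed.

End Homogenization.

Lemma alg_closed_in_field (K : fieldType) : alg_closed_in (idfun : {rmorphism K -> K}).
Proof. by move=> M F u v v0 _ _ _; exists (u / v); rewrite /= divfK. Qed.

(** The coefficients of [u] and [v] at a common degree bound [N] satisfy the same form. If that of
    [v] vanishes, the form loses its top coefficient; otherwise their ratio is a root of [F] in [K],
    and a linear factor splits off. Either way the degree of the form drops, unless the linear
    factor itself vanishes. *)
Lemma alg_closed_in_poly (K : fieldType) (A : idomainType)
    (str : {rmorphism K -> A}) (str' : {rmorphism K -> {poly A}}) :
  (forall c, str' c = (str c)%:P) -> alg_closed_in str -> alg_closed_in str'.
Proof.
move=> strE acA; elim=> [|M IHM] F u v v0 F0 sF.
  rewrite /hform big_ord1 !expr0 !mulr1 strE => /eqP.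
  rewrite polyC_eq0 fmorph_eq0 => F00; case/eqP: F0; apply/polyP=> -[|i].
    by rewrite coef0 (eqP F00).
  by rewrite coef0 nth_default // (leq_trans sF).
move=> FE; pose N := maxn (size u).-1 (size v).-1.
have sN (w : {poly A}) : ((size w).-1 <= N)%N -> forall k,
    (size (w ^+ k) <= (k * N).+1)%N /\ (w ^+ k)`_(k * N) = w`_N ^+ k.
  move=> wN; elim=> [|k [IH1 IH2]]; first by rewrite expr0 size_poly1 coef1.
  have sw : (size w <= N.+1)%N by lia.
  split.
    by rewrite exprS; apply: leq_trans (size_polyMleq _ _) _; lia.
  rewrite exprS coefM mulSn.
  have lt_N : (N < (N + k * N).+1)%N by rewrite ltnS leq_addr.
  rewrite (bigD1 (Ordinal lt_N)) //= addKn IH2 big1 ?addr0 ?exprS // => i.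
  rewrite -val_eqE /= => iN; case: (ltngtP N i) iN => // lt_iN _.
    by rewrite (nth_default _ (leq_trans sw lt_iN)) mul0r.
  by rewrite (nth_default _ (leq_trans IH1 _)) ?mulr0 //; have := ltn_ord i; lia.
have uN := leq_maxl (size u).-1 (size v).-1.
have vN := leq_maxr (size u).-1 (size v).-1.
have topE : hform str M.+1 F u`_N v`_N = 0.
  have := congr1 (fun p : {poly A} => p`_(M.+1 * N)) FE; rewrite coef0 => E0.
  rewrite -[RHS]E0 coef_sum; apply: eq_bigr => i _; rewrite strE -!mulrA coefCM.
  congr (_ * _); have le_i : (i <= M.+1)%N by rewrite -ltnS ltn_ord.
  have -> : (M.+1 * N = i * N + (M.+1 - i) * N)%N by rewrite -mulnDl subnKC.
  rewrite coefM.
  have lt_i : (i * N < (i * N + (M.+1 - i) * N).+1)%N by rewrite ltnS leq_addr.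
  have [s1 c1] := sN u uN i; have [s2 c2] := sN v vN (M.+1 - i)%N.
  rewrite (bigD1 (Ordinal lt_i)) //= addKn c1 c2 big1 ?addr0 // => j.
  rewrite -val_eqE /= => ji; case: (ltngtP (i * N) j) ji => // lt_ji _.
    by rewrite (nth_default _ (leq_trans s1 lt_ji)) mul0r.
  by rewrite (nth_default _ (leq_trans s2 _)) ?mulr0 //; have := ltn_ord j; lia.
case: (eqVneq v`_N 0) => [vN0|vN0].
  have uN0 : u`_N != 0.
    have [E|E] : N = (size u).-1 \/ N = (size v).-1 by rewrite /N; lia.
      rewrite E -lead_coefE lead_coef_eq0; apply/eqP => u0.
      move: vN0; rewrite E u0 size_poly0 /=.
      have -> : 0%N = (size v).-1 by move: vN; rewrite -/N E u0 size_poly0 leqn0 => /eqP.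
      by rewrite -lead_coefE => /eqP; rewrite lead_coef_eq0 (negbTE v0).
    by move/eqP: vN0; rewrite E -lead_coefE lead_coef_eq0 (negbTE v0).
  move: topE; rewrite /hform big_ord_recr /= vN0 big1 ?add0r => [|i _]; last first.
    by rewrite subSn -1?ltnS ?ltn_ord // exprS mul0r mulr0.
  rewrite subnn expr0 mulr1 => /eqP; rewrite mulf_eq0 expf_eq0 (negbTE uN0) andbF.
  rewrite orbF fmorph_eq0 => FM0.
  have sF' : (size F <= M.+1)%N.
    rewrite leqNgt; apply/negP => lt_F; have sFE : size F = M.+2 by lia.
    by move: FM0; rewrite -[M.+1]/(M.+2.-1) -sFE -lead_coefE lead_coef_eq0 (negbTE F0).
  apply: (IHM F) => //; move: FE; rewrite hform_top // => /eqP.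
  by rewrite mulf_eq0 (negbTE v0) => /eqP.
have [l ul] := acA _ _ _ _ vN0 F0 sF topE.
move: topE; rewrite ul hform_scale => /eqP.
rewrite mulf_eq0 expf_eq0 (negbTE vN0) andbF orbF fmorph_eq0.
rewrite -(horner_coef_wide _ sF) => /factor_theorem[G FG].
rewrite mulrC in FG; have G0 : G != 0 by apply: contraNneq F0 => G0; rewrite FG G0 mulr0.
have sG : (size G <= M.+1)%N.
  by move: sF; rewrite FG mulrC size_Mmonic ?monicXsubC // size_XsubC addn2.
move: FE; rewrite FG hform_factor // => /eqP; rewrite mulf_eq0 subr_eq0.
by case/orP=> [/eqP uE|/eqP /IHM]; [exists l | apply].
Qed.

(** * Danielewski coordinates *)

Lemma map_poly_MXaddC (A B : nzRingType) (g : {rmorphism A -> B}) p c :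
  map_poly g (p * 'X + c%:P) = map_poly g p * 'X + (g c)%:P.
Proof. by rewrite rmorphD rmorphM /= map_polyX map_polyC. Qed.

Section Coordinates.

Variables (K : fieldType) (S : idomainType) (str : {rmorphism K -> S}).

Lemma comm_str (t : S) : commr_rmorph str t.
Proof. by move=> c; exact: mulrC. Qed.

Definition ev1 (t : S) : {poly K} -> S := horner_morph (comm_str t).
HB.instance Definition _ t :=
  GRing.RMorphism.copy (ev1 t) (horner_morph (comm_str t)).

Lemma comm_ev1 (x z : S) : commr_rmorph (ev1 x) z.
Proof. by move=> c; exact: mulrC. Qed.

(* The outer variable is evaluated at z and the inner one at x. *)
Definition ev2 (x z : S) : {poly {poly K}} -> S := horner_morph (comm_ev1 x z).
HB.instance Definition _ x z :=
  GRing.RMorphism.copy (ev2 x z) (horner_morph (comm_ev1 x z)).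

Lemma ev1C t c : ev1 t c%:P = str c.
Proof. exact: horner_morphC. Qed.

Lemma ev1X t : ev1 t 'X = t.
Proof. exact: horner_morphX. Qed.

Lemma ev1Z t c P : ev1 t (c *: P) = str c * ev1 t P.
Proof. by rewrite -mul_polyC rmorphM /= ev1C. Qed.

Lemma ev1E t P : ev1 t P = \sum_(i < size P) str P`_i * t ^+ i.
Proof.
rewrite -{1}[P]coefK poly_def rmorph_sum; apply: eq_bigr => i _.
by rewrite /= ev1Z rmorphXn /= ev1X.
Qed.

Lemma ev2C x z c : ev2 x z c%:P = ev1 x c.
Proof. exact: horner_morphC. Qed.

Lemma ev2X x z : ev2 x z 'X = z.
Proof. exact: horner_morphX. Qed.

Lemma ev1_MXaddC t P c : ev1 t (P * 'X + c%:P) = ev1 t P * t + str c.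
Proof. by rewrite rmorphD rmorphM /= ev1X ev1C. Qed.

Lemma ev2_MXaddC x z P c : ev2 x z (P * 'X + c%:P) = ev2 x z P * z + ev1 x c.
Proof. by rewrite rmorphD rmorphM /= ev2X ev2C. Qed.

Lemma ev2_map x z P : ev2 x z (map_poly polyC P) = ev1 z P.
Proof.
elim/poly_ind: P => [|P c IH]; first by rewrite !rmorph0.
by rewrite !rmorphD !rmorphM /= IH map_polyX map_polyC /= ev2X ev1X ev2C !ev1C.
Qed.

Lemma ev1_comp t P Q : ev1 t (P \Po Q) = ev1 (ev1 t Q) P.
Proof.
elim/poly_ind: P => [|P c IH]; first by rewrite comp_poly0 !rmorph0.
by rewrite comp_polyD comp_polyM comp_polyX comp_polyC !rmorphD !rmorphM /= IH
  !ev1C ev1X.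
Qed.

Definition generated (G : S -> Prop) := forall B : S -> Prop,
  (forall c, B (str c)) -> (forall a, G a -> B a) ->
  (forall a b, B a -> B b -> B (a + b)) ->
  (forall a b, B a -> B b -> B (a * b)) -> forall a, B a.

Definition gens (x y z : S) : S -> Prop := fun a => [\/ a = x, a = y | a = z].

(** These clauses make [S] the ring of the surface [XY = phi(Z)]: in the presence of the relation,
    independence of [x] and [z] excludes any further one. Taking [phi] monic is harmless, as [y] can
    be rescaled. *)
Record system (phi : {poly K}) (x y z : S) : Prop := System {
  sys_size : (1 < size phi)%N;
  sys_monic : phi \is monic;
  sys_rel : x * y = ev1 z phi;
  sys_gen : generated (gens x y z);
  sys_free : forall P, ev2 x z P = 0 -> P = 0 }.

End Coordinates.

Arguments gens {S}.

(** * Balanced monomials in two variables and normal words *)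

Definition i0 : 'I_2 := ord0.
Definition i1 : 'I_2 := lift ord0 ord0.

Lemma I2P (i : 'I_2) : i = i0 \/ i = i1.
Proof.
by case: i => -[|[|//]] lt; [left | right]; apply: val_inj.
Qed.

Lemma mnm2P (m m' : 'X_{1..2}) : m i0 = m' i0 -> m i1 = m' i1 -> m = m'.
Proof. by move=> e0 e1; apply/mnmP => i; case: (I2P i) => ->. Qed.

Definition mnm2 a b : 'X_{1..2} := [multinom if i == i0 then a else b | i < 2].

Lemma mnm2_0 a b : mnm2 a b i0 = a. Proof. by rewrite mnmE eqxx. Qed.
Lemma mnm2_1 a b : mnm2 a b i1 = b. Proof. by rewrite mnmE. Qed.

Section Standard.

Variables (K : fieldType) (S : idomainType) (str : {rmorphism K -> S}).
Variables (d : nat) (d_gt0 : (0 < d)%N).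

(** The monomials generated by [u^d], [v^d] and [uv], that is, the invariants of a cyclic group of
    order [d]. *)
Definition balanced (m : 'X_{1..2}) := m i0 = m i1 %[mod d].

(** Normal words avoid the product [x y], so each one involves [x, z] or [y, z] only. The quotients
    are exact for balanced exponents; other exponents get a value without meaning. *)
Definition mon (x y z : S) (m : 'X_{1..2}) : S :=
  if (m i1 <= m i0)%N then x ^+ ((m i0 - m i1) %/ d) * z ^+ m i1
  else y ^+ ((m i1 - m i0) %/ d) * z ^+ m i0.

Definition evm (x y z : S) (f : {mpoly K[2]}) : S :=
  \sum_(m <- msupp f) str f@_m * mon x y z m.

Lemma evm_wide x y z f r : uniq r -> {subset msupp f <= r} ->
  evm x y z f = \sum_(m <- r) str f@_m * mon x y z m.
Proof.
move=> ur sfr; rewrite [RHS](bigID (fun m => m \in msupp f)) /= [X in _ + X]big1 ?addr0.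
  rewrite -big_filter; apply: perm_big; apply: uniq_perm.
  - exact: msupp_uniq.
  - exact: filter_uniq.
  by move=> m; rewrite mem_filter; case: (boolP (m \in msupp f)) => // /sfr ->.
by move=> m /memN_msupp_eq0 ->; rewrite rmorph0 mul0r.
Qed.

Lemma evmD x y z f g : evm x y z (f + g) = evm x y z f + evm x y z g.
Proof.
pose r := undup (msupp f ++ msupp g); have ur : uniq r by apply: undup_uniq.
rewrite (@evm_wide x y z f r) // ?(@evm_wide x y z g r) //.
- rewrite (@evm_wide x y z (f + g) r) // -?big_split => [|m /msuppD_le].
    by apply: eq_bigr => m _; rewrite mcoeffD rmorphD mulrDl.
  by rewrite mem_undup.
- by move=> m mg; rewrite mem_undup mem_cat mg orbT.
by move=> m mf; rewrite mem_undup mem_cat mf.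
Qed.

Lemma evmZ x y z c f : evm x y z (c *: f) = str c * evm x y z f.
Proof.
rewrite (evm_wide _ _ _ (msupp_uniq f)) => [|m]; last exact: msuppZ_le.
by rewrite mulr_sumr; apply: eq_bigr => m _; rewrite mcoeffZ rmorphM mulrA.
Qed.

Lemma evm0 x y z : evm x y z 0 = 0.
Proof. by rewrite /evm msupp0 big_nil. Qed.

Lemma evm_mon x y z m : evm x y z 'X_[m] = mon x y z m.
Proof. by rewrite /evm msuppX big_seq1 mcoeffX eqxx rmorph1 mul1r. Qed.

(** The hypothesis fails for the coordinates of [S], where it holds up to lower weight, but it holds
    for their leading coefficients. *)
Lemma mon_mnm2 x y z a b j : x * y = z ^+ d ->
  mon x y z (mnm2 (d * a + j) (d * b + j)) = x ^+ a * y ^+ b * z ^+ j.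
Proof.
move=> xy; rewrite /mon mnm2_0 mnm2_1 leq_add2r leq_pmul2l //.
case: leqP => ab; rewrite subnDr -mulnBr mulKn // exprD exprM -xy exprMn.
  by rewrite -[in RHS](subnK ab) exprD; ring.
by rewrite -[in RHS](subnK (ltnW ab)) exprD; ring.
Qed.

End Standard.

Lemma seq_argmax (T : eqType) (F : T -> nat) (s : seq T) : s != [::] ->
  exists2 m, m \in s & forall m', m' \in s -> (F m' <= F m)%N.
Proof.
elim: s => // a s IHs _; case: (eqVneq s [::]) => [->|/IHs[m ms mmax]].
  by exists a => [|m']; rewrite ?mem_seq1 // => /eqP ->.
case: (leqP (F m) (F a)) => le; [exists a | exists m].
- by rewrite mem_head.
- by move=> m'; rewrite inE => /orP[/eqP -> //|/mmax le']; apply: leq_trans le.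
- by rewrite inE ms orbT.
by move=> m'; rewrite inE => /orP[/eqP ->|/mmax //]; apply: ltnW.
Qed.

(** * The filtration attached to a pair of weights, and its symbols *)

Section Symbols.

Variables (K : fieldType) (S : idomainType) (str : {rmorphism K -> S}).
Variables (phi : {poly K}) (x y z : S) (sys : system str phi x y z).

Local Notation d := (size phi).-1.
Local Notation evm := (evm str d).
Local Notation mon := (mon d).
Local Notation balanced := (balanced d).
Local Notation ev2 := (ev2 str).
Local Notation ev1 := (ev1 str).

Lemma deg_gt0 : (0 < d)%N.
Proof. by have := sys_size sys; case: (size phi) => [|[]]. Qed.

Lemma sys_x_neq0 : x != 0.
Proof.
apply/eqP => x0; have := sys_free sys (P := 'X%:P).
rewrite ev2C ev1X => /(_ x0)/eqP.
by rewrite polyC_eq0 polyX_eq0.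
Qed.

(** Multiplication by a power of [x] turns each normal word into a polynomial in the independent
    elements [x] and [z], monic in [z] of degree [m i1] up to a power of [x]. In the highest degree
    these powers of [x] are pairwise distinct, so nothing cancels. *)
Lemma evm_free f : (forall m, f@_m != 0 -> balanced m) ->
  evm x y z f = 0 -> f = 0.
Proof.
move=> bal f0; apply/eqP; rewrite -msupp_eq0; apply/negPn/negP => nz.
have [mx mxf mx_max] := seq_argmax (fun m : 'X_{1..2} => m i1) nz.
pose N := mx i1.
(* [x^N mon m] is [x^(e m)] times [H m]: every factor [y] uses up one [x] and becomes [phi(z)]. *)
pose e (m : 'X_{1..2}) := if (m i1 <= m i0)%N then (N + (m i0 - m i1) %/ d)%N
  else (N - (m i1 - m i0) %/ d)%N.
pose H (m : 'X_{1..2}) : {poly {poly K}} := if (m i1 <= m i0)%N then 'X^(m i1)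
  else (map_poly polyC phi) ^+ ((m i1 - m i0) %/ d) * 'X^(m i0).
have dvd m : m \in msupp f -> ((m i0 - m i1) %/ d * d = m i0 - m i1)%N /\
   ((m i1 - m i0) %/ d * d = m i1 - m i0)%N.
  rewrite mcoeff_msupp => /bal bm; split; apply/eqP; rewrite -dvdn_eq; last first.
    case: (leqP (m i0) (m i1)) => le; first by rewrite -eqn_mod_dvd // bm.
    by have /eqP-> : (m i1 - m i0 == 0)%N by rewrite subn_eq0 ltnW.
  case: (leqP (m i1) (m i0)) => le; first by rewrite -eqn_mod_dvd // bm.
  by have /eqP-> : (m i0 - m i1 == 0)%N by rewrite subn_eq0 ltnW.
have monH m : H m \is monic.
  rewrite /H; case: ifP => _; first exact: monicXn.
  by rewrite monicMl ?monicXn // monic_exp // monic_map // (sys_monic sys).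
have sH m : m \in msupp f -> size (H m) = (m i1).+1.
  move=> /dvd[_ dm]; rewrite /H; case: leqP => le; first by rewrite size_polyXn.
  have mphi : (map_poly polyC phi) \is monic by rewrite monic_map // (sys_monic sys).
  rewrite size_monicM ?monic_exp ?monic_neq0 ?monicXn // size_polyXn addnS /=.
  have /= := size_exp (map_poly polyC phi) ((m i1 - m i0) %/ d).
  rewrite size_map_polyC mulnC dm.
  have : (size ((map_poly polyC phi) ^+ ((m i1 - m i0) %/ d)) > 0)%N.
    by rewrite size_poly_gt0 monic_neq0 // monic_exp.
  by move: le; set Q := _ ^+ _; case: (size Q) => [|n] // lt _ /= ->; rewrite addSn subnK // ltnW.
have evG m : m \in msupp f -> ev2 x z (('X^(e m))%:P * H m) = x ^+ N * mon x y z m.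
  move=> mf; have /= le_N := mx_max m mf; have [_ dm] := dvd m mf.
  rewrite rmorphM /= ev2C rmorphXn /= ev1X /e /H /mon; case: leqP => le.
    by rewrite rmorphXn /= ev2X exprD mulrA.
  rewrite rmorphM !rmorphXn /= ev2X ev2_map -(sys_rel sys).
  have leN : ((m i1 - m i0) %/ d <= N)%N.
    by apply: leq_trans (leq_div _ _) (leq_trans (leq_subr _ _) le_N).
  by rewrite -[in RHS](subnK leN) exprD exprMn; ring.
have sum0 : \sum_(m <- msupp f) (f@_m)%:P%:P * (('X^(e m))%:P * H m) = 0.
  apply: (sys_free sys); rewrite rmorph_sum /= big_seq.
  rewrite (eq_bigr (fun m => x ^+ N * (str f@_m * mon x y z m))).
    by rewrite -big_seq -mulr_sumr -/(evm x y z f) f0 mulr0.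
  by move=> m mf; rewrite rmorphM /= evG // ev2C ev1C mulrCA.
have := congr1 (fun P : {poly {poly K}} => P`_N`_(e mx)) sum0.
rewrite !coef0 coef_sum coef_sum (bigD1_seq mx) ?msupp_uniq //= big1_seq ?addr0.
  rewrite !coefCM.
  have -> : (H mx)`_N = 1.
    by have /monicP := monH mx; rewrite lead_coefE sH.
  rewrite mulr1 coefXn eqxx mulr1 => /eqP.
  by rewrite (negbTE (_ : f@_mx != 0)) // -mcoeff_msupp.
move=> m /andP[ne mf]; rewrite !coefCM.
have := mx_max m mf; rewrite leq_eqVlt => /orP[/eqP eq1|lt]; last first.
  by rewrite [(H m)`_N]nth_default ?mulr0 ?coef0 ?mulr0 // sH.
have -> : (H m)`_N = 1.
  by have /monicP := monH m; rewrite lead_coefE sH // eq1.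
rewrite mulr1 coefXn; case: eqP => [ee|_]; last by rewrite mulr0.
(* Once [m i1] is fixed, [e m] is strictly monotone in [m i0] along balanced exponents, which leaves
   four comparisons of [m i0] with [m i1]. *)
case/eqP: ne; apply: mnm2P => //; move: ee; rewrite /e eq1.
have [] := dvd _ mf; have [] := dvd _ mxf; rewrite /N eq1.
have := leq_div (m i1 - m i0) d; have := leq_div (mx i1 - mx i0) d.
rewrite eq1; move: (m i0) (mx i0 : nat) (mx i1 : nat) d deg_gt0 => a b c e' e'_gt0.
set u := (_ %/ _)%N; set v := (_ %/ _)%N; set w := (_ %/ _)%N.
set t := (_ %/ _)%N => le1 le2 d1 d2 d3 d4.
case: leqP => l1; case: leqP => l2 ee.
- have E : t = w by lia.
  by move: d3; rewrite E d1; lia.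
- have u0 : u = 0%N by lia.
  have v0 : t = 0%N by lia.
  by move: d2 d3; rewrite u0 v0; lia.
- have u0 : v = 0%N by lia.
  have v0 : w = 0%N by lia.
  by move: d4 d1; rewrite u0 v0; lia.
have E : u = v by lia.
by move: d2; rewrite E d4; lia.
Qed.

End Symbols.

Section Filtration.

Variables (K : fieldType) (S : idomainType) (str : {rmorphism K -> S}).
Variables (phi : {poly K}) (x y z : S) (sys : system str phi x y z).

Local Notation d := (size phi).-1.
Local Notation evm := (evm str d).
Local Notation mon := (mon d).
Local Notation balanced := (balanced d).
Local Notation ev2 := (ev2 str).
Local Notation ev1 := (ev1 str).

Variables p q c : nat.

Definition wt (m : 'X_{1..2}) := (p * m i0 + q * m i1)%N.

(* sym n a T: the element a has weight at most n, and T is its component of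
   weight n, written in K[u, v] through x = u^d, y = v^d, z = uv. *)
Inductive sym : nat -> S -> {mpoly K[2]} -> Prop :=
| sym_word a b j : sym (a * p + b * q + j * c) (x ^+ a * y ^+ b * z ^+ j)
    'X_[mnm2 (d * a + j) (d * b + j)]
| sym_add n a b T T' : sym n a T -> sym n b T' -> sym n (a + b) (T + T')
| sym_scale n k a T : sym n a T -> sym n (str k * a) (k *: T)
| sym_lift n n' a T : sym n a T -> (n < n')%N -> sym n' a 0.

Lemma sym_0 n : sym n 0 0.
Proof.
have s0 : sym 0 0 0.
  by have := sym_scale 0 (sym_word 0 0 0); rewrite rmorph0 mul0r scale0r.
by case: n => // n; apply: sym_lift s0 _.
Qed.

Lemma sym_str k : sym 0 (str k) k%:MP.
Proof.
have := sym_scale k (sym_word 0 0 0); rewrite !expr0 !mulr1 muln0 add0n.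
suff -> : k *: 'X_[mnm2 0 0] = k%:MP :> {mpoly K[2]} by [].
have -> : mnm2 0 0 = 0%MM.
  by apply: mnm2P; rewrite ?mnm2_0 ?mnm2_1 mnm0E.
by rewrite mpolyX0 -mul_mpolyC mulr1.
Qed.

Lemma sym_x : sym p x 'X_[mnm2 d 0].
Proof. by have := sym_word 1 0 0; rewrite expr1 !mulr1 muln1 mul1n muln0 !addn0. Qed.

Lemma sym_y : sym q y 'X_[mnm2 0 d].
Proof. by have := sym_word 0 1 0; rewrite expr1 mul1r mulr1 muln1 mul1n muln0 !addn0. Qed.

Lemma sym_z : sym c z 'X_[mnm2 1 1].
Proof. by have := sym_word 0 0 1; rewrite expr1 !mul1r mul1n muln0 !add0n. Qed.

Lemma sym_mul_word n e j k a T : sym n a T ->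
  sym (n + (e * p + k * q + j * c)) (a * (x ^+ e * y ^+ k * z ^+ j))
    (T * 'X_[mnm2 (d * e + j) (d * k + j)]).
Proof.
elim=> {n a T}.
- move=> a b j'; have := sym_word (a + e) (b + k) (j' + j).
  suff -> : 'X_[mnm2 (d * (a + e) + (j' + j)) (d * (b + k) + (j' + j))] =
            'X_[mnm2 (d * a + j') (d * b + j')]
            * 'X_[mnm2 (d * e + j) (d * k + j)] :> {mpoly K[2]}.
    rewrite !exprD; congr sym; [lia | ring].
  rewrite -mpolyXD; congr 'X_[_].
  by apply: mnm2P; rewrite mnmDE ?mnm2_0 ?mnm2_1; lia.
- by move=> n a b T T' _ IH1 _ IH2; rewrite !mulrDl; apply: sym_add.
- by move=> n b a T _ IH; rewrite -mulrA -scalerAl; apply: sym_scale.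
move=> n n' a T _ IH lt; rewrite mul0r; apply: sym_lift IH _.
by rewrite ltn_add2r.
Qed.

Lemma symM n m a b T T' : sym n a T -> sym m b T' -> sym (n + m) (a * b) (T * T').
Proof.
move=> sa; elim=> {m b T'}.
- by move=> e k j; apply: sym_mul_word.
- by move=> m b b' T1 T2 _ IH1 _ IH2; rewrite !mulrDr; apply: sym_add.
- by move=> m k b T1 _ IH; rewrite mulrCA -scalerAr; apply: sym_scale.
move=> m m' b T1 _ IH lt; rewrite mulr0; apply: sym_lift IH _.
by rewrite ltn_add2l.
Qed.

Lemma symN n a T : sym n a T -> sym n (- a) (- T).
Proof.
by move=> /(sym_scale (-1)); rewrite rmorphN rmorph1 mulN1r scaleN1r.
Qed.

Lemma symX n a T k : sym n a T -> sym (k * n) (a ^+ k) (T ^+ k).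
Proof.
move=> sa; elim: k => [|k IHk]; first by have := sym_str 1; rewrite rmorph1 mpolyC1.
by rewrite !exprS mulSn; apply: symM.
Qed.

Lemma sym_sum_ex n I (r : seq I) (F : I -> S) :
  (forall i, exists T, sym n (F i) T) -> exists T, sym n (\sum_(i <- r) F i) T.
Proof.
move=> sF; elim: r => [|i r [T IH]]; first by rewrite big_nil; exists 0; exact: sym_0.
by have [T' sT'] := sF i; rewrite big_cons; exists (T' + T); apply: sym_add.
Qed.

(** [sym] is closed under products by construction but not visibly single-valued; this version is
    single-valued because normal words are independent. Weights in [u, v] are [d] times those in
    [x, y, z]. *)
Definition stdrep n (a : S) (T : {mpoly K[2]}) := exists f : {mpoly K[2]},
  [/\ forall m, f@_m != 0 -> balanced m /\ (wt m <= d * n)%N,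
      a = evm x y z f &
      forall m, T@_m = if wt m == (d * n)%N then f@_m else 0].

Lemma stdrep_add n a b T T' :
  stdrep n a T -> stdrep n b T' -> stdrep n (a + b) (T + T').
Proof.
move=> [f [bf -> cf]] [g [bg -> cg]]; exists (f + g); split.
- move=> m; rewrite mcoeffD; case: (eqVneq f@_m 0) => [->|/bf //].
  by rewrite add0r => /bg.
- by rewrite evmD.
by move=> m; rewrite !mcoeffD cf cg; case: ifP; rewrite ?addr0.
Qed.

Lemma stdrep_scale n k a T : stdrep n a T -> stdrep n (str k * a) (k *: T).
Proof.
move=> [f [bf -> cf]]; exists (k *: f); split.
- by move=> m; rewrite mcoeffZ mulf_eq0 negb_or => /andP[_ /bf].
- by rewrite evmZ.
by move=> m; rewrite !mcoeffZ cf; case: ifP; rewrite ?mulr0.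
Qed.

Lemma stdrep_lift n n' a T : stdrep n a T -> (n < n')%N -> stdrep n' a 0.
Proof.
move=> [f [bf -> cf]] lt; have d0 := deg_gt0 sys.
have lt' : (d * n < d * n')%N by rewrite ltn_pmul2l.
exists f; split=> // m; first by case/bf => ? le; split=> //; apply: leq_trans le (ltnW lt').
rewrite mcoeff0; case: eqP => // E; case: (eqVneq f@_m 0) => // /bf[_].
by rewrite E leqNgt lt'.
Qed.

Lemma stdrep_0 n : stdrep n 0 0.
Proof.
exists 0; split=> [m||m]; rewrite ?mcoeff0 ?eqxx ?if_same //.
by rewrite evm0.
Qed.

Lemma stdrep_sum0 n I (r : seq I) (F : I -> S) :
  (forall i, stdrep n (F i) 0) -> stdrep n (\sum_(i <- r) F i) 0.
Proof.
move=> sF; elim: r => [|i r IH]; first by rewrite big_nil; exact: stdrep_0.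
by rewrite big_cons -(addr0 (0 : {mpoly K[2]})); apply: stdrep_add.
Qed.

Lemma stdrep_mon m n : balanced m -> wt m = (d * n)%N ->
  stdrep n (mon x y z m) 'X_[m].
Proof.
move=> bm wm; exists 'X_[m]; split.
- by move=> m'; rewrite mcoeffX; case: (m =P m') => [<- _|_]; [rewrite wm | rewrite eqxx].
- by rewrite evm_mon.
by move=> m'; rewrite mcoeffX; case: (eqVneq m m') => [<-|]; rewrite ?wm ?eqxx ?if_same.
Qed.

Hypotheses (p_gt0 : (0 < p)%N) (q_gt0 : (0 < q)%N).
Hypothesis pqc : (p + q = d * c)%N.

Lemma wt_mnm2 a b j :
  wt (mnm2 (d * a + j) (d * b + j)) = (d * (a * p + b * q + j * c))%N.
Proof.
rewrite /wt mnm2_0 mnm2_1 !mulnDr.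
have -> : (p * (d * a) + p * j + (q * (d * b) + q * j) =
           p * (d * a) + q * (d * b) + (p + q) * j)%N by lia.
by rewrite pqc; lia.
Qed.

Lemma balanced_mnm2 a b j : balanced (mnm2 (d * a + j) (d * b + j)).
Proof. by rewrite /balanced mnm2_0 mnm2_1 ![(d * _)%N]mulnC !modnMDl. Qed.

(** Each [x y] is replaced by [phi(z)]: the term [z^d] keeps the weight because [p + q = d c], and
    the other terms of [phi] have smaller weight, so they do not affect the symbol. *)
Lemma stdrep_word a b j : stdrep (a * p + b * q + j * c)
  (x ^+ a * y ^+ b * z ^+ j) 'X_[mnm2 (d * a + j) (d * b + j)].
Proof.
have d0 := deg_gt0 sys.
elim: a b j => [|a IH] b j.
  have := stdrep_mon (balanced_mnm2 0 b j) (wt_mnm2 0 b j).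
  rewrite /mon mnm2_0 mnm2_1 muln0 add0n expr0 mul1r.
  case: leqP => [|_]; last by rewrite addnK mulKn.
  case: b => [|b]; first by rewrite muln0 add0n subnn div0n.
  by rewrite -{2}[j]add0n leq_add2r leqn0 muln_eq0 (gtn_eqF d0).
case: b => [|b].
  have := stdrep_mon (balanced_mnm2 a.+1 0 j) (wt_mnm2 a.+1 0 j).
  by rewrite /mon mnm2_0 mnm2_1 muln0 add0n leq_addl addnK mulKn // mulr1.
have -> : x ^+ a.+1 * y ^+ b.+1 * z ^+ j =
    x ^+ a * y ^+ b * z ^+ (d + j)
    + \sum_(l < d) str phi`_l * (x ^+ a * y ^+ b * z ^+ (l + j)).
  rewrite !exprS !mulrA -[x * x ^+ a * y]mulrA [x ^+ a * y]mulrC mulrA.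
  rewrite (sys_rel sys) ev1E.
  rewrite -(prednK (ltnW (sys_size sys))) big_ord_recr /=.
  have -> : phi`_d = 1 by rewrite -lead_coefE; apply/monicP; exact: sys_monic sys.
  rewrite rmorph1 mul1r !mulrDl addrC; congr (_ + _).
    by rewrite exprD; ring.
  rewrite !mulr_suml; apply: eq_bigr => l _; rewrite exprD; ring.
rewrite -(addr0 'X_[_]); apply: stdrep_add.
  have := IH b (d + j)%N.
  have -> : (a * p + b * q + (d + j) * c = a.+1 * p + b.+1 * q + j * c)%N.
    by rewrite mulnDl -pqc; lia.
  by rewrite !addnA -!mulnSr.
apply: stdrep_sum0 => l; rewrite -(scaler0 {mpoly K[2]} phi`_l).
apply: stdrep_scale; apply: stdrep_lift (IH b (l + j)%N) _.
have : ((l + 1) * c <= d * c)%N by rewrite leq_mul2r addn1 ltn_ord orbT.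
have : (0 < d * c)%N by rewrite -pqc addn_gt0 p_gt0.
by rewrite -pqc !mulnDl; case: c => [|c']; lia.
Qed.

Lemma sym_stdrep n a T : sym n a T -> stdrep n a T.
Proof.
elim=> {n a T}.
- exact: stdrep_word.
- by move=> n a b T T' _ IH1 _; apply: stdrep_add.
- by move=> n k a T _; apply: stdrep_scale.
by move=> n n' a T _ IH; apply: stdrep_lift IH.
Qed.

Lemma sym_eq0 n T : sym n 0 T -> T = 0.
Proof.
move=> /sym_stdrep[f [bf f0 cf]].
have f00 : f = 0 by apply: (evm_free sys) => [m /bf[]|].
by apply/mpolyP => m; rewrite cf f00 mcoeff0 if_same.
Qed.

Lemma sym_uniq n a T T' : sym n a T -> sym n a T' -> T = T'.
Proof.
move=> sT /symN sT'; apply/eqP; rewrite -subr_eq0; apply/eqP/(@sym_eq0 n).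
by rewrite -(subrr a); apply: sym_add.
Qed.

Lemma sym_supp n a T m : sym n a T -> T@_m != 0 ->
  balanced m /\ wt m = (d * n)%N.
Proof.
move=> /sym_stdrep[f [bf _ cf]]; rewrite cf; case: ifP => [/eqP wm /bf[]|_] //.
by rewrite eqxx.
Qed.

Lemma balanced_word m : balanced m -> exists a b j,
  m = mnm2 (d * a + j) (d * b + j) /\
  forall x' y' z' : S, mon x' y' z' m = x' ^+ a * y' ^+ b * z' ^+ j.
Proof.
move=> bm; have E a b : (a <= b)%N -> a = b %[mod d] ->
    (d * ((b - a) %/ d) + a)%N = b.
  by move=> le ab; rewrite mulnC divnK ?subnK // -eqn_mod_dvd // ab.
case: (leqP (m i1) (m i0)) => le.
  exists ((m i0 - m i1) %/ d)%N, 0%N, (m i1); split=> [|x' y' z'].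
    by apply: mnm2P; rewrite ?mnm2_0 ?mnm2_1 ?muln0 ?E.
  by rewrite /mon le mulr1.
exists 0%N, ((m i1 - m i0) %/ d)%N, (m i0); split=> [|x' y' z'].
  by apply: mnm2P; rewrite ?mnm2_0 ?mnm2_1 ?muln0 ?E // ltnW.
by rewrite /mon leqNgt le mul1r.
Qed.

Lemma sym_mon m n : balanced m -> (wt m <= d * n)%N ->
  exists T, sym n (mon x y z m) T.
Proof.
move=> /balanced_word[a [b [j [-> ->]]]]; rewrite wt_mnm2 leq_pmul2l ?(deg_gt0 sys) //.
rewrite leq_eqVlt => /orP[/eqP <-|lt]; first by eexists; exact: sym_word.
by exists 0; apply: sym_lift (sym_word a b j) lt.
Qed.

(** If the top part vanishes, all weights are below [d n]; being multiples of [d], they are at most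
    [d (n - 1)]. Iterating reaches a nonzero symbol. *)
Lemma sym_lower n a : sym n a 0 -> a = 0 \/ exists n' T, (n' < n)%N /\ sym n' a T.
Proof.
case: n => [|n] /sym_stdrep[f [bf -> cf]].
  left; suff -> : f = 0 by exact: evm0.
  apply/mpolyP => m; move: (cf m); rewrite !mcoeff0 muln0.
  case: (eqVneq f@_m 0) => // nz; have [_] := bf m nz.
  by rewrite muln0 leqn0 => -> E; rewrite -E eqxx in nz.
right; have [T sT] : exists T, sym n (evm x y z f) T; last by exists n, T.
apply: (@sym_sum_ex n _ (msupp f) (fun m => str f@_m * mon x y z m)) => m.
case: (eqVneq f@_m 0) => [->|nz]; first by exists 0; rewrite rmorph0 mul0r; exact: sym_0.
have [bm wm] := bf m nz; have d0 := deg_gt0 sys.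
suff /(sym_mon bm)[T sT] : (wt m <= d * n)%N by eexists; apply: sym_scale sT.
have [e [k [j [Em _]]]] := balanced_word bm.
move: (cf m) wm; rewrite Em wt_mnm2 -Em eqn_pmul2l // !leq_pmul2l //.
rewrite mcoeff0 leq_eqVlt => E /orP[/eqP H|]; last by rewrite ltnS.
by rewrite H eqxx in E; rewrite -E eqxx in nz.
Qed.

Lemma sym_ex a : exists n T, sym n a T.
Proof.
apply: (sys_gen sys (B := fun a => exists n T, sym n a T)) => {a}.
- by move=> k; exists 0%N; eexists; exact: sym_str.
- move=> a [] ->; [exists p|exists q|exists c]; eexists;
    [exact: sym_x | exact: sym_y | exact: sym_z].
- move=> a b [n [T sa]] [m [T' sb]].
  case: (ltngtP n m) => [lt|lt|E].
  + by exists m; eexists; apply: sym_add (sym_lift sa lt) sb.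
  + by exists n; eexists; apply: sym_add sa (sym_lift sb lt).
  by subst m; exists n; eexists; apply: sym_add sa sb.
by move=> a b [n [T sa]] [m [T' sb]]; exists (n + m)%N; eexists; apply: symM sa sb.
Qed.

End Filtration.

(** * Weighted homogeneous vector fields on the plane *)

Section VectorField.

Variables (K : fieldType) (U : 'I_2 -> {mpoly K[2]}).

Definition vfield (f : {mpoly K[2]}) : {mpoly K[2]} := \sum_(i < 2) U i * f^`M(i).

Lemma vfield_zmod : zmod_morphism vfield.
Proof.
move=> f g; rewrite /vfield -sumrB; apply: eq_bigr => i _.
by rewrite raddfB mulrBr.
Qed.

HB.instance Definition _ :=
  GRing.isZmodMorphism.Build {mpoly K[2]} {mpoly K[2]} vfield vfield_zmod.

Lemma vfield_der : is_derivation vfield.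
Proof.
move=> f g; rewrite /vfield /= mulr_suml mulr_sumr -big_split.
by apply: eq_bigr => i _; rewrite mderivM /=; ring.
Qed.

Lemma vfieldE f : vfield f = U i0 * f^`M(i0) + U i1 * f^`M(i1).
Proof. by rewrite /vfield big_ord_recl big_ord_recl big_ord0 addr0. Qed.

Lemma vfieldC c : vfield c%:MP = 0.
Proof. by rewrite vfieldE !mderivC !mulr0 addr0. Qed.

Lemma vfieldX i : vfield 'X_i = U i.
Proof.
have E j : ('X_i : {mpoly K[2]})^`M(j) = (i == j)%:R.
  rewrite mderivX mnm1E; case: eqP => [->|]; last by rewrite scale0r.
  rewrite scale1r -mpolyX0; congr 'X_[_].
  by apply/mnmP => k; rewrite mnmBE mnm0E subnn.
by rewrite vfieldE !E; case: (I2P i) => ->; rewrite ?eqxx /= mulr1 mulr0 ?addr0 ?add0r.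
Qed.

End VectorField.

Lemma mpolyX_neq0 (K : fieldType) n (m : 'X_{1..n}) : 'X_[m] != 0 :> {mpoly K[n]}.
Proof.
apply/eqP => /(congr1 (mcoeff m)); rewrite mcoeffX eqxx mcoeff0 => /eqP.
by rewrite oner_eq0.
Qed.

Lemma mpolyX2 (K : fieldType) (i j : 'I_2) m : i != j ->
  'X_[m] = 'X_i ^+ m i * 'X_j ^+ m j :> {mpoly K[2]}.
Proof.
rewrite mpolyXE_id big_ord_recl big_ord_recl big_ord0 mulr1 -/i0 -/i1.
by case: (I2P i) => ->; case: (I2P j) => ->; rewrite ?eqxx // mulrC.
Qed.

Lemma mpoly_divX (K : fieldType) (j : 'I_2) k (f : {mpoly K[2]}) :
  (forall m, f@_m != 0 -> (k <= m j)%N) ->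
  exists g, f = 'X_j ^+ k * g /\ forall m, g@_m = f@_(m + U_(j) *+ k)%MM.
Proof.
move=> sf; pose g : {mpoly K[2]} :=
  \sum_(m <- msupp f) f@_m *: 'X_[(m - U_(j) *+ k)%MM].
have fg : f = 'X_j ^+ k * g.
  rewrite {1}(mpolyE f) mulr_sumr big_seq [RHS]big_seq; apply: eq_bigr => m.
  rewrite mcoeff_msupp => /sf le; rewrite -scalerAr mpolyXn -mpolyXD addmC submK //.
  apply/mnm_lepP => l; rewrite mulmnE mnm1E; case: eqP => [<-|//].
  by rewrite mul1n.
exists g; split=> // m; rewrite [in RHS]fg mulrC mpolyXn.
by rewrite addmC mcoeffMX.
Qed.

Section Coset.

Variables (K : fieldType) (d : nat) (i j : 'I_2).

(** Semi-invariants of the cyclic group of order [d]; [k = 0] gives the balanced polynomials. *)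
Definition coset k (f : {mpoly K[2]}) :=
  forall m, f@_m != 0 -> m i = m j + k %[mod d].

Lemma cosetM k l f g : coset k f -> coset l g -> coset (k + l) (f * g).
Proof.
move=> cf cg m; rewrite -mcoeff_msupp => /msuppM_le /allpairsP[[m1 m2] /= []].
rewrite !mcoeff_msupp => /cf e1 /cg e2 ->; rewrite !mnmDE.
by rewrite -modnDm e1 e2 modnDm; congr (_ %% _)%N; lia.
Qed.

Lemma cosetX k f n : coset k f -> coset (n * k) (f ^+ n).
Proof.
move=> cf; elim: n => [|n IHn]; last by rewrite exprS mulSn; apply: cosetM.
move=> m; rewrite expr0 mcoeff1 mul0n addn0.
by case: (m =P 0%MM) => [->|_]; rewrite ?mnm0E // eqxx.
Qed.

End Coset.

Section HomogeneousField.

Variables (K : fieldType) (charK : [pchar K] =i pred0).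
Variables (d c h : nat) (w : 'I_2 -> nat) (U : 'I_2 -> {mpoly K[2]}).
Hypotheses (d_gt0 : (0 < d)%N) (c_gt0 : (0 < c)%N) (w_gt0 : forall i, (0 < w i)%N).

Local Notation D := (vfield U).
Local Notation nilD := (nilp (vfield U)).
Local Notation mc := (@mpolyC 2 K).
Local Notation dgD := (dg mc (vfield U)).

Hypothesis wc : (w i0 + w i1 = d * c)%N.
Hypothesis nilX : forall i, nilD ('X_i ^+ d).
Hypothesis nilXX : nilD ('X_i0 * 'X_i1).
Hypothesis cosU : forall i j, i != j -> coset d i j 1 (U i).
Hypothesis homU : forall i j, i != j -> forall m, (U i)@_m != 0 ->
  (w i * m i + w j * m j + d = w i + d * h)%N.

Let derD := vfield_der U.

Lemma wcP (i j : 'I_2) : i != j -> (w i + w j = d * c)%N.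
Proof.
by case: (I2P i) => ->; case: (I2P j) => ->; rewrite ?eqxx // addnC.
Qed.

Lemma coset0_nil (i j : 'I_2) f : i != j -> coset d i j 0 f -> nilD f.
Proof.
move=> ij cf; rewrite (mpolyE f) big_seq; apply: nilp_sum => m.
rewrite mcoeff_msupp => /cf; rewrite addn0 => mij.
rewrite -mul_mpolyC; apply: (nilpM derD); first by apply: nilp_ker; exact: vfieldC.
have nXX : nilD ('X_i * 'X_j).
  by move: ij; case: (I2P i) => ->; case: (I2P j) => ->; rewrite ?eqxx // mulrC.
rewrite (mpolyX2 _ _ ij); case: (leqP (m j) (m i)) => le.
  have /dvdnP[a E] : (d %| m i - m j)%N by rewrite -eqn_mod_dvd // mij.
  rewrite -(subnK le) E exprD mulnC exprM -mulrA -exprMn.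
  by apply: (nilpM derD); apply: (nilpX derD).
have /dvdnP[a E] : (d %| m j - m i)%N by rewrite -eqn_mod_dvd ?(ltnW le) // mij.
rewrite -(subnK (ltnW le)) E exprD [(a * d)%N]mulnC exprM mulrCA -exprMn.
by apply: (nilpM derD); apply: (nilpX derD).
Qed.

Lemma cos_pow_nil (i j : 'I_2) k f : i != j -> coset d i j k f -> nilD (f ^+ d).
Proof.
move=> ij cf0; have cf := @cosetX _ _ _ _ _ _ d cf0; apply: (coset0_nil ij) => m /cf ->.
by rewrite addn0 addnC mulnC modnMDl.
Qed.

Lemma nat_neq0 n : (0 < n)%N -> n%:R != 0 :> {mpoly K[2]}.
Proof. by case: n => // n _; exact: (natrA_neq0 charK mc). Qed.

Lemma DXd i : D ('X_i ^+ d) = 'X_i ^+ d.-1 * U i *+ d.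
Proof. by have := derX derD 'X_i d; rewrite /= vfieldX. Qed.

Lemma DXd_neq0 i : U i != 0 -> D ('X_i ^+ d) != 0.
Proof.
move=> Ui; rewrite DXd -mulr_natl !mulf_neq0 ?nat_neq0 //.
by rewrite expf_neq0 // mpolyX_neq0.
Qed.

Lemma dgXd i : exists P, dgD P ('X_i ^+ d).
Proof.
have [n] := nilX i; move/(dg_exists charK mc); apply.
by rewrite expf_neq0 // mpolyX_neq0.
Qed.

Lemma dgDXd i P : U i != 0 -> dgD P ('X_i ^+ d) ->
  (0 < P)%N /\ dgD P.-1 (D ('X_i ^+ d)).
Proof.
move=> Ui; case: P => [|P] dP; last by split=> //; apply: (dg_D charK).
by have := DXd_neq0 Ui; rewrite (dg0_ker dP) eqxx.
Qed.

(** Otherwise [X_i] divides [U i], so [X_i^d] divides its own derivative with a nilpotent cofactor,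
    and the derivation fails to lower its degree. *)
Lemma supp_edge (i j : 'I_2) : i != j -> U i != 0 ->
  exists2 m, (U i)@_m != 0 & m i = 0%N.
Proof.
move=> ij Ui; apply: contrapT => no.
have sU m : (U i)@_m != 0 -> (1 <= m i)%N.
  by rewrite lt0n => nz; apply/eqP => mi; apply: no; exists m.
have [g [Ug cg]] := mpoly_divX sU.
have g0 : g != 0 by apply: contraNneq Ui => g0; rewrite Ug g0 mulr0.
have ng : nilD g.
  apply: (coset0_nil ij) => m; rewrite cg => /(cosU ij).
  rewrite !mnmDE !mulmnE !mnm1E eqxx (negbTE ij) mul1n mul0n addn0.
  by move/eqP; rewrite eqn_modDr => /eqP.
have [P dP] := dgXd i; have [P0 dP'] := dgDXd Ui dP.
have [n] := ng; move/(dg_exists charK mc) => /(_ g0)[b db].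
have E : D ('X_i ^+ d) = mc d%:R * ('X_i ^+ d * g).
  by rewrite DXd {1}Ug expr1 mulrA -exprSr prednK // rmorph_nat mulr_natl.
have dc0 : dgD 0 (mc d%:R).
  split; first by apply: dle_ker; exact: vfieldC.
  by rewrite lead_0 rmorph_nat nat_neq0.
have := dgM charK derD dc0 (dgM charK derD dP db); rewrite -E.
by move/(dg_uniq dP'); lia.
Qed.

(** Let [r = w i / gcd(w i, c)], which is at least 2. Homogeneity and the congruences, compared with
    those of a monomial of [U j] free of [X_j], force [r] to divide [m j + 1] for every monomial of
    [U i]; so [X_j^(r - 1)] divides [U i]. Counting degrees in [D(X_i^d)] gives
    [P >= d + (r - 1) Q]. *)
Lemma dg_gap (i j : 'I_2) P Q : i != j -> U i != 0 -> U j != 0 ->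
  dgD P ('X_i ^+ d) -> dgD Q ('X_j ^+ d) -> ~~ (w i %| c)%N -> (Q < P)%N.
Proof.
move=> ij Ui Uj dP dQ ndvd; have ji : j != i by rewrite eq_sym.
have [mv Umv mvj] := supp_edge ji Uj.
pose r := (w i %/ gcdn (w i) c)%N.
have gt0 : (0 < gcdn (w i) c)%N by rewrite gcdn_gt0 w_gt0.
have r_ge2 : (2 <= r)%N.
  have : (0 < r)%N by rewrite divn_gt0 // dvdn_leq // dvdn_gcdl.
  have : r != 1%N.
    apply: contra ndvd => /eqP r1; have := divnK (dvdn_gcdl (w i) c).
    by rewrite -/r r1 mul1n => <-; apply: dvdn_gcdr.
  by lia.
have r_dvd m : (U i)@_m != 0 -> (r %| m j + 1)%N.
  move=> Um; have e1 := homU ij Um; have e2 := homU ji Umv.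
  have c1 := cosU ij Um; have c2 := cosU ji Umv; rewrite mvj in e2 c2.
  have wE := wcP ij.
  have eJ' : (w j * (m j + 1) + w i * m i = w i * (mv i + 1))%N.
    rewrite !mulnDr !muln1; move: e1 e2; rewrite muln0 add0n; clear.
    by move: (w i * _)%N (w j * _)%N (w i * _)%N (d * h)%N => a1 a2 a3 a4; lia.
  have le : (m i <= mv i + 1)%N by rewrite -(leq_pmul2l (w_gt0 i)) -eJ' leq_addl.
  have eJ : (w j * (m j + 1) = w i * (mv i + 1 - m i))%N by rewrite mulnBr -eJ' addnK.
  have /dvdnP[f ef] : (d %| (mv i + 1 - m i) + (m j + 1))%N.
    by rewrite /dvdn -modnDmr -c1 modnDmr subnK // -c2 mod0n.
  have cJ : (c * (m j + 1) = w i * f)%N.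
    apply/eqP; rewrite -(eqn_pmul2l d_gt0); apply/eqP.
    have : ((w i + w j) * (m j + 1) = w i * ((mv i + 1 - m i) + (m j + 1)))%N.
      by rewrite [RHS]mulnDr mulnDl eJ addnC.
    by rewrite wE ef => E; rewrite mulnA E mulnA mulnC.
  have : (r %| (c %/ gcdn (w i) c) * (m j + 1))%N.
    apply/dvdnP; exists f; apply/eqP; rewrite -(eqn_pmul2r gt0); apply/eqP.
    rewrite mulnAC divnK ?dvdn_gcdr // cJ -mulnA divnK ?dvdn_gcdl //.
    by rewrite mulnC.
  rewrite Gauss_dvdr // /r /coprime; apply/eqP.
  apply/eqP; rewrite -(eqn_pmul2r gt0) muln_gcdl !divnK ?dvdn_gcdl ?dvdn_gcdr //.
  by rewrite mul1n.
have sU m : (U i)@_m != 0 -> (r.-1 <= m j)%N.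
  by move=> /r_dvd /dvdn_leq; rewrite addn1 => /(_ isT); lia.
have [B [UB cB]] := mpoly_divX sU.
have B0 : B != 0 by apply: contraNneq Ui => B0; rewrite UB B0 mulr0.
have nB : nilD (B ^+ d).
  apply: (cos_pow_nil (k := r) ij) => m; rewrite cB => /(cosU ij).
  rewrite !mnmDE !mulmnE !mnm1E eqxx eq_sym (negbTE ij) mul0n mul1n addn0 => ->.
  by congr (_ %% _)%N; lia.
have [n] := nB; move/(dg_exists charK mc); rewrite expf_neq0 // => /(_ isT)[b db].
have [P0 dP'] := dgDXd Ui dP.
have dc0 : dgD 0 (mc (d%:R ^+ d)).
  split; first by apply: dle_ker; exact: vfieldC.
  by rewrite lead_0 rmorphXn rmorph_nat expf_neq0 // nat_neq0.
(* The [d]-th power is taken because [X_j] and the cofactor [B] need not be balanced, while their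
   [d]-th powers are, and so have a degree. *)
have E : D ('X_i ^+ d) ^+ d =
    mc (d%:R ^+ d) * (('X_i ^+ d) ^+ d.-1 * (('X_j ^+ d) ^+ r.-1 * B ^+ d)).
  rewrite DXd UB -mulr_natl !exprMn rmorphXn rmorph_nat; congr (_ * _).
  by rewrite -!exprM [(d.-1 * d)%N]mulnC [(r.-1 * d)%N]mulnC.
have := dgM charK derD dc0 (dgM charK derD (dgX charK derD d.-1 dP)
  (dgM charK derD (dgX charK derD r.-1 dQ) db)); rewrite -E.
move/(dg_uniq (dgX charK derD d dP')).
have : (1 * Q <= r.-1 * Q)%N by rewrite leq_mul2r; lia.
have : (d * P.-1 + d = d.-1 * P + P)%N.
  by rewrite -mulnSr prednK // -[X in _ = (_ + X)%N]mul1n -mulnDl addn1 prednK.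
lia.
Qed.

(** If neither weight divided [c], the strict inequality of [dg_gap] would hold both ways. If [w i1]
    divides [c], it divides [w i0 = d c - w i1], and the two weights are equal. *)
Lemma weight_dvd : U i0 != 0 -> U i1 != 0 -> (w i0 <= w i1)%N -> (w i0 %| c)%N.
Proof.
move=> U0 U1 le; apply/negPn/negP => ndvd.
have [P dP] := dgXd i0; have [Q dQ] := dgXd i1.
have lt := dg_gap (isT : i0 != i1) U0 U1 dP dQ ndvd.
suff : (P < Q)%N by rewrite ltnNge (ltnW lt).
apply: (dg_gap (isT : i1 != i0) U1 U0 dQ dP); apply: contra ndvd => dvd1.
have dvd10 : (w i1 %| w i0)%N.
  by rewrite -(dvdn_addl _ (dvdnn (w i1))) wc dvdn_mull.
have -> // : w i0 = w i1.
by apply/eqP; rewrite eqn_leq le dvdn_leq.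
Qed.

(** The degree of [X_j^(d - 1) X^m] is proportional to [m j + d - 1], and homogeneity makes [m j]
    determine [m]. So the monomial with the largest [m j] survives in [D(X_j^d)]; if [m j > 0] its
    degree would be at least [Q], whereas [D(X_j^d)] has degree [Q - 1]. *)
Lemma single_monomial (i j : 'I_2) : i != j -> U i = 0 -> U j != 0 ->
  exists e k, k != 0 /\ U j = k *: 'X_i ^+ e.
Proof.
move=> ij Ui Uj; have ji : j != i by rewrite eq_sym.
have [m0 Um0 m0j] := supp_edge ji Uj.
have sU0 : msupp (U j) != [::] by rewrite msupp_eq0.
have [mx mxU mx_max] := seq_argmax (fun m : 'X_{1..2} => m j) sU0.
have [Q dQ] := dgXd j; have [Q0 dQ'] := dgDXd Uj dQ.
have dP : dgD 0 ('X_i ^+ d).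
  split; last by rewrite lead_0 expf_neq0 // mpolyX_neq0.
  by apply: dle_ker; have := DXd i; rewrite Ui mulr0 mul0rn.
have dgm m : (U j)@_m != 0 ->
    exists2 n, dgD n ('X_j ^+ d.-1 * 'X_[m]) & (d * n = Q * (m j + d.-1))%N.
  move=> Um; have nm : nilD ('X_j ^+ d.-1 * 'X_[m]).
    have -> : 'X_j ^+ d.-1 * 'X_[m] = 'X_[(U_(j) *+ d.-1 + m)%MM] :> {mpoly K[2]}.
      by rewrite mpolyXn mpolyXD.
    apply: (coset0_nil ij) => m'; rewrite mcoeffX; case: (_ =P m') => [<- _|_].
      rewrite !mnmDE !mulmnE !mnm1E eqxx (negbTE ji) mul0n mul1n addn0 add0n.
      by rewrite -modnDmr (cosU ji Um) modnDmr addnCA addn1 prednK // modnDr.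
    by rewrite eqxx.
  have nz : 'X_j ^+ d.-1 * 'X_[m] != 0 :> {mpoly K[2]}.
    by rewrite mulf_neq0 ?expf_neq0 ?mpolyX_neq0.
  have [k] := nm; move/(dg_exists charK mc) => /(_ nz)[n dn]; exists n => //.
  have E : ('X_j ^+ d.-1 * 'X_[m]) ^+ d =
      ('X_i ^+ d) ^+ m i * ('X_j ^+ d) ^+ (m j + d.-1) :> {mpoly K[2]}.
    rewrite (mpolyX2 K m ij) !exprMn -!exprM mulrCA -exprD -mulnDl addnC.
    by rewrite [(m i * d)%N]mulnC [(_ * d)%N]mulnC.
  have := dgX charK derD d dn; rewrite E.
  move/(dg_uniq (dgM charK derD (dgX charK derD (m i) dP)
    (dgX charK derD (m j + d.-1) dQ))).
  by rewrite muln0 add0n [(Q * _)%N]mulnC => ->.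
have hom_eq m : (U j)@_m != 0 -> m j = mx j -> m = mx.
  move=> Um ejm; apply/mnmP => k.
  have Umx : (U j)@_mx != 0 by rewrite -mcoeff_msupp.
  have e1 := homU ji Um; have e2 := homU ji Umx.
  have eim : m i = mx i.
    by apply/eqP; rewrite -(eqn_pmul2l (w_gt0 i)); apply/eqP; rewrite ejm in e1; lia.
  by move: ij eim ejm; case: (I2P i) => ->; case: (I2P j) => ->; case: (I2P k) => ->;
    rewrite ?eqxx.
have Umx : (U j)@_mx != 0 by rewrite -mcoeff_msupp.
have mxj : mx j = 0%N.
  apply/eqP/negPn/negP => mxj0.
  have [n dn En] := dgm _ Umx.
  have leQ : (Q <= n)%N.
    rewrite -(leq_pmul2l d_gt0) En mulnC leq_pmul2l //.
    by rewrite -{1}(prednK d_gt0) -addn1 addnC leq_add2r lt0n.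
  have lt : (Q.-1 < n)%N by lia.
  have := lead_gt mc dQ'.1 lt; rewrite DXd.
  have -> : 'X_j ^+ d.-1 * U j *+ d = \sum_(m <- msupp (U j))
      mc (d%:R * (U j)@_m) * ('X_j ^+ d.-1 * 'X_[m]).
    rewrite {1}(mpolyE (U j)) mulr_sumr -mulr_natl mulr_sumr.
    apply: eq_bigr => m _; rewrite rmorphM rmorph_nat -mul_mpolyC; ring.
  have leadC k (f : {mpoly K[2]}) l : lead mc (vfield U) l (mc k * f) = mc k * lead mc (vfield U) l f.
    rewrite /lead mulrCA; congr (_ * _); elim: l => //= l ->.
    by rewrite vfield_der /= vfieldC mul0r add0r.
  rewrite lead_sum (bigD1_seq mx) ?msupp_uniq //= big1_seq => [|m /andP[ne mU]].
    rewrite addr0 leadC => /eqP; rewrite mulf_eq0 (negbTE dn.2) orbF.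
    rewrite mpolyC_eq0 mulf_eq0 (negbTE Umx) orbF.
    by have := natrK_neq0 charK d.-1; rewrite prednK // => /negbTE ->.
  have Um : (U j)@_m != 0 by rewrite -mcoeff_msupp.
  have [n' dn' En'] := dgm _ Um.
  have ltm : (m j < mx j)%N.
    by rewrite ltn_neqAle mx_max // andbT; apply: contra ne => /eqP /(hom_eq _ Um) ->.
  rewrite leadC (lead_gt mc dn'.1) ?mulr0 //.
  by rewrite -(ltn_pmul2l d_gt0) En En' ltn_pmul2l // ltn_add2r.
exists (mx i), (U j)@_mx; split=> //.
apply/mpolyP => m; rewrite mcoeffZ.
have -> : 'X_i ^+ mx i = 'X_[mx] :> {mpoly K[2]}.
  by rewrite (mpolyX2 _ mx ij) mxj expr0 mulr1.
rewrite mcoeffX; case: (mx =P m) => [<-|ne]; first by rewrite mulr1.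
rewrite mulr0; apply/eqP/negPn/negP => Um; case: ne; symmetry; apply: hom_eq => //.
by apply/eqP; rewrite eqn_leq mx_max ?mcoeff_msupp // mxj.
Qed.

End HomogeneousField.

(** * The leading form of a locally nilpotent derivation *)

Lemma mpoly_Xdiv (K : fieldType) (j : 'I_2) k (g : {mpoly K[2]}) m :
  ('X_j ^+ k * g)@_m != 0 -> (k <= m j)%N.
Proof.
rewrite -mcoeff_msupp => /msuppM_le /allpairsP[[m1 m2] /= [m1X _ ->]].
move: m1X; rewrite mpolyXn msuppX mem_seq1 => /eqP ->.
by rewrite mnmDE mulmnE mnm1E eqxx mul1n leq_addr.
Qed.

(** * Clearing powers of [x]; algebraic closedness of [K] in [S] *)

Section Clearing.

Variables (K : fieldType) (S : idomainType) (str : {rmorphism K -> S}).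
Variables (phi : {poly K}) (x y z : S) (sys : system str phi x y z).

(** Once [x] is inverted, [y = phi(z)/x] and [S] becomes [K[x, 1/x, z]]. *)
Lemma clear_x a : exists N P, x ^+ N * a = ev2 str x z P.
Proof.
apply: (sys_gen sys (B := fun a => exists N P, x ^+ N * a = ev2 str x z P)) => {a}.
- by move=> k; exists 0%N, k%:P%:P; rewrite mul1r ev2C ev1C.
- move=> a [] ->.
  + by exists 0%N, 'X%:P; rewrite mul1r ev2C ev1X.
  + by exists 1%N, (map_poly polyC phi); rewrite ev2_map expr1; exact: sys_rel sys.
  by exists 0%N, 'X; rewrite mul1r ev2X.
- move=> a b [N [P EP]] [M [Q EQ]].
  exists (N + M)%N, (('X ^+ M)%:P * P + ('X ^+ N)%:P * Q).
  rewrite rmorphD !rmorphM /= !ev2C !rmorphXn /= ev1X -EP -EQ exprD; ring.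
move=> a b [N [P EP]] [M [Q EQ]]; exists (N + M)%N, (P * Q).
by rewrite rmorphM /= -EP -EQ exprD; ring.
Qed.

Lemma ev2_inj : injective (ev2 str x z).
Proof.
move=> P Q E; apply/eqP; rewrite -subr_eq0; apply/eqP/(sys_free sys).
apply: (addIr (ev2 str x z Q)).
by rewrite -rmorphD /= subrK E add0r.
Qed.

Lemma ev1_inj : injective (ev1 str x).
Proof.
by move=> P Q E; apply: polyC_inj; apply: ev2_inj; rewrite !ev2C.
Qed.

(** Two polynomial extensions give the property for [K[x][z]]; a common power of [x] moves [u] and
    [v] there without changing their ratio. *)
Lemma sys_alg_closed : alg_closed_in str.
Proof.
pose str1 : {rmorphism K -> {poly K}} := polyC.
pose str2 : {rmorphism K -> {poly {poly K}}} := polyC \o str1.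
have ac2 : alg_closed_in str2.
  apply: (alg_closed_in_poly (str := str1)) => //.
  by apply: (alg_closed_in_poly (str := idfun)) => //; apply: alg_closed_in_field.
have xN0 N : x ^+ N != 0 by rewrite expf_neq0 // (sys_x_neq0 sys).
move=> M F u v v0 F0 sF FE.
have [N1 [P1 E1]] := clear_x u; have [N2 [P2 E2]] := clear_x v.
pose P := ('X ^+ N2)%:P * P1; pose Q := ('X ^+ N1)%:P * P2.
have EP : ev2 str x z P = x ^+ (N1 + N2) * u.
  by rewrite rmorphM /= ev2C rmorphXn /= ev1X -E1 exprD; ring.
have EQ : ev2 str x z Q = x ^+ (N1 + N2) * v.
  by rewrite rmorphM /= ev2C rmorphXn /= ev1X -E2 exprD; ring.
have Q0 : Q != 0.
  apply/eqP => Q0; move: EQ; rewrite Q0 rmorph0 => /esym/eqP.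
  by rewrite mulf_eq0 (negbTE (xN0 _)) (negbTE v0).
have [|l El] := ac2 M F P Q Q0 F0 sF.
  apply: (sys_free sys); rewrite /hform rmorph_sum /=.
  transitivity ((x ^+ (N1 + N2)) ^+ M * hform str M F u v); last by rewrite FE mulr0.
  rewrite /hform mulr_sumr; apply: eq_bigr => i _.
  rewrite !rmorphM !rmorphXn /= EP EQ ev2C ev1C !exprMn.
  have le_iM : (i <= M)%N by rewrite -ltnS ltn_ord.
  have -> : (x ^+ (N1 + N2)) ^+ M = (x ^+ (N1 + N2)) ^+ i * (x ^+ (N1 + N2)) ^+ (M - i).
    by rewrite -exprD subnKC.
  ring.
exists l; apply: (mulfI (xN0 (N1 + N2)%N)); rewrite -EP El rmorphM /= ev2C ev1C EQ.
by rewrite mulrCA.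
Qed.

End Clearing.

Section Generators.

Variables (K : fieldType) (S : idomainType) (str : {rmorphism K -> S}).
Variables (phi : {poly K}) (x y z : S) (p q c : nat) (c_gt0 : (0 < c)%N).

Local Notation d := (size phi).-1.
Local Notation sym := (sym str phi x y z p q c).

Lemma sym_X0 : sym p x ('X_i0 ^+ d).
Proof.
suff <- : 'X_[mnm2 d 0] = 'X_i0 ^+ d :> {mpoly K[2]} by exact: sym_x.
by rewrite (mpolyX2 K (mnm2 d 0) (isT : i0 != i1)) mnm2_0 mnm2_1 mulr1.
Qed.

Lemma sym_X1 : sym q y ('X_i1 ^+ d).
Proof.
suff <- : 'X_[mnm2 0 d] = 'X_i1 ^+ d :> {mpoly K[2]} by exact: sym_y.
by rewrite (mpolyX2 K (mnm2 0 d) (isT : i0 != i1)) mnm2_0 mnm2_1 mul1r.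
Qed.

Lemma sym_X01 : sym c z ('X_i0 * 'X_i1).
Proof.
suff <- : 'X_[mnm2 1 1] = 'X_i0 * 'X_i1 :> {mpoly K[2]} by exact: sym_z.
by rewrite (mpolyX2 K (mnm2 1 1) (isT : i0 != i1)) mnm2_0 mnm2_1.
Qed.

Lemma sym_ev1z n (P : {poly K}) : (size P <= n.+1)%N ->
  sym (n * c) (ev1 str z P) (P`_n *: ('X_i0 * 'X_i1) ^+ n).
Proof.
move=> sP; have symz := sym_X01.
have -> : P = \poly_(i < n.+1) P`_i.
  apply/polyP => i; rewrite coef_poly; case: ltnP => // le.
  by rewrite nth_default // (leq_trans sP).
rewrite coef_poly leqnn.
rewrite poly_def rmorph_sum big_ord_recr /= ev1Z rmorphXn /= ev1X addrC.
rewrite -[X in sym _ _ X]addr0; apply: sym_add.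
  by apply: sym_scale; apply: symX symz.
elim: n {sP} => [|n IH]; first by rewrite big_ord0; exact: sym_0.
rewrite big_ord_recr /= -[X in sym _ _ X]addr0; apply: sym_add.
  by apply: sym_lift IH _; rewrite ltn_mul2r c_gt0 /=.
rewrite ev1Z rmorphXn /= ev1X -(scaler0 _ P`_n); apply: sym_scale.
by apply: sym_lift (symX n symz) _; rewrite ltn_mul2r c_gt0 /=.
Qed.

End Generators.

Arguments sym_X0 {K S str phi x y z p q c}.
Arguments sym_X1 {K S str phi x y z p q c}.
Arguments sym_X01 {K S str phi x y z p q c}.
Arguments sym_ev1z {K S str phi x y z p q c}.

(** * The symbol of a derivation of positive degree on [x] and [y] *)

Section Step.

Variables (K : fieldType) (charK : [pchar K] =i pred0).
Variables (S : idomainType) (str : {rmorphism K -> S}).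
Variables (phi : {poly K}) (x y z : S) (sys : system str phi x y z).
Variables (D : {additive S -> S}) (derD : is_derivation D).
Variables (lnD : locally_nilpotent D).

Local Notation d := (size phi).-1.
Local Notation dgD := (dg str D).
Local Notation ld := (lead str D).

Let Dstr : forall k, D (str k) = 0 := D_str charK str derD lnD.

Lemma der_ev1 t (P : {poly K}) : D (ev1 str t P) = ev1 str t P^`() * D t.
Proof.
elim/poly_ind: P => [|P k IH]; first by rewrite deriv0 !rmorph0 raddf0 mul0r.
rewrite derivD derivM derivX derivC addr0 mulr1 !rmorphD !rmorphM raddfD derD /=.
rewrite ev1X ev1C IH Dstr addr0; ring.
Qed.

Variables (p q c : nat) (p_gt0 : (0 < p)%N) (q_gt0 : (0 < q)%N).
Hypotheses (dgx : dgD p x) (dgy : dgD q y) (dgz : dgD c z).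

Local Notation alpha := (ld p x).
Local Notation gamma := (ld q y).
Local Notation beta := (ld c z).

Lemma lead_scale n k a : ld n (str k * a) = str k * ld n a.
Proof.
rewrite /lead mulrCA; congr (_ * _); elim: n => //= n ->.
by rewrite derD Dstr mul0r add0r.
Qed.

Lemma dle_scale n k a : dle D n a -> dle D n (str k * a).
Proof.
by move=> an; have := dleM derD (dle_ker (Dstr k)) an; rewrite add0n.
Qed.

Lemma dle_ev1 n t (P : {poly K}) : dle D n t -> dle D ((size P).-1 * n) (ev1 str t P).
Proof.
move=> tn; rewrite ev1E; apply: big_ind => [||i _]; first exact: dle0.
  by move=> a b; exact: dleD.
apply: dle_scale; apply: dle_mono (dleX derD i tn) _.
by rewrite leq_mul2r -ltnS; have := ltn_ord i; lia.
Qed.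

Lemma lead_ev1_monic n t (P : {poly K}) : P \is monic -> (0 < n)%N -> dle D n t ->
  ld ((size P).-1 * n) (ev1 str t P) = ld n t ^+ (size P).-1.
Proof.
move=> mP n0 tn; have sP : (0 < size P)%N by rewrite size_poly_gt0 monic_neq0.
rewrite ev1E -(prednK sP) big_ord_recr /= leadD lead_scale (leadX charK str derD) //.
have -> : P`_(size P).-1 = 1 by rewrite -lead_coefE; apply/monicP.
rewrite rmorph1 mul1r lead_sum big1 ?add0r // => i _; rewrite lead_scale.
by rewrite (lead_gt str (dleX derD i tn)) ?mulr0 // ltn_mul2r n0 /=.
Qed.

(** If [z] had degree 0, so would [phi(z) = x y], whose degree is [p + q]. *)
Lemma c_gt0 : (0 < c)%N.
Proof.
rewrite lt0n; apply/eqP => c0; have := dgM charK derD dgx dgy.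
rewrite (sys_rel sys) => -[_]; have := dle_ev1 phi dgz.1; rewrite c0 muln0 => E.
by rewrite (lead_gt str E) ?eqxx // addn_gt0 p_gt0.
Qed.

Lemma degree_sum : (p + q = d * c)%N.
Proof.
apply: (dg_uniq (dgM charK derD dgx dgy)); rewrite (sys_rel sys); split.
  exact: dle_ev1 dgz.1.
by rewrite (lead_ev1_monic (sys_monic sys) c_gt0 dgz.1) expf_neq0 // dgz.2.
Qed.

Lemma lead_rel : alpha * gamma = beta ^+ d.
Proof.
rewrite -(leadM charK str derD dgx.1 dgy.1) (sys_rel sys) degree_sum.
exact: lead_ev1_monic (sys_monic sys) c_gt0 dgz.1.
Qed.

Local Notation sym := (sym str phi x y z p q c).
Local Notation evl := (evm str d alpha gamma beta).

(** The leading coefficients satisfy [alpha gamma = beta^d] exactly, so symbols can be evaluated at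
    them multiplicatively. The weight only bounds the degree: a nonzero symbol may vanish there. *)
Lemma sym_lead n a T : sym n a T -> dle D n a /\ ld n a = evl T.
Proof.
elim=> {n a T}.
- move=> a b j; rewrite evm_mon mon_mnm2 ?(deg_gt0 sys) ?lead_rel //.
  have hx := dleX derD a dgx.1; have hy := dleX derD b dgy.1.
  have hz := dleX derD j dgz.1.
  split; first by apply: (dleM derD) hz; apply: (dleM derD).
  rewrite (leadM charK str derD (dleM derD hx hy) hz) (leadM charK str derD hx hy).
  by rewrite (leadX charK str derD _ dgx.1) (leadX charK str derD _ dgy.1) (leadX charK str derD _ dgz.1).
- move=> n a b T T' _ [an lan] _ [bn lbn]; split; first exact: dleD.
  by rewrite leadD evmD lan lbn.
- move=> n k a T _ [an lan]; split; first exact: dle_scale.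
  by rewrite lead_scale evmZ lan.
move=> n n' a T _ [an _] lt; split; first exact: dle_mono an (ltnW lt).
by rewrite (lead_gt str an lt) evm0.
Qed.

Lemma sym_0_const n a T : sym n a T -> n = 0%N -> exists k, a = str k /\ T = k%:MP.
Proof.
elim=> {n a T}.
- move=> a b j /eqP; rewrite !addn_eq0 !muln_eq0.
  rewrite (gtn_eqF p_gt0) (gtn_eqF q_gt0) (gtn_eqF c_gt0) !orbF => /andP[/andP[/eqP-> /eqP->] /eqP->].
  exists 1; rewrite rmorph1 mpolyC1 !mul1r muln0; split=> //.
  by rewrite -mpolyX0; congr 'X_[_]; apply: mnm2P; rewrite ?mnm2_0 ?mnm2_1 mnm0E.
- move=> n a b T T' _ IH1 _ IH2 n0; have [k [-> ->]] := IH1 n0.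
  by have [l [-> ->]] := IH2 n0; exists (k + l); rewrite rmorphD mpolyCD.
- move=> n k a T _ IH n0; have [l [-> ->]] := IH n0; exists (k * l).
  by rewrite rmorphM mpolyCM mul_mpolyC.
by move=> n n' a T _ _ lt n0; rewrite n0 in lt.
Qed.

Let pqc : (p + q = d * c)%N := degree_sum.
Let d_gt0 : (0 < d)%N := deg_gt0 sys.

Lemma sym_le n m a T : sym n a T -> (n <= m)%N -> exists T', sym m a T'.
Proof.
move=> sa; rewrite leq_eqVlt => /orP[/eqP <-|lt]; first by exists T.
by exists 0; apply: sym_lift sa lt.
Qed.

(** The least admissible [h] works: if all three symbols vanished, [h] could be decreased, and for
    [h = 0] this would contradict that [D x] has degree exactly [p - 1]. That same fact is why [h]
    can be a natural number. *)
Lemma shift_exists : exists h T1 T2 T3,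
  [/\ sym (p + h).-1 (D x) T1, sym (q + h).-1 (D y) T2,
      sym (c + h).-1 (D z) T3 & ~ [/\ T1 = 0, T2 = 0 & T3 = 0]].
Proof.
pose P h := `[< exists T1 T2 T3, [/\ sym (p + h).-1 (D x) T1,
  sym (q + h).-1 (D y) T2 & sym (c + h).-1 (D z) T3] >].
have exP : exists h, P h.
  have [n1 [T1 s1]] := sym_ex sys p q c (D x).
  have [n2 [T2 s2]] := sym_ex sys p q c (D y).
  have [n3 [T3 s3]] := sym_ex sys p q c (D z).
  exists (n1 + n2 + n3).+1; apply/asboolP.
  have [|T1' s1'] := sym_le (m := (p + (n1 + n2 + n3).+1).-1) s1; first lia.
  have [|T2' s2'] := sym_le (m := (q + (n1 + n2 + n3).+1).-1) s2; first lia.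
  have [|T3' s3'] := sym_le (m := (c + (n1 + n2 + n3).+1).-1) s3; first lia.
  by exists T1', T2', T3'.
case: (ex_minnP exP) => h /asboolP[T1 [T2 [T3 [s1 s2 s3]]]] hmin.
exists h, T1, T2, T3; split=> // -[T10 T20 T30].
rewrite {}T10 in s1; rewrite {}T20 in s2; rewrite {}T30 in s3.
case: h => [|h] in s1 s2 s3 hmin *.
  rewrite addn0 in s1; have [_] := sym_lead s1; rewrite evm0.
  have := dgx; rewrite -(prednK p_gt0) => /(dg_D charK)[_ /eqP].
  by rewrite (prednK p_gt0).
suff : P h by move/hmin; rewrite ltnn.
have low n a : (0 < n)%N -> sym (n + h.+1).-1 a 0 -> exists T, sym (n + h).-1 a T.
  rewrite addnS /= => n0 /(sym_lower sys p_gt0 q_gt0 pqc)[->|[n' [T [lt sT]]]].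
    by exists 0; exact: sym_0.
  by apply: (sym_le sT); lia.
have [T1' s1'] := low _ _ p_gt0 s1; have [T2' s2'] := low _ _ q_gt0 s2.
have [T3' s3'] := low _ _ c_gt0 s3.
by apply/asboolP; exists T1', T2', T3'.
Qed.

(** * The plane vector field lifting the symbol of [D] *)

Section Shift.

Variables (h : nat) (T1 T2 T3 : {mpoly K[2]}).
Hypotheses (sDx : sym (p + h).-1 (D x) T1) (sDy : sym (q + h).-1 (D y) T2)
  (sDz : sym (c + h).-1 (D z) T3).

(** Both sides are the symbol of [D(x y) = phi'(z) D z]; [d] is the leading coefficient of
    [phi']. *)
Lemma symbol_rel : T1 * 'X_i1 ^+ d + 'X_i0 ^+ d * T2 =
  (d%:R *: ('X_i0 * 'X_i1) ^+ d.-1) * T3.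
Proof.
have c0 := c_gt0.
apply: (sym_uniq sys p_gt0 q_gt0 pqc (n := (p + q + h).-1) (a := D (x * y))).
  rewrite derD; apply: sym_add.
    have -> : (p + q + h).-1 = ((p + h).-1 + q)%N by lia.
    exact: symM sDx sym_X1.
  have -> : (p + q + h).-1 = (p + (q + h).-1)%N by lia.
  exact: symM sym_X0 sDy.
rewrite (sys_rel sys) der_ev1.
have -> : (p + q + h).-1 = (d.-1 * c + (c + h).-1)%N.
  rewrite pqc -{1}(prednK d_gt0) mulSn; lia.
have -> : d%:R = (phi^`())`_d.-1 :> K.
  have -> : d%:R = phi`_d.-1.+1 *+ d.-1.+1; last by rewrite coef_deriv.
  rewrite prednK // -lead_coefE; have /monicP -> := sys_monic sys.
  by [].
apply: symM sDz; apply: (sym_ev1z c_gt0); rewrite prednK //.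
have /lt_size_deriv := monic_neq0 (sys_monic sys).
by have := sys_size sys; case: (size phi).
Qed.

(** The three formulas are the chain rule for [u^d], [v^d], [uv]. By [symbol_rel], [u^(d - 1)]
    divides [T1 v^d], hence [T1], and symmetrically for [T2]; the third formula follows by
    cancellation. *)
Lemma fields_exist : exists U : 'I_2 -> {mpoly K[2]},
  [/\ T1 = 'X_i0 ^+ d.-1 * U i0 *+ d, T2 = 'X_i1 ^+ d.-1 * U i1 *+ d &
      T3 = 'X_i1 * U i0 + 'X_i0 * U i1].
Proof.
have dK : d%:R != 0 :> K by have := natrK_neq0 charK d.-1; rewrite prednK.
have rel := symbol_rel; rewrite exprMn in rel.
have Xd (i : 'I_2) : 'X_i ^+ d = 'X_i * 'X_i ^+ d.-1 :> {mpoly K[2]}.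
  by rewrite -exprS prednK.
have [g1 [E1 _]] : exists g1, T1 = 'X_i0 ^+ d.-1 * g1 /\ forall m, g1@_m = T1@_(m + U_(i0) *+ d.-1)%MM.
  apply: mpoly_divX => m Tm.
  have E : 'X_i0 ^+ d.-1 * (d%:R *: 'X_i1 ^+ d.-1 * T3 - 'X_i0 * T2) = T1 * 'X_i1 ^+ d.
    apply: (addIr ('X_i0 ^+ d * T2)); rewrite rel (Xd i0) -!mul_mpolyC; ring.
  have := @mpoly_Xdiv _ i0 d.-1 (d%:R *: 'X_i1 ^+ d.-1 * T3 - 'X_i0 * T2)
    (U_(i1) *+ d + m)%MM.
  rewrite E mpolyXn mcoeffMX => /(_ Tm).
  by rewrite mnmDE mulmnE mnm1E mul0n.
have [g2 [E2 _]] : exists g2, T2 = 'X_i1 ^+ d.-1 * g2 /\ forall m, g2@_m = T2@_(m + U_(i1) *+ d.-1)%MM.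
  apply: mpoly_divX => m Tm.
  have E : 'X_i1 ^+ d.-1 * (d%:R *: 'X_i0 ^+ d.-1 * T3 - 'X_i1 * T1) = T2 * 'X_i0 ^+ d.
    apply: (addIr (T1 * 'X_i1 ^+ d)); rewrite [RHS]addrC [_ * 'X_i0 ^+ d]mulrC rel (Xd i1).
    by rewrite -!mul_mpolyC; ring.
  have := @mpoly_Xdiv _ i1 d.-1 (d%:R *: 'X_i0 ^+ d.-1 * T3 - 'X_i1 * T1)
    (U_(i0) *+ d + m)%MM.
  rewrite E mpolyXn mcoeffMX => /(_ Tm).
  by rewrite mnmDE mulmnE mnm1E mul0n.
exists (fun i => d%:R^-1 *: (if i == i0 then g1 else g2)) => /=.
have sc (f : {mpoly K[2]}) : d%:R^-1 *: f *+ d = f.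
  by rewrite -scaler_nat scalerA divff // scale1r.
rewrite -!scalerAr !sc; split=> //.
apply: (@mulfI _ ('X_i0 ^+ d.-1 * 'X_i1 ^+ d.-1)).
  by rewrite mulf_neq0 ?expf_neq0 ?mpolyX_neq0.
apply: (scalerI dK); rewrite scalerAl -rel E1 E2 !(Xd _).
by rewrite -scalerDr -scalerAr scalerA divff // scale1r; ring.
Qed.

Variable U : 'I_2 -> {mpoly K[2]}.
Hypotheses (T1E : T1 = 'X_i0 ^+ d.-1 * U i0 *+ d)
  (T2E : T2 = 'X_i1 ^+ d.-1 * U i1 *+ d) (T3E : T3 = 'X_i1 * U i0 + 'X_i0 * U i1).

Local Notation V := (vfield U).
Let derV : is_derivation V := vfield_der U.

Definition shifted n a T := sym n a T /\ sym (n + h).-1 (D a) (V T).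

Lemma shifted_str k : shifted 0 (str k) k%:MP.
Proof.
split; first exact: sym_str.
by rewrite Dstr vfieldC; exact: sym_0.
Qed.

(** The predecessor in [(n + h).-1] is truncated when [n = h = 0]. Factors of weight 0 are therefore
    treated apart: they are scalars, killed by [D]. *)
Lemma shiftedM n m a b T T' :
  shifted n a T -> shifted m b T' -> shifted (n + m) (a * b) (T * T').
Proof.
move=> [sa sDa] [sb sDb]; split; first exact: symM.
rewrite derD derV.
case: (posnP n) => [n0|n_gt0].
  have [k [-> ->]] := sym_0_const sa n0.
  rewrite /= Dstr vfieldC !mul0r !add0r n0 add0n mul_mpolyC.
  exact: sym_scale.
case: (posnP m) => [m0|m_gt0].
  have [k [-> ->]] := sym_0_const sb m0.
  rewrite /= Dstr vfieldC !mulr0 !addr0 m0 addn0 mulrC [_ * k%:MP]mulrC mul_mpolyC.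
  exact: sym_scale.
apply: sym_add.
  have -> : (n + m + h).-1 = ((n + h).-1 + m)%N by lia.
  exact: symM sDa sb.
have -> : (n + m + h).-1 = (n + (m + h).-1)%N by lia.
exact: symM sa sDb.
Qed.

Lemma shiftedX n a T k : shifted n a T -> shifted (k * n) (a ^+ k) (T ^+ k).
Proof.
move=> sa; elim: k => [|k IH].
  by have := shifted_str 1; rewrite rmorph1 mpolyC1.
by rewrite !exprS mulSn; apply: shiftedM.
Qed.

Lemma VX0 : V ('X_i0 ^+ d) = T1. Proof. by rewrite DXd T1E. Qed.
Lemma VX1 : V ('X_i1 ^+ d) = T2. Proof. by rewrite DXd T2E. Qed.
Lemma VX01 : V ('X_i0 * 'X_i1) = T3.
Proof. by rewrite derV /= !vfieldX T3E; ring. Qed.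

Lemma sym_shift n a T : sym n a T -> sym (n + h).-1 (D a) (V T).
Proof.
elim=> {n a T}.
- move=> a b j; have -> : 'X_[mnm2 (d * a + j) (d * b + j)] =
      ('X_i0 ^+ d) ^+ a * ('X_i1 ^+ d) ^+ b * ('X_i0 * 'X_i1) ^+ j :> {mpoly K[2]}.
    rewrite (mpolyX2 K (mnm2 _ _) (isT : i0 != i1)) mnm2_0 mnm2_1 !exprD !exprM exprMn.
    by ring.
  apply: (proj2 (A := sym _ _ _)); apply: shiftedM; first apply: shiftedM.
  + by apply: shiftedX; split; [exact: sym_X0 | rewrite VX0].
  + by apply: shiftedX; split; [exact: sym_X1 | rewrite VX1].
  by apply: shiftedX; split; [exact: sym_X01 | rewrite VX01].
- by move=> n a b T T' _ IH1 _ IH2; rewrite !raddfD; apply: sym_add.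
- move=> n k a T _ IH; rewrite derD Dstr mul0r add0r -mul_mpolyC derV /= vfieldC.
  by rewrite mul0r add0r mul_mpolyC; apply: sym_scale.
move=> n n' a T sa IH lt; rewrite raddf0.
case: (posnP (n + h)) => [|nh]; last by apply: sym_lift IH _; lia.
move/eqP; rewrite addn_eq0 => /andP[/eqP n0 _].
by have [k [-> _]] := sym_0_const sa n0; rewrite Dstr; exact: sym_0.
Qed.

(** The iterates of [V] on [T] are symbols of the iterates of [D] on [a], and the only symbol of 0
    is 0. *)
Lemma sym_nilp n a T : sym n a T -> nilp V T.
Proof.
have [N DN] := lnD a => sa.
have it k : exists n', sym n' (iter k D a) (iter k V T).
  elim: k => [|k [n' IH]]; first by exists n.
  by exists (n' + h).-1; exact: sym_shift.
exists N; have [n'] := it N; rewrite DN.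
exact: (sym_eq0 sys p_gt0 q_gt0 pqc).
Qed.

Definition pqw (i : 'I_2) := if i == i0 then p else q.

Lemma pqw_gt0 i : (0 < pqw i)%N. Proof. by rewrite /pqw; case: eqP. Qed.

Lemma nilV i : nilp V ('X_i ^+ d).
Proof. by case: (I2P i) => ->; [apply: sym_nilp sym_X0 | apply: sym_nilp sym_X1]. Qed.

Lemma nilVX : nilp V ('X_i0 * 'X_i1).
Proof. exact: sym_nilp sym_X01. Qed.

Lemma supp_U i m : (U i)@_m != 0 -> balanced d (m + U_(i) *+ d.-1)%MM /\
  (wt p q (m + U_(i) *+ d.-1) = d * (pqw i + h).-1)%N.
Proof.
move=> Um; have dK : d%:R != 0 :> K by have := natrK_neq0 charK d.-1; rewrite prednK.
have nz : ('X_i ^+ d.-1 * U i *+ d)@_(m + U_(i) *+ d.-1)%MM != 0.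
  rewrite mcoeffMn mulrC mpolyXn addmC mcoeffMX -mulr_natl.
  by rewrite mulf_neq0.
move: nz; case: (I2P i) => ->; [rewrite -T1E | rewrite -T2E].
  exact: (sym_supp sys p_gt0 q_gt0 pqc sDx).
exact: (sym_supp sys p_gt0 q_gt0 pqc sDy).
Qed.

Lemma coset_U i j : i != j -> coset d i j 1 (U i).
Proof.
move=> ij m /supp_U[bal _].
have {bal} : (m i + d.-1 = m j %[mod d])%N.
  move: bal ij; rewrite /balanced !mnmDE !mulmnE !mnm1E.
  by case: (I2P i) => ->; case: (I2P j) => ->; rewrite ?eqxx //= ?mul1n ?mul0n ?addn0.
by move=> E; rewrite -[RHS]modnDml -E modnDml -addnA addn1 prednK // modnDr.
Qed.

Lemma homog_U i j : i != j -> forall m, (U i)@_m != 0 ->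
  (pqw i * m i + pqw j * m j + d = pqw i + d * h)%N.
Proof.
move=> ij m /supp_U[_]; have wi := pqw_gt0 i.
have -> : wt p q (m + U_(i) *+ d.-1) = (pqw i * (m i + d.-1) + pqw j * m j)%N.
  move: ij; rewrite /wt !mnmDE !mulmnE !mnm1E.
  by case: (I2P i) => ->; case: (I2P j) => ->;
    rewrite ?eqxx //= ?mul1n ?mul0n ?addn0 // /pqw addnC.
have -> : (d * (pqw i + h).-1 = d * (pqw i + h) - d)%N by rewrite -(subn1 (pqw i + h)) mulnBr muln1.
have le : (d <= d * (pqw i + h))%N by rewrite leq_pmulr // addn_gt0 wi.
move/(congr1 (addn^~ d)) => /=; rewrite subnK // mulnDr.
have -> : (pqw i * d.-1 = pqw i * d - pqw i)%N by rewrite -(subn1 d) mulnBr muln1.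
have : (pqw i <= pqw i * d)%N by rewrite leq_pmulr.
rewrite mulnDr [(d * pqw i)%N]mulnC.
move: (pqw i * m i)%N (pqw j * m j)%N (pqw i * d)%N (d * h)%N (pqw i).
by clear; move=> *; lia.
Qed.

Lemma weights_sum : (pqw i0 + pqw i1 = d * c)%N. Proof. exact: pqc. Qed.

Lemma field_neq0 (i : 'I_2) : U i != 0 -> 'X_i ^+ d.-1 * U i *+ d != 0.
Proof.
move=> Ui; rewrite -mulr_natl !mulf_neq0 ?expf_neq0 ?mpolyX_neq0 //.
by have := natrA_neq0 charK (@mpolyC 2 K) d.-1; rewrite prednK.
Qed.

Lemma evl_monomial (e e' : nat) k : k != 0 -> evl (k *: 'X_[mnm2 e e']) != 0.
Proof.
move=> k0; rewrite evmZ evm_mon mulf_neq0 ?str_eq0 // /mon.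
by case: ifP => _; rewrite mulf_neq0 ?expf_neq0 ?(proj2 dgx) ?(proj2 dgy) ?(proj2 dgz).
Qed.

Hypothesis T_neq0 : ~ [/\ T1 = 0, T2 = 0 & T3 = 0].

Let dgDx : dgD p.-1 (D x).
Proof. by apply: (dg_D charK); rewrite prednK. Qed.

Let dgDy : dgD q.-1 (D y).
Proof. by apply: (dg_D charK); rewrite prednK. Qed.

(** If it vanished, [U i1] and hence [T2] would be a single monomial, nonzero at the leading
    coefficients; so [D y] would have degree [q + h - 1], forcing [h = 0]. Then [T1 = 0] contradicts
    the degree [p - 1] of [D x]. *)
Lemma U0_neq0 : U i0 != 0.
Proof.
apply/eqP => U0; have U1 : U i1 != 0.
  by apply/eqP => U1; apply: T_neq0; rewrite T1E T2E T3E U0 U1 !mulr0 !mul0rn addr0.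
have [e [k [k0 UE]]] := single_monomial charK d_gt0 c_gt0 pqw_gt0 weights_sum nilV
  nilVX coset_U homog_U (isT : i0 != i1) U0 U1.
have [_] := sym_lead sDy.
have -> : T2 = (k *+ d) *: 'X_[mnm2 e d.-1].
  rewrite T2E UE (mpolyX2 K (mnm2 _ _) (isT : i0 != i1)) mnm2_0 mnm2_1.
  by rewrite -scalerAr scalerMnl mulrC.
have kd : k *+ d != 0.
  by rewrite -mulr_natl mulf_neq0 //; have := natrK_neq0 charK d.-1; rewrite prednK.
move=> ld; have := evl_monomial e d.-1 kd; rewrite -ld => nz.
have h0 : h = 0%N.
  apply/eqP; rewrite -leqn0 leqNgt; apply: contra nz => h_gt0; apply/eqP.
  by apply: lead_gt dgDy.1 _; lia.
have [_] := sym_lead sDx; rewrite h0 addn0 T1E U0 mulr0 mul0rn evm0.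
by move/eqP; rewrite (negbTE dgDx.2).
Qed.

Lemma U1_neq0 : U i1 != 0.
Proof.
apply/eqP => U1; have U0 := U0_neq0.
have [e [k [k0 UE]]] := single_monomial charK d_gt0 c_gt0 pqw_gt0 weights_sum nilV
  nilVX coset_U homog_U (isT : i1 != i0) U1 U0.
have [_] := sym_lead sDx.
have -> : T1 = (k *+ d) *: 'X_[mnm2 d.-1 e].
  rewrite T1E UE (mpolyX2 K (mnm2 _ _) (isT : i0 != i1)) mnm2_0 mnm2_1.
  by rewrite -scalerAr scalerMnl.
have kd : k *+ d != 0.
  by rewrite -mulr_natl mulf_neq0 //; have := natrK_neq0 charK d.-1; rewrite prednK.
move=> ld; have := evl_monomial d.-1 e kd; rewrite -ld => nz.
have h0 : h = 0%N.
  apply/eqP; rewrite -leqn0 leqNgt; apply: contra nz => h_gt0; apply/eqP.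
  by apply: lead_gt dgDx.1 _; lia.
have [_] := sym_lead sDy; rewrite h0 addn0 T2E U1 mulr0 mul0rn evm0.
by move/eqP; rewrite (negbTE dgDy.2).
Qed.

Lemma p_dvd_c : (p <= q)%N -> (p %| c)%N.
Proof.
exact: (weight_dvd charK d_gt0 c_gt0 pqw_gt0 weights_sum nilV nilVX coset_U homog_U
  U0_neq0 U1_neq0).
Qed.

Let inKM a b : (exists k, a = str k) -> (exists k, b = str k) ->
  exists k, a * b = str k.
Proof. by move=> [k ->] [l ->]; exists (k * l); rewrite rmorphM. Qed.

Let inKX a n : (exists k, a = str k) -> exists k, a ^+ n = str k.
Proof. by move=> [k ->]; exists (k ^+ n); rewrite rmorphXn. Qed.

(* If h = 0 then d = p = 1, and the leading coefficients are constants. *)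
Lemma lead_proportional0 s : h = 0%N -> (p <= q)%N ->
  exists l, beta = str l * alpha ^+ s.
Proof.
move=> h0 le_pq; have a0 : alpha != 0 := dgx.2; have U0 := U0_neq0.
have [m Um m0] := supp_edge charK d_gt0 c_gt0 weights_sum nilV nilVX coset_U
  (isT : i0 != i1) U0.
have /= hom := homog_U (isT : i0 != i1) Um.
rewrite m0 h0 !muln0 add0n addn0 /pqw /= in hom.
have m1 : m i1 = 0%N.
  apply/eqP; rewrite -leqn0 leqNgt; apply/negP => m1.
  have le_q : (q <= q * m i1)%N by rewrite leq_pmulr.
  have : (q < p)%N by rewrite -hom -addn1 leq_add.
  by rewrite ltnNge le_pq.
have d1 : d = 1%N.
  have := coset_U (isT : i0 != i1) Um; rewrite m0 m1 add0n mod0n.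
  by case: d d_gt0 => [|[|d']] // _; rewrite modn_small.
have p1 : p = 1%N by move: hom; rewrite m1 muln0 add0n d1 => <-.
have [a aE] : exists a, alpha = str a.
  have [|k [Dxk _]] := sym_0_const sDx; first by rewrite h0 p1.
  by apply: inKM; [eexists | exists k; rewrite p1 /= Dxk].
have [g gE] : exists g, gamma = str g.
  (* A symbol of weight [q - 1] contains only powers of [u], and [alpha] is already a scalar. The
     leading coefficient of [D y] is [q gamma], so [gamma] is a scalar too. *)
  have : exists g, ld q.-1 (D y) = str g.
    have [_] := sym_lead sDy; rewrite h0 addn0 => ->; rewrite /evm big_seq.
    apply: (big_ind (fun a => exists k, a = str k)); first by exists 0; rewrite rmorph0.
      by move=> ? ? [k ->] [l ->]; exists (k + l); rewrite rmorphD.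
    move=> m'; rewrite mcoeff_msupp => /(sym_supp sys p_gt0 q_gt0 pqc sDy)[_].
    rewrite /wt d1 p1 mul1n h0 addn0 mul1n => wm.
    have m'1 : m' i1 = 0%N.
      apply/eqP; rewrite -leqn0 leqNgt; apply/negP => m'1.
      have le_q : (q <= q * m' i1)%N by rewrite leq_pmulr.
      have := leq_trans le_q (leq_addl (m' i0) _); rewrite wm.
      by rewrite -ltnS prednK // ltnn.
    rewrite /mon m'1 leq0n expr0 mulr1 /=; apply: inKM; first by eexists.
    by apply: inKX; exists a; rewrite -aE p1.
  rewrite (lead_D charK) prednK // -(rmorph_nat str) => -[g E]; exists (q%:R^-1 * g).
  have qK : q%:R != 0 :> K by have := natrK_neq0 charK q.-1; rewrite prednK.
  by rewrite rmorphM -E mulrA -rmorphM mulVf // rmorph1 mul1r.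
have bE : beta = str (a * g) by rewrite rmorphM -aE -gE lead_rel d1 expr1.
exists (a * g / a ^+ s).
have aK : a ^+ s != 0 by rewrite expf_neq0 // -(str_eq0 str) -aE.
by rewrite aE -rmorphXn -rmorphM /= divfK.
Qed.

(** For [h > 0], [D x] has degree below [p + h - 1], so [T1] vanishes at the leading coefficients
    although it is nonzero. Eliminating [gamma] by [alpha gamma = beta^d] turns this into a form in
    [beta] and [alpha^s], to which algebraic closedness applies. *)
Lemma lead_proportional s : (p <= q)%N -> c = (s * p)%N ->
  exists l, beta = str l * alpha ^+ s.
Proof.
move=> le_pq cE; case: (posnP h) => [h0|h_gt0]; first exact: lead_proportional0.
have a0 : alpha != 0 := dgx.2.
have s_gt0 : (0 < s)%N by have := c_gt0; rewrite cE muln_gt0 => /andP[].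
have ev0 : evl T1 = 0.
  by have [_ <-] := sym_lead sDx; apply: lead_gt dgDx.1 _; lia.
have T1n0 : msupp T1 != [::] by rewrite msupp_eq0 T1E; apply/field_neq0/U0_neq0.
have word m : T1@_m != 0 -> exists a b j, [/\ m i1 = (d * b + j)%N,
    (a * p + b * q + j * c = (p + h).-1)%N &
    mon d alpha gamma beta m = alpha ^+ a * gamma ^+ b * beta ^+ j].
  move=> Tm; have [bm wm] := sym_supp sys p_gt0 q_gt0 pqc sDx Tm.
  have [a [b [j [mE monE]]]] := balanced_word S bm; exists a, b, j.
  split; rewrite ?monE // ?mE ?mnm2_1 //.
  by move: wm; rewrite mE (wt_mnm2 p_gt0 q_gt0 pqc) => /eqP; rewrite eqn_pmul2l // => /eqP.
have [mx mxT mx_max] := seq_argmax (fun m : 'X_{1..2} => m i1) T1n0.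
have Tmx : T1@_mx != 0 by rewrite -mcoeff_msupp.
have wordE m a b j : (m = d * b + j)%N -> (a * p + b * q + j * c = (p + h).-1)%N ->
    ((a + s * m) * p = (p + h).-1 + b * p)%N.
  move=> -> <-; have : (b * (p + q) = b * (d * c))%N by rewrite pqc.
  rewrite cE !mulnDl !mulnDr; lia.
pose N := ((p + h).-1 %/ p)%N.
have NE : (p + h).-1 = (N * p)%N.
  have [a [b [j [m1E wE _]]]] := word mx Tmx.
  apply/esym/divnK; rewrite -(dvdn_addl _ (dvdn_mull b (dvdnn p))).
  by rewrite -(wordE _ _ _ _ m1E wE) dvdn_mull.
have wordN m a b j : (m = d * b + j)%N -> (a * p + b * q + j * c = (p + h).-1)%N ->
    (a + s * m = N + b)%N.
  move=> m1E wE; apply/eqP; rewrite -(eqn_pmul2r p_gt0).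
  by rewrite (wordE _ _ _ _ m1E wE) NE mulnDl.
(* Eliminating [gamma] from a word of [T1] leaves [alpha^(N - s m) beta^m] with [m = m i1], the
   exponent of [alpha] being possibly negative. Multiplied by [alpha^M] it becomes
   [(alpha^s)^(L - m) beta^m]. *)
pose L := (N + mx i1)%N; pose M := (s * L - N)%N.
(* The minimum only provides a bound valid for every [m]; on the support of [T1] it is [m i1]. *)
pose F := \sum_(m <- msupp T1) T1@_m *: 'X^(minn (m i1) L).
have leL m : m \in msupp T1 -> minn (m i1) L = m i1.
  by move=> /mx_max /= le; apply/minn_idPl/(leq_trans le)/leq_addl.
have leN : (N + s * mx i1 <= s * L)%N by rewrite mulnDr leq_add2r leq_pmull.
have FE : hform str L F beta (alpha ^+ s) = 0.
  rewrite hform_sumX => [|m]; last exact: geq_minr.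
  transitivity (alpha ^+ M * evl T1); last by rewrite ev0 mulr0.
  rewrite /evm mulr_sumr big_seq [RHS]big_seq.
  apply: eq_bigr => m mT; rewrite (leL _ mT) -mulrA [RHS]mulrCA; congr (_ * _).
  have /word[a [b [j [m1E wE ->]]]] : T1@_m != 0 by rewrite -mcoeff_msupp.
  have wN := wordN _ _ _ _ m1E wE.
  have le_m : (s * m i1 <= s * mx i1)%N by rewrite leq_mul2l mx_max ?orbT.
  have le_b : (b <= s * m i1)%N.
    apply: leq_trans (leq_pmull _ s_gt0); rewrite m1E.
    by apply: leq_trans (leq_addr _ _); rewrite leq_pmull.
  have ab : alpha ^+ M * (alpha ^+ a * gamma ^+ b * beta ^+ j) =
      alpha ^+ (M - b + a) * (alpha * gamma) ^+ b * beta ^+ j.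
    have le_bM : (b <= M)%N by rewrite /M; lia.
    have -> : alpha ^+ M = alpha ^+ (M - b) * alpha ^+ b by rewrite -exprD subnK.
    have gen (u v w : S) k : u ^+ k * u ^+ b * (u ^+ a * v ^+ b * w) =
        u ^+ (k + a) * (u * v) ^+ b * w by rewrite exprD exprMn; ring.
    exact: gen.
  rewrite ab lead_rel -!exprM -mulrA -exprD -m1E mulrC; congr (_ ^+ _ * _).
  by rewrite mulnBr /M; lia.
(* By homogeneity [m i1] determines [m], so the terms of [F] have distinct exponents and [F] is not
   zero. *)
have Fmx : F`_(mx i1) = T1@_mx.
  rewrite /F coef_sum (bigD1_seq mx) ?msupp_uniq //= leL // coefZ coefXn eqxx mulr1.
  rewrite big1_seq ?addr0 // => m /andP[ne mT]; rewrite leL // coefZ coefXn.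
  case: eqP => [e1|_]; last by rewrite mulr0.
  case/eqP: ne; apply: mnm2P => //.
  have [_ w1] := sym_supp sys p_gt0 q_gt0 pqc sDx Tmx.
  have [|_ w2] := sym_supp sys p_gt0 q_gt0 pqc sDx (m := m); first by rewrite -mcoeff_msupp.
  move: w2; rewrite -w1 /wt e1 => /eqP; rewrite eqn_add2r eqn_pmul2l //.
  by move/eqP.
apply: (sys_alg_closed sys (M := L) (F := F)) => //.
- by rewrite expf_neq0.
- by apply: contraNneq Tmx => F0; rewrite -Fmx F0 coef0.
rewrite /F; apply: (leq_trans (size_sum _ _ _)); apply/bigmax_leqP_seq => m mT _.
by apply: leq_trans (size_scale_leq _ _) _; rewrite size_polyXn ltnS geq_minr.
Qed.

End Shift.

Lemma lower_z : (p <= q)%N -> exists s l,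
  (0 < s)%N /\ dle D c.-1 (z - str l * x ^+ s).
Proof.
move=> le_pq; have [h [T1 [T2 [T3 [s1 s2 s3 nz]]]]] := shift_exists.
have [U [E1 E2 E3]] := fields_exist s1 s2 s3.
have /dvdnP[s cE] := p_dvd_c s1 s2 s3 E1 E2 E3 nz le_pq.
have [l El] := lead_proportional s1 s2 s3 E1 E2 E3 nz le_pq cE.
exists s, l; split; first by have := c_gt0; rewrite cE muln_gt0 => /andP[].
have dxs : dle D c (x ^+ s) by rewrite cE; exact: (dleX derD s dgx.1).
have dzx : dle D c (z - str l * x ^+ s).
  by apply: dleD; [exact: dgz.1 | rewrite -mulNr -rmorphN; apply: dle_scale].
have c1 := prednK c_gt0; apply: (dle_pred charK (str := str)); rewrite c1 //.
have lxs : ld c (x ^+ s) = alpha ^+ s.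
  by rewrite -(leadX charK str derD _ dgx.1) cE.
by rewrite leadD -mulNr -rmorphN lead_scale lxs El rmorphN mulNr subrr.
Qed.

End Step.

(** * Changes of coordinates *)

Section Change.

Variables (K : fieldType) (S : idomainType) (str : {rmorphism K -> S}).
Variables (phi : {poly K}) (x y z : S) (sys : system str phi x y z).

Local Notation d := (size phi).-1.

Lemma closed_ev1 (B : S -> Prop) t (P : {poly K}) :
  (forall k, B (str k)) -> (forall a b, B a -> B b -> B (a + b)) ->
  (forall a b, B a -> B b -> B (a * b)) -> B t -> B (ev1 str t P).
Proof.
move=> Bs BD BM Bt; elim/poly_ind: P => [|P k IH].
  by rewrite rmorph0 -(rmorph0 str).
by rewrite rmorphD rmorphM /= ev1X ev1C; apply/BD => //; apply/BM.
Qed.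

Lemma closed_ev2 (B : S -> Prop) s t (P : {poly {poly K}}) :
  (forall k, B (str k)) -> (forall a b, B a -> B b -> B (a + b)) ->
  (forall a b, B a -> B b -> B (a * b)) -> B s -> B t -> B (ev2 str s t P).
Proof.
move=> Bs BD BM Bx Bz; elim/poly_ind: P => [|P k IH].
  by rewrite rmorph0 -(rmorph0 str).
rewrite rmorphD rmorphM /= ev2X ev2C; apply/BD; first exact/BM.
exact: closed_ev1.
Qed.

Lemma ev1_shift (P W : {poly K}) : exists h,
  ev1 str (z + ev1 str x W) P = ev1 str z P + ev1 str x W * ev2 str x z h.
Proof.
elim/poly_ind: P => [|P k [h IH]].
  by exists 0; rewrite !rmorph0 mulr0 addr0.
exists (map_poly polyC P + h * ('X + W%:P)).
rewrite !rmorphD !rmorphM !rmorphD /= !ev1X !ev1C IH ev2_map ev2X ev2C; ring.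
Qed.

Variables (a c : K) (g : {poly K}) (a0 : a != 0) (c0 : c != 0).

(** The constant term of [g] cannot be absorbed into [y], so it translates the argument of [phi];
    the factor [c^d] keeps the result monic. *)
Definition change_phi := c ^+ d *: (phi \Po (c^-1 *: ('X - (g`_0)%:P))).

Let q := c^-1 *: ('X - (g`_0)%:P).

Let size_q : size q = 2.
Proof. by rewrite size_scale ?invr_eq0 // size_XsubC. Qed.

Lemma size_change_phi : size change_phi = size phi.
Proof. by rewrite size_scale ?expf_neq0 // size_comp_poly2 // size_q. Qed.

Lemma change_phi_monic : change_phi \is monic.
Proof.
rewrite monicE lead_coefZ lead_coef_comp ?size_q // lead_coefZ lead_coefXsubC mulr1.
by rewrite (monicP (sys_monic sys)) mul1r -exprMn divff // expr1n.
Qed.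

(** The part [W] of the translation of [z] is a multiple of [x], and [phi(z + W) - phi(z)] is a
    multiple of [W]; so [x] still divides the new value of [phi], and the quotient is the new
    [y]. *)
Lemma change_coordinates : exists y',
  system str change_phi (str a * x) y' (str c * z + ev1 str x g).
Proof.
have [g1 gE] : exists g1, g = g1 * 'X + (g`_0)%:P.
  elim/poly_ind: g => [|g1 k _]; first by exists 0; rewrite mul0r coef0 add0r polyC0.
  by exists g1; rewrite coefD coefMX coefC eqxx add0r.
pose W := c^-1 *: (g1 * 'X).
have [h hE] := ev1_shift phi W.
pose y' := str (a^-1 * c ^+ d) * (y + str c^-1 * ev1 str x g1 * ev2 str x z h).
exists y'; have sa0 : str a != 0 by rewrite str_eq0.
have sc0 : str c != 0 by rewrite str_eq0.
have zE : str c * z + ev1 str x g = str c * (z + ev1 str x W) + str g`_0.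
  rewrite /W ev1Z {1}gE rmorphD /= ev1C mulrDr mulrA -rmorphM divff //.
  by rewrite rmorph1 mul1r addrA.
split.
- by rewrite size_change_phi (sys_size sys).
- exact: change_phi_monic.
- rewrite /change_phi ev1Z ev1_comp ev1Z rmorphB /= ev1X ev1C zE addrK.
  rewrite mulrA -rmorphM mulVf // rmorph1 mul1r hE -(sys_rel sys) /W ev1Z.
  rewrite rmorphM /= ev1X /y' rmorphM /= mulrACA -rmorphM mulrA -rmorphM.
  have -> : a * (a^-1 * c ^+ d) = c ^+ d by rewrite mulrA divff // mul1r.
  ring.
- move=> B Bs BG BD BM; have Bx' : B (str a * x) by apply: BG; constructor 1.
  have By' : B y' by apply: BG; constructor 2.
  have Bz' : B (str c * z + ev1 str x g) by apply: BG; constructor 3.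
  have BN b : B b -> B (- b).
    move=> Bb; have -> : - b = str (-1) * b by rewrite rmorphN rmorph1 mulN1r.
    exact: BM.
  have Bx : B x.
    have -> : x = str a^-1 * (str a * x) by rewrite mulrA -rmorphM mulVf // rmorph1 mul1r.
    exact: BM.
  have Bz : B z.
    have -> : z = str c^-1 * ((str c * z + ev1 str x g) - ev1 str x g).
      by rewrite addrK mulrA -rmorphM mulVf // rmorph1 mul1r.
    by apply: (BM _ _ (Bs _)); apply: (BD _ _ Bz'); apply: BN; exact: (closed_ev1 _ Bs BD BM Bx).
  apply: (sys_gen sys) => // b [] -> //.
  have -> : y = str (a * c ^- d) * y' - str c^-1 * ev1 str x g1 * ev2 str x z h.
    rewrite /y' mulrA -rmorphM.
    have -> : a * c ^- d * (a^-1 * c ^+ d) = 1.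
      rewrite mulrACA divff // mul1r; apply: mulVf.
      exact: expf_neq0.
    by rewrite rmorph1 mul1r addrK.
  apply: (BD _ _ (BM _ _ (Bs _) By')); apply/BN/BM; last exact: (closed_ev2 h Bs BD BM Bx Bz).
  by apply: (BM _ _ (Bs _)); exact: (closed_ev1 _ Bs BD BM Bx).
move=> P P0.
(* Independence: substituting [a x] for [x] and [c z + g(x)] for [z] is injective on polynomials,
   both being of degree 1 in their variable. *)
pose r : {poly {poly K}} := c%:P%:P * 'X + g%:P.
have size_r : size r = 2.
  by rewrite size_MXaddC polyC_eq0 polyC_eq0 (negbTE c0) /= size_polyC polyC_eq0 c0.
pose ax : {poly K} := a *: 'X.
have size_ax : size ax = 2 by rewrite size_scale // size_polyX.
have E Q : ev2 str x z (map_poly (comp_poly ax) Q \Po r) =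
    ev2 str (str a * x) (str c * z + ev1 str x g) Q.
  elim/poly_ind: Q => [|Q k IH]; first by rewrite map_poly0 comp_poly0 !rmorph0.
  rewrite rmorphD rmorphM /= map_polyX map_polyC /= comp_polyD comp_polyM comp_polyX.
  rewrite comp_polyC !rmorphD !rmorphM /= IH !ev2C !ev2X ev1_comp ev1Z ev1X.
  by rewrite rmorphD rmorphM /= !ev2C ev2X ev1C.
apply/eqP; rewrite -(size_poly_eq0 P); move: P0; rewrite -E => /(sys_free sys) /eqP.
rewrite comp_poly_eq0 ?size_r // => /eqP mP0.
have inj : injective (comp_poly ax).
  move=> u v /= /eqP; rewrite -subr_eq0 -comp_polyB comp_poly_eq0 ?size_ax //.
  by rewrite subr_eq0 => /eqP.
have : size (map_poly (comp_poly ax) P) = size P.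
  by apply: size_map_inj_poly => //; rewrite comp_poly0.
by rewrite mP0 size_poly0 => <-.
Qed.

End Change.

Section Swap.

Variables (K : fieldType) (S : idomainType) (str : {rmorphism K -> S}).
Variables (phi : {poly K}) (x y z : S) (sys : system str phi x y z).

Local Notation d := (size phi).-1.

(** Only independence is not symmetric. The words [y^k z^j] are normal words with distinct exponents
    [(j, d k + j)], so [evm_free] gives it for [y, z]. *)
Lemma system_swap : system str phi y x z.
Proof.
have d_gt0 := deg_gt0 sys.
case: (sys) => szphi monphi rel gen free; split=> //.
- by rewrite mulrC.
- move=> B Bs BG BD BM; apply: gen => // a [] ->; apply: BG;
    [constructor 2 | constructor 1 | constructor 3]; done.
move=> P P0.
pose f : {mpoly K[2]} := \sum_(j < size P) \sum_(k < size P`_j)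
  P`_j`_k *: 'X_[mnm2 j (d * k + j)].
have f0 : f = 0.
  apply: (evm_free sys).
    move=> m nz; apply: contrapT => bal; case/eqP: nz; rewrite raddf_sum.
    apply: big1 => j _; rewrite raddf_sum; apply: big1 => k _ /=.
    rewrite mcoeffZ mcoeffX; case: eqP => [E|_]; last by rewrite mulr0.
    by case: bal; rewrite /balanced -E mnm2_0 mnm2_1 mulnC modnMDl.
  rewrite -[RHS]P0 -[in RHS](coefK P) poly_def rmorph_sum.
  have evm_sum n (F : nat -> {mpoly K[2]}) :
      evm str d x y z (\sum_(i < n) F i) = \sum_(i < n) evm str d x y z (F i).
    by apply: (big_morph _ (evmD str d x y z) (evm0 str d x y z)).
  rewrite (evm_sum _ (fun j => \sum_(k < size P`_j) P`_j`_k *: 'X_[mnm2 j (d * k + j)])).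
  apply: eq_bigr => j _.
  rewrite -mul_polyC rmorphM rmorphXn /= ev2X ev2C ev1E mulr_suml.
  rewrite (evm_sum _ (fun k => P`_j`_k *: 'X_[mnm2 j (d * k + j)])).
  apply: eq_bigr => k _; rewrite evmZ evm_mon /mon mnm2_0 mnm2_1 addnK mulKn // -mulrA.
  congr (_ * _); case: leqP => // le; case: (posnP k) => [->|k_gt0].
    by rewrite muln0 add0n subnn div0n.
  have : (0 < d * k)%N by rewrite muln_gt0 d_gt0.
  by move: le; case: (d * k)%N => // n; rewrite addSn ltnNge leq_addl.
apply/polyP => j; apply/polyP => k; rewrite !coef0.
case: (ltnP j (size P)) => [lt_j|le]; last by rewrite (nth_default _ le) coef0.
case: (ltnP k (size P`_j)) => [lt_k|le]; last by rewrite nth_default.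
have := congr1 (mcoeff (mnm2 j (d * k + j))) f0.
rewrite mcoeff0 raddf_sum (bigD1 (Ordinal lt_j)) //= [X in _ + X]big1 => [|j' ne].
  rewrite addr0 raddf_sum (bigD1 (Ordinal lt_k)) //= mcoeffZ mcoeffX eqxx mulr1.
  rewrite big1 ?addr0 // => k' ne; rewrite mcoeffZ mcoeffX; case: eqP => [E|_].
    case/eqP: ne; apply: val_inj => /=; move/(congr1 (fun m : 'X_{1..2} => m i1)): E.
    by rewrite !mnm2_1 => /eqP; rewrite eqn_add2r eqn_pmul2l // => /eqP.
  by rewrite mulr0.
rewrite raddf_sum; apply: big1 => k' _; rewrite /= mcoeffZ mcoeffX; case: eqP => [E|_].
  case/eqP: ne; apply: val_inj => /=; move/(congr1 (fun m : 'X_{1..2} => m i0)): E.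
  by rewrite !mnm2_0.
by rewrite mulr0.
Qed.

End Swap.

(** * Straightening by induction on the degree of [z] *)

Section Straighten.

Variables (K : fieldType) (charK : [pchar K] =i pred0).
Variables (S : idomainType) (str : {rmorphism K -> S}).
Variables (D : {additive S -> S}) (derD : is_derivation D).
Variables (lnD : locally_nilpotent D).

Lemma dg_ex a : a != 0 -> exists n, dg str D n a.
Proof. by have [n an] := lnD a; apply: dg_exists an. Qed.

Lemma sys_y_neq0 phi x y z : system str phi x y z -> y != 0.
Proof. by move/system_swap/sys_x_neq0. Qed.

Lemma sys_z_neq0 phi x y z : system str phi x y z -> z != 0.
Proof.
move=> sys; apply/eqP => z0; have := sys_free sys (P := 'X); rewrite ev2X.
by move/(_ z0)/eqP; rewrite polyX_eq0.
Qed.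

Theorem straighten phi x y z : system str phi x y z ->
  exists phi' x' y' z', system str phi' x' y' z' /\ D x' = 0.
Proof.
move=> sys; have [c] := dg_ex (sys_z_neq0 sys).
elim/ltn_ind: c phi x y z sys => c IH phi x y z sys dz.
have [p dx] := dg_ex (sys_x_neq0 sys); have [q dy] := dg_ex (sys_y_neq0 sys).
case: (posnP p) => [p0|p0].
  by exists phi, x, y, z; split=> //; rewrite p0 in dx; exact: dg0_ker dx.
case: (posnP q) => [q0|q0].
  exists phi, y, x, z; split; first exact: system_swap.
  by rewrite q0 in dy; exact: dg0_ker dy.
wlog le : x y p q sys dx dy p0 q0 / (p <= q)%N.
  move=> wl; case: (leqP p q) => [|/ltnW] le; first exact: (wl x y p q).
  exact: (wl y x q p (system_swap sys)).
have [s [l [s0 lez]]] := lower_z charK sys derD lnD p0 q0 dx dy dz le.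
have [y'] := change_coordinates sys (- l *: 'X^s) (oner_neq0 K) (oner_neq0 K).
set phi' := change_phi _ _ _.
have -> : str 1 * z + ev1 str x (- l *: 'X^s) = z - str l * x ^+ s.
  by rewrite rmorph1 mul1r ev1Z rmorphXn /= ev1X rmorphN mulNr.
move=> sys'; have [c' lt_c' dz'] := dle_dg charK str lez (sys_z_neq0 sys').
apply: IH sys' dz'.
by have := c_gt0 charK sys derD lnD p0 q0 dx dy dz; case: (c) lt_c'.
Qed.

End Straighten.

(** * Forms of the affine line *)

Section FormOfLine.

Variables (K : fieldType) (charK : [pchar K] =i pred0).
Variables (la : K -> K) (pi : {additive {poly K} -> {poly K}}).
Hypothesis piM : forall P Q, pi (pi P * Q) = pi P * pi Q.
Hypothesis pi1 : pi 1 = 1.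
Hypothesis piC : forall c, pi c%:P = (la c)%:P.
Hypothesis pi_span : forall P, exists r : seq (K * K),
  P = \sum_(k <- r) k.1 *: pi (k.2 *: P).

Definition fixedp P := pi P = P.

Lemma fixed_pi P : fixedp (pi P).
Proof. by have := piM P 1; rewrite mulr1 pi1 mulr1. Qed.

Lemma fixedM P Q : fixedp P -> fixedp Q -> fixedp (P * Q).
Proof. by rewrite /fixedp => <- fQ; rewrite piM fQ. Qed.

Lemma fixedB P Q : fixedp P -> fixedp Q -> fixedp (P - Q).
Proof. by rewrite /fixedp raddfB => -> ->. Qed.

Lemma pi_fixedZ c P : fixedp P -> pi (c *: P) = la c *: P.
Proof.
by move=> fP; rewrite -mul_polyC mulrC -{1}fP piM piC fP mulrC mul_polyC.
Qed.

Lemma laB c c' : la (c - c') = la c - la c'.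
Proof. by apply: polyC_inj; rewrite -piC !rmorphB /= raddfB !piC. Qed.

Lemma laMn c n : la (c *+ n) = la c *+ n.
Proof. by apply: polyC_inj; rewrite -piC !polyCMn raddfMn piC. Qed.

(** For [a0] of degree [n], the trace of multiplication by [b] on [K[X]/(a0)], in the basis of
    powers of [X]. *)
Definition mod_trace n (a0 b : {poly K}) :=
  \sum_(i < n) (('X^i * b) %% a0)`_i.

(** By [pi_span], classes of fixed polynomials span the quotient, so some of them form a basis. In
    that basis the matrix of multiplication by [b] has entries fixed by [la], and the trace does not
    depend on the basis. *)
Lemma mod_trace_fixed n (a0 b : {poly K}) : size a0 = n.+1 -> fixedp a0 -> fixedp b ->
  la (mod_trace n a0 b) = mod_trace n a0 b.
Proof.
move=> sa fa fb; have a00 : a0 != 0 by rewrite -size_poly_gt0 sa.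
have smod (P : {poly K}) : (size (P %% a0)%R <= n)%N by rewrite -ltnS -sa ltn_modp.
pose cf (P : {poly K}) : 'rV[K]_n := \row_j (P %% a0)`_j.
have cfD P Q : cf (P + Q) = cf P + cf Q.
  by apply/rowP => j; rewrite !mxE modpD coefD.
have cfZ c P : cf (c *: P) = c *: cf P.
  by apply/rowP => j; rewrite !mxE modpZl coefZ.
have cf0 : cf 0 = 0 by apply/rowP => j; rewrite !mxE mod0p coef0.
have cf_sum (I : Type) (r : seq I) (F : I -> {poly K}) :
    cf (\sum_(i <- r) F i) = \sum_(i <- r) cf (F i).
  exact: (big_morph cf cfD cf0).
have cf_eq0 P : cf P = 0 -> P %% a0 = 0.
  move=> /rowP E; apply/polyP => j; rewrite coef0; case: (ltnP j n) => lt.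
    by have := E (Ordinal lt); rewrite !mxE.
  by rewrite nth_default // (leq_trans (smod P)).
have [L [fL spanL]] : exists L : seq {poly K}, (forall P, P \in L -> fixedp P) /\
    forall i : 'I_n, (cf 'X^i <= \matrix_(s < size L) cf L`_s)%MS.
  have [Li HLi] := choice (fun i : 'I_n => pi_span 'X^i).
  exists (flatten [seq [seq pi (k.2 *: 'X^i) | k <- Li i] | i : 'I_n <- enum 'I_n]).
  split=> [P /flattenP[_ /mapP[i _ ->] /mapP[k _ ->]]|i]; first exact: fixed_pi.
  rewrite {1}(HLi i) cf_sum big_seq; apply: summx_sub => k kL; rewrite cfZ.
  apply: scalemx_sub; set L := flatten _.
  have Lk : pi (k.2 *: 'X^i) \in L.
    apply/flattenP; exists [seq pi (k.2 *: 'X^i) | k <- Li i].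
      by apply/mapP; exists i; rewrite ?mem_enum.
    by apply/mapP; exists k.
  have lt : (index (pi (k.2 *: 'X^i)) L < size L)%N by rewrite index_mem.
  have -> : cf (pi (k.2 *: 'X^i)) = row (Ordinal lt) (\matrix_(s < size L) cf L`_s).
    by rewrite rowK /= nth_index.
  exact: row_sub.
set M := \matrix_(s < size L) cf L`_s in spanL.
have fullM : row_full M.
  rewrite -sub1mx; apply/row_subP => i; rewrite row1.
  have <- // : cf 'X^i = delta_mx 0 i.
  apply/rowP => j; rewrite !mxE modp_small; last by rewrite size_polyXn sa ltnS.
  by rewrite coefXn eqxx -val_eqE.
pose B i : {poly K} := L`_(fullrankfun fullM i).
pose BM : 'M[K]_n := \matrix_i cf (B i).
have BMu : BM \in unitmx.
  have := fullrowsub_unit fullM; congr (is_true (_ \in unitmx)).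
  by apply/matrixP => i j; rewrite !mxE.
have fB i : fixedp (B i) by apply: fL; rewrite mem_nth.
pose Mb : 'M[K]_n := \matrix_(i < n) cf ('X^i * b).
have cfE P : cf P = \sum_i (cf P) 0 i *: cf 'X^i.
  rewrite {1}[cf P]row_sum_delta; apply: eq_bigr => i _; congr (_ *: _).
  apply/rowP => j; rewrite !mxE modp_small; last by rewrite size_polyXn sa ltnS.
  by rewrite coefXn eqxx -val_eqE.
have cf_mod P Q : P %% a0 = Q %% a0 -> cf P = cf Q.
  by move=> E; apply/rowP => j; rewrite !mxE E.
have cfMb P : cf (P * b) = cf P *m Mb.
  have cfP : cf P = cf (\sum_i (cf P) 0 i *: 'X^i).
    by rewrite cf_sum {1}(cfE P); apply: eq_bigr => i _; rewrite cfZ.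
  have -> : cf (P * b) = cf ((\sum_i (cf P) 0 i *: 'X^i) * b).
    apply: cf_mod; rewrite mulrC [in RHS]mulrC -modp_mul -[RHS]modp_mul.
    congr ((_ * _) %% _); apply/polyP => j; case: (ltnP j n) => lt.
      by have /rowP/(_ (Ordinal lt)) := cfP; rewrite !mxE.
    by rewrite !nth_default // (leq_trans (smod _)).
  rewrite mulr_suml cf_sum; apply/rowP => j; rewrite summxE mxE.
  by apply: eq_bigr => i _; rewrite -scalerAl cfZ !mxE.
pose N := BM *m Mb *m invmx BM.
have NB : N *m BM = BM *m Mb by rewrite mulmxKV.
have rowN i : cf (\sum_j N i j *: B j) = row i (N *m BM).
  rewrite cf_sum; apply/rowP => j; rewrite summxE !mxE.
  by apply: eq_bigr => l _; rewrite cfZ !mxE.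
have NE i : (B i * b - \sum_j N i j *: B j) %% a0 = 0.
  apply: cf_eq0; rewrite cfD -scaleN1r cfZ scaleN1r cfMb rowN NB row_mul rowK subrr.
  by [].
have laN i j : la (N i j) = N i j.
  (* [pi] preserves the ideal of the fixed polynomial [a0], so applying it to the congruences that
     define [N] shows that [N'] satisfies the same ones. *)
  pose N' : 'M[K]_n := \matrix_(i, j) la (N i j).
  suff /matrixP/(_ i j) : N' = N by rewrite mxE.
  apply: (can_inj (mulmxK BMu)); apply/row_matrixP => l.
  have rowN' : cf (\sum_j N' l j *: B j) = row l (N' *m BM).
    rewrite cf_sum; apply/rowP => j'; rewrite summxE !mxE.
    by apply: eq_bigr => l' _; rewrite cfZ !mxE.
  rewrite -rowN -rowN'; apply: cf_mod.
  have /modp_eq0P/dvdpP[q qE] := NE l.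
  have piE : pi (\sum_j N l j *: B j) = \sum_j N' l j *: B j.
    by rewrite raddf_sum; apply: eq_bigr => j' _; rewrite [N' _ _]mxE; exact: pi_fixedZ.
  have := congr1 pi qE; rewrite raddfB /= piE (fixedM (fB l) fb).
  have -> : pi (q * a0) = a0 * pi q by rewrite mulrC -{1}fa piM fa.
  move=> E.
  have E1 : (B l * b - \sum_j N' l j *: B j) %% a0 = 0.
    by rewrite E modp_mulr.
  by move: (NE l) E1; rewrite !modpD !modpN => /eqP; rewrite subr_eq0 => /eqP->
    => /eqP; rewrite subr_eq0 => /eqP.
have trE : mod_trace n a0 b = \tr N.
  rewrite /N mxtrace_mulC mulmxA mulVmx // mul1mx /mxtrace.
  by apply: eq_bigr => i _; rewrite !mxE.
have la_sum (I : finType) (F : I -> K) : la (\sum_i F i) = \sum_i la (F i).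
  apply: polyC_inj; rewrite -piC !rmorph_sum /= raddf_sum.
  by apply: eq_bigr => i _; rewrite piC.
by rewrite trE /mxtrace la_sum; apply: eq_bigr => i _; exact: laN.
Qed.

(* The division X^i l = q_i a + r_i gives X^i l = q_i (a - 1) + (q_i + r_i), and
   q_i has degree less than i: so the traces of l modulo a and a - 1 agree. *)
Lemma mod_trace_diff n (a b : {poly K}) : size a = n.+1 -> size b = n.+1 ->
  (0 < n)%N -> mod_trace n (a - 1) b - mod_trace n a b = (b`_n / a`_n) *+ n.
Proof.
move=> sa sb n0; have a0 : a != 0 by rewrite -size_poly_gt0 sa.
have an : a`_n != 0 by rewrite -[n]/(n.+1.-1) -sa -lead_coefE lead_coef_eq0.
set rho := _ / _.
have sl : (size (b - rho *: a)%R <= n)%N.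
  apply/leq_sizeP => j; rewrite leq_eqVlt => /orP[/eqP<-|lt].
    by rewrite coefB coefZ divfK // subrr.
  by rewrite coefB coefZ !nth_default ?sa ?sb // mulr0 subrr.
have sa1 : size (a - 1) = n.+1.
  by rewrite size_polyDl ?size_polyN ?size_poly1 sa.
rewrite /mod_trace -sumrB -[n in RHS]card_ord -sumr_const; apply: eq_bigr => i _.
set l := b - _ in sl; pose q := ('X^i * l) %/ a; pose r := ('X^i * l) %% a.
have bE : b = rho *: a + l by rewrite addrC subrK.
have sq : (size q <= i)%N.
  rewrite size_divp // sa /= leq_subLR.
  apply: leq_trans (size_polyMleq _ _) _; rewrite size_polyXn addSn /=.
  by rewrite addnC leq_add2r.
have sr : (size r <= n)%N by rewrite -ltnS -sa ltn_modp.
have qrE : 'X^i * l = q * a + r by exact: divp_eq.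
have lt_in : (i < n)%N := ltn_ord i.
have E0 : 'X^i * b = (rho *: 'X^i + q) * a + r.
  by rewrite bE mulrDr qrE mulrDl -scalerAr -scalerAl addrA.
have E1 : 'X^i * b = (rho *: 'X^i + q) * (a - 1) + (rho *: 'X^i + q + r).
  by rewrite E0 mulrBr mulr1 addrA subrK.
rewrite E0 modp_addl_mul_small ?sa ?ltnS // -E0 E1 modp_addl_mul_small; last first.
  rewrite sa1 ltnS; apply: (leq_trans (size_polyD _ _)); rewrite geq_max sr andbT.
  apply: (leq_trans (size_polyD _ _)); rewrite geq_max.
  rewrite (leq_trans sq (ltnW lt_in)) andbT.
  by apply: leq_trans (size_scale_leq _ _) _; rewrite size_polyXn.
by rewrite !coefD coefZ coefXn eqxx mulr1 [q`_i]nth_default // addr0 addrK.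
Qed.

(** The traces of [b] modulo [a] and modulo [a - 1] are fixed, and they differ by [n] times the
    ratio. *)
Lemma lead_ratio_fixed n (a b : {poly K}) : size a = n.+1 -> size b = n.+1 ->
  (0 < n)%N -> fixedp a -> fixedp b -> la (b`_n / a`_n) = b`_n / a`_n.
Proof.
move=> sa sb n0 fa fb; have fa1 : fixedp (a - 1) by apply: fixedB.
have sa1 : size (a - 1) = n.+1.
  by rewrite size_polyDl ?size_polyN ?size_poly1 sa.
have nK : n%:R != 0 :> K by have := natrK_neq0 charK n.-1; rewrite prednK.
apply: (mulfI nK); rewrite !mulr_natl -laMn -(mod_trace_diff sa sb n0) laB.
by rewrite !mod_trace_fixed.
Qed.

(** [X] is a [K]-combination of fixed polynomials. Those of top degree are reduced by multiples of
    one of them, with fixed ratios. The sum does not change, since the total multiple subtracted is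
    read off from a coefficient of [X] of degree at least 2, which is 0. In the end only degrees at
    most 1 occur, and not all of them are 0. *)
Theorem form_of_line : exists P, fixedp P /\ size P = 2.
Proof.
pose spanned N := exists r : seq (K * {poly K}),
  [/\ forall k, k \in r -> fixedp k.2, forall k, k \in r -> (size k.2 <= N.+2)%N &
      'X = \sum_(k <- r) k.1 *: k.2].
have [N sN] : exists N, spanned N.
  have [r rE] := pi_span 'X.
  pose r' := [seq (k.1, pi (k.2 *: 'X)) | k <- r].
  exists (\max_(k <- r') size k.2), r'; split.
  - by move=> _ /mapP[k _ ->]; exact: fixed_pi.
  - move=> k kr; rewrite -addn2; apply: leq_trans (leq_addr _ _).
    by apply: (@leq_bigmax_seq _ r' xpredT (fun k : K * {poly K} => size k.2) k).
  by rewrite big_map.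
elim: N sN => [|N IH] [r [fr sr rE]].
  apply: contrapT => no; have s1 k : k \in r -> (size k.2 <= 1)%N.
    move=> kr; have := sr k kr; rewrite leq_eqVlt ltnS => /orP[/eqP s2|//].
    by case: no; exists k.2; split=> //; apply: fr.
  have : ('X : {poly K})`_1 = 0.
    rewrite rE coef_sum big_seq big1 // => k /s1 sk.
    by rewrite coefZ nth_default ?mulr0.
  by rewrite coefX /= => /eqP; rewrite oner_eq0.
case: (pselect (exists2 k, k \in r & size k.2 = N.+3)) => [[k0 k0r s0]|no]; last first.
  apply: IH; exists r; split=> // k kr; have := sr k kr.
  by rewrite leq_eqVlt ltnS => /orP[/eqP s3|//]; case: no; exists k.
pose a := k0.2; have fa : fixedp a := fr _ k0r.
have an : a`_N.+2 != 0.
  by rewrite -[N.+2]/(N.+3.-1) -s0 -lead_coefE lead_coef_eq0 -size_poly_gt0 s0.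
pose rho (P : {poly K}) := P`_N.+2 / a`_N.+2.
have la0 : la 0 = 0 by have := laB 0 0; rewrite !subrr.
have fix_rho k : k \in r -> la (rho k.2) = rho k.2.
  move=> kr; have := sr k kr; rewrite leq_eqVlt ltnS => /orP[/eqP s3|s2].
    by apply: lead_ratio_fixed => //; exact: fr.
  by rewrite /rho nth_default // mul0r la0.
apply: IH; exists [seq (k.1, k.2 - rho k.2 *: a) | k <- r]; split.
- move=> _ /mapP[k kr ->] /=; apply: fixedB; first exact: fr.
  by rewrite /fixedp pi_fixedZ // fix_rho.
- move=> _ /mapP[k kr ->] /=; apply/leq_sizeP => j.
  rewrite coefB coefZ leq_eqVlt => /orP[/eqP<-|lt].
    by rewrite divfK // subrr.
  by rewrite !nth_default ?mulr0 ?subrr // ?s0 // (leq_trans (sr k kr)).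
rewrite big_map /=; under eq_bigr => k _ do rewrite scalerBr scalerA.
rewrite sumrB -rE -scaler_suml; suff -> : \sum_(k <- r) k.1 * rho k.2 = 0.
  by rewrite scale0r subr0.
apply: (mulIf an); rewrite mul0r mulr_suml.
have := congr1 (fun P : {poly K} => P`_N.+2) rE; rewrite coefX coef_sum => /= E.
rewrite [RHS]E; apply: eq_bigr => k _; rewrite coefZ -mulrA divfK //.
Qed.

End FormOfLine.

(** * Derivations with a coordinate in their kernel *)

Section KernelCoordinate.

Variables (K : fieldType) (S : idomainType) (str : {rmorphism K -> S}).
Variables (phi : {poly K}) (x y z : S) (sys : system str phi x y z).

Local Notation d := (size phi).-1.
Local Notation ev1 := (ev1 str).
Local Notation ev2 := (ev2 str).

(** With weights [d, d, 2], which satisfy [p + q = d c], the symbol of [rho(z)] is a multiple of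
    [(uv)^n] with [n < d], whereas that of [x b] is divisible by [u^d]. *)
Lemma x_dvd_small (rho : {poly K}) b :
  ev1 z rho = x * b -> (size rho <= d)%N -> rho = 0.
Proof.
have d_gt0 := deg_gt0 sys; move=> E sr; apply/eqP/negPn/negP => rho0.
have pqc : (d + d = d * 2)%N by rewrite muln2 addnn.
have sym_top a : a != 0 -> exists n T, sym str phi x y z d d 2 n a T /\ T != 0.
  move=> a0; have [n [T sT]] := sym_ex sys d d 2 a.
  elim/ltn_ind: n T sT => n IH T sT; case: (eqVneq T 0) => [T0|]; last by exists n, T.
  rewrite T0 in sT; have [a00|[n' [T' [lt sT']]]] := sym_lower sys d_gt0 d_gt0 pqc sT.
    by rewrite a00 eqxx in a0.
  exact: IH lt _ sT'.
have s_gt0 : (0 < size rho)%N by rewrite size_poly_gt0.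
pose n := (size rho).-1; have sn : (size rho <= n.+1)%N by rewrite /n prednK.
have sym1 : sym str phi x y z d d 2 (n * 2) (ev1 z rho) (rho`_n *: ('X_i0 * 'X_i1) ^+ n).
  exact: sym_ev1z.
have lc : rho`_n != 0 by rewrite -lead_coefE lead_coef_eq0.
have b0 : b != 0.
  apply/eqP => b0; move: E; rewrite b0 mulr0 -(ev2_map str x) => /(sys_free sys)/eqP.
  by rewrite map_polyC_eq0 (negbTE rho0).
have [m [T [sb T0]]] := sym_top b b0.
have sym2 : sym str phi x y z d d 2 (d + m) (ev1 z rho) ('X_i0 ^+ d * T).
  by rewrite E; apply: symM sb; exact: sym_X0.
have nz2 : 'X_i0 ^+ d * T != 0 by rewrite mulf_neq0 // expf_neq0 // mpolyX_neq0.
have nz1 : rho`_n *: ('X_i0 * 'X_i1) ^+ n != 0 :> {mpoly K[2]}.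
  by rewrite -mul_mpolyC mulf_neq0 ?mpolyC_eq0 // expf_neq0 // mulf_neq0 ?mpolyX_neq0.
have uniq0 := sym_uniq sys d_gt0 d_gt0 pqc.
case: (ltngtP (n * 2) (d + m)) => [lt|lt|eqn].
- by have := uniq0 _ _ _ _ (sym_lift sym1 lt) sym2 => /eqP; rewrite eq_sym (negbTE nz2).
- by have := uniq0 _ _ _ _ (sym_lift sym2 lt) sym1 => /eqP; rewrite eq_sym (negbTE nz1).
rewrite -eqn in sym2; have := uniq0 _ _ _ _ sym1 sym2.
move/(congr1 (mcoeff (U_(i0) *+ n + U_(i1) *+ n)%MM)).
have -> : ('X_i0 * 'X_i1) ^+ n = 'X_[(U_(i0) *+ n + U_(i1) *+ n)%MM] :> {mpoly K[2]}.
  by rewrite mpolyXD -!mpolyXn -exprMn.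
rewrite mcoeffZ mcoeffX eqxx mulr1 => Ec.
have := @mpoly_Xdiv K i0 d T (U_(i0) *+ n + U_(i1) *+ n)%MM; rewrite -Ec lc => /(_ isT).
rewrite mnmDE !mulmnE !mnm1E /= mul1n mul0n addn0 leqNgt; case/negP.
by rewrite /n prednK.
Qed.

Lemma split_inner (P : {poly {poly K}}) : exists Q (rho : {poly K}),
  [/\ P = Q * 'X%:P + map_poly polyC rho, (size rho <= size P)%N &
      (size Q <= size P)%N].
Proof.
pose Q := \poly_(i < size P) drop_poly 1 P`_i.
pose rho := \poly_(i < size P) P`_i`_0.
have QE i : Q`_i = drop_poly 1 P`_i.
  by rewrite coef_poly; case: ltnP => // le; rewrite nth_default // (raddf0 (drop_poly 1)).
have rhoE i : rho`_i = P`_i`_0.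
  by rewrite coef_poly; case: ltnP => // le; rewrite [P`_i]nth_default // coef0.
exists Q, rho; split; rewrite ?size_poly //; apply/polyP => i.
rewrite coefD coefMC QE coef_map rhoE /= -{1}(poly_take_drop 1 P`_i) addrC expr1.
by congr (_ + _); apply/polyP => j; rewrite coef_take_poly coefC; case: j.
Qed.

(** The part of [P] free of [x] is a polynomial in [z] of degree below [d] divisible by [x], hence
    0; so [x] can be cancelled one factor at a time. *)
Lemma reduce_x N b (P : {poly {poly K}}) : (size P <= d)%N -> x ^+ N * b = ev2 x z P ->
  exists2 Q : {poly {poly K}}, (size Q <= d)%N & b = ev2 x z Q.
Proof.
elim: N b P => [|N IH] b P sP E; first by exists P => //; rewrite -E mul1r.
have [Q [rho [PE srho sQ]]] := split_inner P.
have rho0 : rho = 0.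
  apply: (x_dvd_small (b := x ^+ N * b - ev2 x z Q)); last exact: leq_trans sP.
  rewrite mulrBr mulrA -exprS E PE rmorphD rmorphM /= ev2C ev1X ev2_map; ring.
apply: (IH b Q); first exact: leq_trans sP.
apply: (mulfI (sys_x_neq0 sys)); rewrite mulrA -exprS E PE rho0 map_poly0 addr0.
by rewrite rmorphM /= ev2C ev1X mulrC.
Qed.

End KernelCoordinate.

(** * The kernels of [D] and of its square when [D x = 0] *)

Section Kernel.

Variables (K : fieldType) (charK : [pchar K] =i pred0).
Variables (S : idomainType) (str : {rmorphism K -> S}).
Variables (D : {additive S -> S}) (derD : is_derivation D).
Variables (lnD : locally_nilpotent D) (D_neq0 : exists a, D a != 0).

Local Notation ev1 := (ev1 str).
Local Notation ev2 := (ev2 str).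

Let Dstr : forall k, D (str k) = 0 := D_str charK str derD lnD.

Lemma D_ev1_ker t P : D t = 0 -> D (ev1 t P) = 0.
Proof. by move=> Dt; rewrite (der_ev1 charK str derD lnD) Dt mulr0. Qed.

Lemma lead_ev2 s V c n (P : {poly {poly K}}) : D s = 0 -> dle D c V -> (0 < c)%N -> (size P <= n.+1)%N ->
  dle D (n * c) (ev2 s V P) /\
  lead str D (n * c) (ev2 s V P) = ev1 s P`_n * lead str D c V ^+ n.
Proof.
move=> Ds Vc c_gt0 sP.
have term m A : dle D (m * c) (ev1 s A * V ^+ m) /\
  lead str D (m * c) (ev1 s A * V ^+ m) = ev1 s A * lead str D c V ^+ m.
  have kA := dle_ker (D_ev1_ker A Ds); have Vm := dleX derD m Vc.
  by split; [have := dleM derD kA Vm | have := leadM charK str derD kA Vm];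
    rewrite add0n // lead_0 (leadX charK str derD).
have E m : ev2 s V (\poly_(i < m.+1) P`_i) =
    ev2 s V (\poly_(i < m) P`_i) + ev1 s P`_m * V ^+ m.
  rewrite !poly_def big_ord_recr /= rmorphD /= -mul_polyC rmorphM rmorphXn /=.
  by rewrite ev2C ev2X.
have low m : (m <= n)%N -> dle D (m * c).-1 (ev2 s V (\poly_(i < m) P`_i)).
  elim: m => [|m IH] le; first by rewrite poly_def big_ord0 rmorph0; exact: dle0.
  rewrite E; apply: dleD; first by apply: dle_mono (IH (ltnW le)) _; lia.
  apply: dle_mono (term m P`_m).1 _; lia.
have -> : P = \poly_(i < n.+1) P`_i.
  apply/polyP => i; rewrite coef_poly; case: ltnP => // le.
  by rewrite nth_default // (leq_trans sP).
rewrite E coef_poly ltnSn; have [t1 t2] := term n P`_n; have ln := low n (leqnn n).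
split; first by apply: dleD t1; apply: dle_mono ln (leq_pred _).
rewrite leadD t2; case: (posnP n) => [->|n_gt0].
  by rewrite poly_def big_ord0 rmorph0 lead0 add0r.
by rewrite (lead_gt str ln) ?add0r // prednK // muln_gt0 n_gt0.
Qed.

Lemma dg_ev2 s V c (P : {poly {poly K}}) : injective (ev1 s) -> D s = 0 -> dg str D c V -> (0 < c)%N ->
  P != 0 -> dg str D ((size P).-1 * c) (ev2 s V P).
Proof.
move=> inj Ds [Vc lV] c_gt0 P0; have s_gt0 : (0 < size P)%N by rewrite size_poly_gt0.
have [|h1 h2] := @lead_ev2 s V c (size P).-1 P Ds Vc c_gt0; first by rewrite prednK.
split=> //; rewrite h2 mulf_neq0 ?expf_neq0 // -lead_coefE.
apply/eqP => E; have : lead_coef P = 0 by apply: inj; rewrite E rmorph0.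
by move/eqP; rewrite lead_coef_eq0 (negbTE P0).
Qed.

Variables (phi : {poly K}) (x y z : S) (sys : system str phi x y z) (Dx : D x = 0).

Local Notation d := (size phi).-1.

(** Some iterate of [D] yields an element of degree 1. A power of [x] times it is a polynomial in
    [x] and [z], whose degree is a multiple of that of [z]. *)
Lemma dg_z : dg str D 1 z.
Proof.
have x0 := sys_x_neq0 sys.
have Dz : D z != 0.
  apply/eqP => Dz; have Dy : D y = 0.
    apply/eqP; have := derD x y; rewrite Dx mul0r add0r (sys_rel sys) D_ev1_ker //.
    by move/esym/eqP; rewrite mulf_eq0 (negbTE x0).
  have [a /eqP] := D_neq0; apply; apply: (sys_gen sys (B := fun a => D a = 0)) => //.
  - by move=> b [] ->.
  - by move=> b b' Db Db'; rewrite raddfD /= Db Db' addr0.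
  by move=> b b' Db Db'; rewrite derD Db Db' mul0r mulr0 addr0.
have [c dz] := dg_ex charK str lnD (sys_z_neq0 sys).
have c_gt0 : (0 < c)%N.
  by rewrite lt0n; apply: contra Dz => /eqP c0; rewrite c0 in dz; apply/eqP/(dg0_ker dz).
have [a1 da1] : exists a1, dg str D 1 a1.
  have [a Da] := D_neq0; have a0 : a != 0 by apply: contraNneq Da => ->; rewrite raddf0.
  have [n dn] := dg_ex charK str lnD a0.
  elim: n a Da a0 dn => [|n IH] a Da a0 dn; first by rewrite (dg0_ker dn) eqxx in Da.
  case: n => [|n] in IH dn *; first by exists a.
  have dDa := dg_D charK dn; apply: (IH (D a)) => //.
  have [_] := dDa; rewrite lead_eq0 // iterSr.
  by apply: contraNneq => ->; rewrite iterD0.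
have [N [P EP]] := clear_x sys a1.
have dx : dg str D 0 x by split; [exact: dle_ker | rewrite lead_0].
have dP := dgM charK derD (dgX charK derD N dx) da1; rewrite EP muln0 in dP.
have P0 : P != 0 by apply: contraNneq (dg_neq0 dP) => ->; rewrite rmorph0.
have := dg_uniq dP (dg_ev2 (ev1_inj sys) Dx dz c_gt0 P0).
move/eqP; rewrite add0n eq_sym muln_eq1 => /andP[_ /eqP c1].
by rewrite c1 in dz.
Qed.

Lemma dg_y : dg str D d y.
Proof.
have dx : dg str D 0 x by split; [exact: dle_ker | rewrite lead_0 (sys_x_neq0 sys)].
have [q dy] := dg_ex charK str lnD (sys_y_neq0 sys).
suff <- : q = d by [].
have := dgM charK derD dx dy; rewrite (sys_rel sys) -(ev2_map str x) add0n.
have P0 : map_poly polyC phi != 0 by rewrite map_polyC_eq0 monic_neq0 // (sys_monic sys).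
move/dg_uniq/(_ (dg_ev2 (ev1_inj sys) Dx dg_z isT P0)).
by rewrite muln1 size_map_polyC.
Qed.

(** If [x^N a = P(x, z)], the degree of [P] in [z] is the [D]-degree of [a], hence below [n <= d];
    [reduce_x] then cancels [x^N]. *)
Lemma ker_small a n : iter n D a = 0 -> (n <= d)%N ->
  exists2 P : {poly {poly K}}, (size P <= n)%N & a = ev2 x z P.
Proof.
move=> an le; case: (eqVneq a 0) => [->|a0].
  by exists 0; rewrite ?size_poly0 ?rmorph0.
have [N [P EP]] := clear_x sys a.
have sP Q N' : x ^+ N' * a = ev2 x z Q -> (size Q <= n)%N.
  move=> EQ; case: (eqVneq Q 0) => [->|Q0]; first by rewrite size_poly0.
  have dx : dg str D 0 x by split; [exact: dle_ker | rewrite lead_0 (sys_x_neq0 sys)].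
  have dxN : dle D 0 (x ^+ N') by have := dleX derD N' dx.1; rewrite muln0.
  case: n an => [/= a00|n] an in le *; first by rewrite a00 eqxx in a0.
  have := dleM derD dxN (an : dle D n a); rewrite EQ add0n.
  move/(dg_leq (dg_ev2 (ev1_inj sys) Dx dg_z isT Q0)); rewrite muln1.
  by move: (size_poly_gt0 Q); rewrite Q0; case: (size Q).
have [Q _ EQ] := reduce_x sys (leq_trans (sP P N EP) le) EP.
by exists Q => //; apply: (sP Q 0%N); rewrite mul1r.
Qed.

Lemma ker_ev1 a : D a = 0 -> exists A, a = ev1 x A.
Proof.
move=> Da; have [|P sP ->] := @ker_small a 1 Da; first exact: (deg_gt0 sys).
by exists P`_0; rewrite {1}(size1_polyC sP) ev2C.
Qed.

Lemma plane_gen : d = 1%N -> forall a, exists P, a = ev2 x y P.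
Proof.
move=> d1; apply: (sys_gen sys).
- by move=> k; exists k%:P%:P; rewrite ev2C ev1C.
- move=> a [] ->; [by exists 'X%:P; rewrite ev2C ev1X | by exists 'X; rewrite ev2X |].
  exists ('X%:P * 'X - (phi`_0)%:P%:P).
  have phiE : phi = 'X + (phi`_0)%:P.
    apply/polyP => -[|[|i]]; rewrite coefD coefX coefC /= ?add0r ?addr0 //.
      have /monicP := sys_monic sys; rewrite lead_coefE; congr (phi`_ _ = _).
      exact: d1.
    by rewrite nth_default // -(prednK (ltnW (sys_size sys))) d1.
  apply: (addIr (ev2 x y (phi`_0)%:P%:P)).
  rewrite -rmorphD /= subrK rmorphM /= !ev2C ev2X ev1X (sys_rel sys) {2}phiE.
  by rewrite rmorphD /= ev1X ev1C ev1C.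
- by move=> a b [P ->] [Q ->]; exists (P + Q); rewrite rmorphD.
by move=> a b [P ->] [Q ->]; exists (P * Q); rewrite rmorphM.
Qed.

(* For d = 1 the relation expresses z in terms of x and y, and S = K[x, y]. *)
Definition coord := if d == 1%N then y else z.

Lemma dg_coord : dg str D 1 coord.
Proof.
rewrite /coord; case: eqP => [d1|_]; last exact: dg_z.
by have := dg_y; rewrite d1.
Qed.

Lemma ker2_coord a : D (D a) = 0 -> exists A B, a = ev1 x A + ev1 x B * coord.
Proof.
move=> DDa; have small (P : {poly {poly K}}) t : (size P <= 2)%N ->
    ev2 x t P = ev1 x P`_0 + ev1 x P`_1 * t.
  move=> sP; have {1}-> : P = (P`_1)%:P * 'X + (P`_0)%:P.
    apply/polyP => -[|[|i]]; rewrite !(coefD, coefMX, coefC) /= ?add0r ?addr0 //.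
    by rewrite nth_default // (leq_trans sP).
  by rewrite rmorphD rmorphM /= !ev2C ev2X addrC.
rewrite /coord; case: eqP => [d1|d1]; last first.
  have [|P sP ->] := @ker_small a 2 DDa; first by have := deg_gt0 sys; lia.
  by exists P`_0, P`_1; exact: small.
have [P aE] := plane_gen d1 a.
exists P`_0, P`_1; rewrite aE small //; case: (eqVneq P 0) => [->|P0].
  by rewrite size_poly0.
have dy : dg str D 1 y by have := dg_y; rewrite d1.
have := dg_ev2 (ev1_inj sys) Dx dy isT P0; rewrite -aE muln1 => da.
by have := dg_leq da (DDa : dle D 1 a); case: (size P) => [|[|[]]].
Qed.

End Kernel.

(** * Descent of the coordinates *)

Lemma coef_exp_XsubC (K : fieldType) (b : K) n :
  (('X - b%:P) ^+ n.+1)`_n = - b *+ n.+1.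
Proof.
elim: n => [|n IH]; first by rewrite expr1 coefB coefX coefC sub0r.
have top m : (('X - b%:P) ^+ m)`_m = 1.
  have /monicP := monic_exp m (monicXsubC b).
  by rewrite lead_coefE size_exp_XsubC.
by rewrite exprS mulrBl coefB coefXM coefCM /= IH top mulr1 addrC -mulrS.
Qed.

Section Descent.

Variables (K : fieldType) (charK : [pchar K] =i pred0).
Variables (S : idomainType) (str : {rmorphism K -> S}).
Variables (D : {additive S -> S}) (derD : is_derivation D).
Variables (lnD : locally_nilpotent D) (D_neq0 : exists a, D a != 0).
Variables (phi : {poly K}) (x y z : S) (sys : system str phi x y z) (Dx : D x = 0).
Variables (la : K -> K) (pi : {additive S -> S}).
Hypothesis piM : forall a b, pi (pi a * b) = pi a * pi b.
Hypothesis pi1 : pi 1 = 1.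
Hypothesis pi_str : forall k, pi (str k) = str (la k).
Hypothesis pi_span : forall a, exists r : seq (K * K),
  a = \sum_(k <- r) str k.1 * pi (str k.2 * a).
Hypothesis piD : forall a, pi (D a) = D (pi a).

Local Notation d := (size phi).-1.
Local Notation ev1 := (ev1 str).
Local Notation ev2 := (ev2 str).
Local Notation fixed a := (pi a = a).

Let str_inj : injective str := fmorph_inj str.
Let Dstr : forall k, D (str k) = 0 := D_str charK str derD lnD.

Lemma pi_fixM a b : fixed a -> pi (a * b) = a * pi b.
Proof. by move=> fa; rewrite -{1}fa piM fa. Qed.

Lemma fixed_piS a : fixed (pi a).
Proof. by have := piM a 1; rewrite mulr1 pi1 mulr1. Qed.

Lemma la_sub k l : la (k - l) = la k - la l.
Proof. by apply: str_inj; rewrite -pi_str !rmorphB /= raddfB !pi_str. Qed.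

Lemma la_0 : la 0 = 0.
Proof. by have := la_sub 0 0; rewrite !subrr. Qed.

Lemma la_muln k n : la (k *+ n) = la k *+ n.
Proof. by apply: str_inj; rewrite -pi_str !rmorphMn /= raddfMn pi_str. Qed.

Lemma la_1 : la 1 = 1.
Proof. by apply: str_inj; rewrite -pi_str rmorph1 pi1. Qed.

(** What [pi] does to polynomials in a fixed element. It is not multiplicative and may lower
    degrees, but not those of monic polynomials. *)
Definition lp (A : {poly K}) := \poly_(i < size A) la A`_i.

Lemma coef_lp A i : (lp A)`_i = la A`_i.
Proof.
by rewrite coef_poly; case: ltnP => // le; rewrite nth_default // la_0.
Qed.

Lemma size_lp_monic A : A \is monic -> size (lp A) = size A /\ lp A \is monic.
Proof.
move=> mA; have sA : size (lp A) = size A.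
  apply: size_poly_eq; rewrite -lead_coefE (monicP mA) la_1 oner_neq0 //.
by split=> //; rewrite monicE lead_coefE sA coef_lp -lead_coefE (monicP mA) la_1.
Qed.

Lemma pi_ev1 t A : fixed t -> pi (ev1 t A) = ev1 t (lp A).
Proof.
move=> ft; have ftn n : fixed (t ^+ n).
  by elim: n => [|n IH]; rewrite ?expr0 // exprS pi_fixM // IH.
rewrite ev1E raddf_sum /lp poly_def rmorph_sum; apply: eq_bigr => i _.
by rewrite mulrC pi_fixM //= pi_str ev1Z rmorphXn /= ev1X mulrC.
Qed.

Lemma pi_ev2 s t Q : fixed s -> fixed t -> exists Q', pi (ev2 s t Q) = ev2 s t Q'.
Proof.
move=> fs ft; elim/poly_ind: Q => [|Q k [Q' IH]]; first by exists 0; rewrite !rmorph0 raddf0.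
exists (Q' * 'X + (lp k)%:P); rewrite !rmorphD !rmorphM /= !ev2X !ev2C raddfD /=.
by rewrite mulrC pi_fixM // IH pi_ev1 // [t * _]mulrC.
Qed.

Let D_ev1 A : D (ev1 x A) = 0 := D_ev1_ker charK str derD lnD A Dx.
Let ker_x : forall a, D a = 0 -> exists A, a = ev1 x A := ker_ev1 charK derD lnD D_neq0 sys Dx.

Lemma fixed_line : exists a b, a != 0 /\ fixed (str a * x + str b).
Proof.
have D0 P : D (pi (ev1 x P)) = 0 by rewrite -piD D_ev1 raddf0.
have [pix pixE] := choice (fun P => ker_x (D0 P)).
have inj := ev1_inj sys.
have pixB : zmod_morphism pix.
  by move=> P Q; apply: inj; rewrite -pixE !rmorphB /= raddfB !pixE.
pose pa : {additive {poly K} -> {poly K}} :=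
  HB.pack pix (GRing.isZmodMorphism.Build _ _ pix pixB).
have [||||P [fP sP]] := @form_of_line K charK la pa.
- by move=> P Q; apply: inj; rewrite -pixE !rmorphM /= -!pixE piM.
- by apply: inj; rewrite -pixE rmorph1 pi1.
- by move=> c; apply: inj; rewrite -pixE !ev1C pi_str.
- move=> P; have [r rE] := pi_span (ev1 x P); exists r; apply: inj.
  rewrite {1}rE rmorph_sum; apply: eq_bigr => k _.
  by rewrite /= ev1Z -pixE ev1Z.
have PE : P = P`_1 *: 'X + (P`_0)%:P.
  apply/polyP => -[|[|i]]; rewrite coefD coefZ coefX coefC /= ?mulr0 ?mulr1 ?add0r ?addr0 //.
  by rewrite nth_default // sP.
exists P`_1, P`_0; split.
  have := lead_coef_eq0 P; rewrite lead_coefE sP /= => ->.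
  by rewrite -size_poly_gt0 sP.
have -> : str P`_1 * x + str P`_0 = ev1 x P.
  by rewrite {3}PE rmorphD /= ev1Z ev1X ev1C.
by rewrite pixE; congr (ev1 x _); exact: fP.
Qed.

Section Line.

Variables (a b : K) (a_neq0 : a != 0).
Let x1 := str a * x + str b.
Hypothesis fx1 : fixed x1.

Lemma ev1_x1 A : exists A', ev1 x A = ev1 x1 A'.
Proof.
exists (A \Po (a^-1 *: ('X - b%:P))); rewrite ev1_comp ev1Z rmorphB /= ev1X ev1C.
by rewrite addrK mulrA -rmorphM mulVf // rmorph1 mul1r.
Qed.

Lemma x1_ev1 A : ev1 x1 A = ev1 x (A \Po (a *: 'X + b%:P)).
Proof. by rewrite ev1_comp rmorphD /= ev1Z ev1X ev1C. Qed.

Lemma ev1_x1_inj : injective (ev1 x1).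
Proof.
move=> A B; rewrite !x1_ev1 => /(ev1_inj sys)/eqP.
rewrite -subr_eq0 -comp_polyB comp_poly_eq0 ?subr_eq0; first by move/eqP.
by rewrite size_polyDl size_scale // size_polyX // size_polyC; case: (b == 0).
Qed.

Lemma Dx1 : D x1 = 0.
Proof. by rewrite raddfD derD /= !Dstr Dx mul0r mulr0 !addr0. Qed.

Local Notation V := (coord phi y z).

(** [D V] is a polynomial [v] in [x1]; [V] is rescaled to make it monic, so that [lp] keeps its
    degree. The image [z0 = A + B V] has derivative [B v], which is also the image of the rescaled
    [v]; equality of degrees makes [B] constant. *)
Lemma fixed_coord : exists c A, c != 0 /\ fixed (str c * V + ev1 x A).
Proof.
have dV : dg str D 1 V := dg_coord charK derD lnD D_neq0 sys Dx.
have [A0 DV0] := ker_x (dV.1 : D (D V) = 0); have [v DV] := ev1_x1 A0.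
rewrite -DV0 in DV.
have v0 : v != 0.
  apply: contra (dV.2) => /eqP v0; rewrite lead_eq0 // /= DV v0 rmorph0.
  by [].
pose k := (lead_coef v)^-1; have k0 : k != 0 by rewrite invr_eq0 lead_coef_eq0.
have mkv : k *: v \is monic by rewrite monicE lead_coefZ mulVf // lead_coef_eq0.
have [skv mlp] := size_lp_monic mkv.
pose z0 := pi (str k * V).
have Dz0 : D z0 = ev1 x1 (lp (k *: v)).
  by rewrite -piD derD Dstr mul0r add0r DV -ev1Z pi_ev1.
have [A [B zE]] : exists A B, z0 = ev1 x A + ev1 x B * V.
  apply: (ker2_coord charK derD lnD D_neq0 sys Dx).
  by rewrite Dz0 (D_ev1_ker charK str derD lnD) // Dx1.
have [B' BE] := ev1_x1 B.
have E : lp (k *: v) = B' * v.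
  apply: ev1_x1_inj; rewrite -Dz0 zE raddfD derD /= !D_ev1 add0r mul0r add0r BE DV.
  by rewrite rmorphM.
have B'0 : B' != 0.
  by apply: contraTneq mlp => B'0; rewrite E B'0 mul0r monicE lead_coef0 eq_sym oner_eq0.
have sB : size B' = 1%N.
  have := skv; rewrite E size_mul // size_scale //.
  have := B'0; rewrite -size_poly_gt0; case: (size B') => // n _.
  by rewrite addSn /= -[RHS]add0n => /eqP; rewrite eqn_add2r => /eqP ->.
have [c c0 B'E] : exists2 c, c != 0 & B' = c%:P.
  by have /eqP/size_poly1P := sB.
exists c, A; split=> //.
suff <- : z0 = str c * V + ev1 x A by exact: fixed_piS.
by rewrite zE BE B'E ev1C addrC.
Qed.

End Line.

(** Here [S] is the polynomial ring in [x1] and [z0], so the relation is trivial: their product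
    serves as third coordinate and [phi] is [X]. *)
Lemma descent_plane a b c A : d = 1%N -> a != 0 -> c != 0 ->
  let x1 := str a * x + str b in let z0 := str c * y + ev1 x A in
  system str 'X x1 z0 (x1 * z0).
Proof.
move=> d1 a0 c0 x1 z0; have dy : dg str D 1 y.
  by have := dg_y charK derD lnD D_neq0 sys Dx; rewrite d1.
have Dx1 : D x1 = 0 := Dx1 a b.
have x10 : x1 != 0.
  apply/eqP => E; have : ev1 x1 'X = ev1 x1 0 by rewrite ev1X E rmorph0.
  by move/(ev1_x1_inj a0)/eqP; rewrite polyX_eq0.
have dz0 : dg str D 1 z0.
  have kA : dle D 0 (ev1 x A) by apply: dle_ker.
  split.
    apply: dleD; last exact: dle_mono kA _.
    exact: (dle_scale charK str derD lnD c dy.1).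
  rewrite leadD (lead_gt str kA) // addr0 (lead_scale charK str derD lnD).
  by rewrite mulf_neq0 ?str_eq0 // dy.2.
have dx1 : dg str D 0 x1 by split; [exact: dle_ker | rewrite lead_0].
have dxz := dgM charK derD dx1 dz0.
split; rewrite ?size_polyX ?monicX ?ev1X //.
  move=> B Bs BG BD BM.
  have Bx1 : B x1 by apply: BG; constructor 1.
  have Bz0 : B z0 by apply: BG; constructor 2.
  have BN u : B u -> B (- u).
    move=> Bu; have -> : - u = str (-1) * u by rewrite rmorphN rmorph1 mulN1r.
    exact: BM.
  have Bx : B x.
    have -> : x = str a^-1 * (x1 - str b).
      by rewrite /x1 addrK mulrA -rmorphM mulVf // rmorph1 mul1r.
    by apply: (BM _ _ (Bs _)); apply: (BD _ _ Bx1); apply: BN.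
  have By : B y.
    have -> : y = str c^-1 * (z0 - ev1 x A).
      by rewrite /z0 addrK mulrA -rmorphM mulVf // rmorph1 mul1r.
    apply: (BM _ _ (Bs _)); apply: (BD _ _ Bz0); apply: BN.
    exact: (closed_ev1 _ Bs BD BM Bx).
  move=> u; have [P ->] := plane_gen sys d1 u.
  exact: (closed_ev2 P Bs BD BM Bx By).
move=> P P0; apply/eqP/negPn/negP => nz.
have := dg_ev2 charK derD lnD (ev1_x1_inj (b := b) a0) Dx1 dxz isT nz.
by move/dg_neq0; rewrite P0 eqxx.
Qed.

Section Affine.

Variables (a b c : K) (A : {poly K}) (a_neq0 : a != 0) (c_neq0 : c != 0).
Let x1 := str a * x + str b.
Let z0 := str c * z + ev1 x A.
Hypotheses (fx1 : fixed x1) (fz0 : fixed z0).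

Let C u := exists Q, u = ev2 x1 z0 Q.

Let Cs k : C (str k). Proof. by exists k%:P%:P; rewrite ev2C ev1C. Qed.
Let CD u v : C u -> C v -> C (u + v).
Proof. by move=> [P ->] [Q ->]; exists (P + Q); rewrite rmorphD. Qed.
Let CM u v : C u -> C v -> C (u * v).
Proof. by move=> [P ->] [Q ->]; exists (P * Q); rewrite rmorphM. Qed.
Let CB u v : C u -> C v -> C (u - v).
Proof.
move=> Cu Cv; apply: CD => //; have -> : - v = str (-1) * v.
  by rewrite rmorphN rmorph1 mulN1r.
exact: CM.
Qed.
Let Cx1 : C x1. Proof. by exists 'X%:P; rewrite ev2C ev1X. Qed.
Let Cz0 : C z0. Proof. by exists 'X; rewrite ev2X. Qed.
Let Cx : C x.
Proof.
have -> : x = str a^-1 * (x1 - str b).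
  by rewrite /x1 addrK mulrA -rmorphM mulVf // rmorph1 mul1r.
by apply: CM => //; apply: CB.
Qed.
Let Cz : C z.
Proof.
have -> : z = str c^-1 * (z0 - ev1 x A).
  by rewrite /z0 addrK mulrA -rmorphM mulVf // rmorph1 mul1r.
by apply: CM => //; apply: CB => //; apply: (closed_ev1 _ Cs CD CM Cx).
Qed.

Let C_ev2 Q : C (ev2 x z Q). Proof. exact: (closed_ev2 Q Cs CD CM Cx Cz). Qed.

(** Otherwise [x] would divide the monic polynomial [phi(z)] in the polynomial ring [K[x, z]]. *)
Lemma y_notin : ~ C y.
Proof.
case=> Q yE; have [Q' yE'] : exists Q', y = ev2 x z Q'.
  rewrite yE; apply: (@closed_ev2 K S str (fun u => exists Q', u = ev2 x z Q')).
  - by move=> k; exists k%:P%:P; rewrite ev2C ev1C.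
  - by move=> u v [P ->] [R ->]; exists (P + R); rewrite rmorphD.
  - by move=> u v [P ->] [R ->]; exists (P * R); rewrite rmorphM.
  - by exists (a *: 'X + b%:P)%:P; rewrite ev2C rmorphD /= ev1Z ev1X ev1C.
  by exists (c%:P%:P * 'X + A%:P); rewrite rmorphD rmorphM /= !ev2C ev2X ev1C.
have E : 'X%:P * Q' = map_poly polyC phi.
  apply: (ev2_inj sys); rewrite rmorphM /= ev2C ev1X ev2_map -yE'.
  exact: sys_rel sys.
have := congr1 (fun P : {poly {poly K}} => P`_d`_0) E.
rewrite coefCM coefXM coef_map /= coefC -lead_coefE (monicP (sys_monic sys)).
by move/esym/eqP; rewrite oner_eq0.
Qed.

(* An element r of the form outside C has conductor (x1 - b)^M into C; the
   conductor is stable under pi, hence so is the coefficient - M b. *)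
Lemma fixed_b : la b = b.
Proof.
have [r [fr Cr]] : exists r, fixed r /\ ~ C r.
  apply: contrapT => no; apply: y_notin; have [r ->] := pi_span y.
  apply: (big_ind C); first by rewrite -(rmorph0 str).
    exact: CD.
  move=> k _; apply: CM => //; apply: contrapT => nC; apply: no.
  by exists (pi (str k.2 * y)); split; first exact: fixed_piS.
pose J (g : {poly K}) := C (ev1 x1 g * r).
have C_ev1 g : C (ev1 x1 g) by exact: (closed_ev1 _ Cs CD CM Cx1).
have JM g h : J g -> J (h * g).
  by rewrite /J rmorphM /= -mulrA => Jg; apply: CM.
have JB g h : J g -> J h -> J (g - h).
  by move=> Jg Jh; rewrite /J rmorphB /= mulrBl; apply: CB.
have Jlp g : J g -> J (lp g).
  move=> [Q EQ]; have [Q' EQ'] := pi_ev2 Q fx1 fz0; exists Q'.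
  by rewrite -EQ' -EQ [in RHS]mulrC pi_fixM // pi_ev1 // mulrC.
have [N JN] : exists N, J (('X - b%:P) ^+ N).
  have [N [Q EQ]] := clear_x sys r; exists N; rewrite /J rmorphXn rmorphB /=.
  rewrite ev1X ev1C /x1 addrK exprMn -mulrA EQ; apply: CM => //.
  by rewrite -rmorphXn.
pose P n := `[< exists g, [/\ J g, g \is monic & size g = n] >].
have exP : exists n, P n.
  exists N.+1; apply/asboolP; exists (('X - b%:P) ^+ N).
  by rewrite size_exp_XsubC monic_exp ?monicXsubC.
case: (ex_minnP exP) => n /asboolP[G [JG mG sG]] nmin.
have small g : J g -> (size g < n)%N -> g = 0.
  move=> Jg lt; apply/eqP/negPn/negP => g0.
  suff /nmin : P (size g) by rewrite leqNgt lt.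
  apply/asboolP; exists ((lead_coef g)^-1 *: g); split.
  - by rewrite -mul_polyC; apply: JM.
  - by rewrite monicE lead_coefZ mulVf // lead_coef_eq0.
  by rewrite size_scale // invr_eq0 lead_coef_eq0.
have G0 : G != 0 := monic_neq0 mG.
(* [J] is an ideal containing [(X - b)^N], because [a x = x1 - b] and a power of [x] brings [r] into
   [K[x, z]]. Its monic generator is therefore a power of [X - b]. *)
have dvdG : G %| ('X - b%:P) ^+ N.
  apply/modp_eq0P; apply: small; last by rewrite -sG ltn_modp.
  have -> : ('X - b%:P) ^+ N %% G = ('X - b%:P) ^+ N - (('X - b%:P) ^+ N %/ G) * G.
    by rewrite {2}(divp_eq (('X - b%:P) ^+ N) G) addrAC subrr add0r.
  by apply: JB => //; apply: JM.
have /dvdp_exp_XsubCP[M le_MN] := dvdG.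
rewrite eqp_monic ?monic_exp ?monicXsubC // => /eqP GE.
case: M => [|M] in le_MN GE.
  by case: Cr; have := JG; rewrite /J GE expr0 rmorph1 mul1r.
have [sl ml] := size_lp_monic mG.
have lpG : lp G = G.
  apply/eqP; rewrite -subr_eq0; apply/eqP/small; first by apply: JB => //; apply: Jlp.
  have Gpred : n.-1.+1 = n by rewrite prednK // -sG size_poly_gt0.
  rewrite -Gpred ltnS; apply/leq_sizeP => i; rewrite leq_eqVlt => /orP[/eqP<-|lt].
    rewrite coefB -{1}sG -{1}sl -lead_coefE (monicP ml) -sG -lead_coefE (monicP mG).
    exact: subrr.
  by rewrite coefB !nth_default ?subrr // ?sl sG -Gpred.
(* The coefficient of [X^M] in [(X - b)^(M + 1)] is [-(M + 1) b]; characteristic zero then makes [b]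
   fixed. *)
have := congr1 (fun g : {poly K} => g`_M) lpG; rewrite coef_lp GE coef_exp_XsubC.
have laN k : la (- k) = - la k by rewrite -sub0r la_sub la_0 sub0r.
rewrite la_muln laN -[- la b *+ _]mulr_natl -[- b *+ _]mulr_natl.
move=> /(mulfI (natrK_neq0 charK M)) /eqP.
by rewrite eqr_opp => /eqP.
Qed.

(** Subtracting the relation from its image under [pi] gives [(lp psi - psi)(z0) = x' (pi y0 - y0)].
    Both polynomials are monic of the same degree, so [x_dvd_small] makes the left side 0, and
    cancelling [x'] shows that [y0] is fixed. *)
Lemma descent_affine : exists psi x' y' z', [/\ system str psi x' y' z',
  fixed x', fixed y', fixed z' & forall i, la psi`_i = psi`_i].
Proof.
have fa : fixed (str a * x).
  have -> : str a * x = x1 - str b by rewrite /x1 addrK.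
  by rewrite raddfB /= fx1 pi_str fixed_b.
have [y0 sys0] := change_coordinates sys A a_neq0 c_neq0.
rewrite -/z0 in sys0; set psi := change_phi _ _ _ in sys0.
exists psi, (str a * x), y0, z0.
have [sl ml] := size_lp_monic (sys_monic sys0).
have E : ev1 z0 (lp psi - psi) = (str a * x) * (pi y0 - y0).
  by rewrite rmorphB /= mulrBr -pi_fixM // (sys_rel sys0) pi_ev1.
have lpE : lp psi - psi = 0.
  apply: (x_dvd_small sys0 E); have s_gt0 := ltnW (sys_size sys0).
  rewrite -ltnS prednK //.
  have Gpred : (size psi).-1.+1 = size psi by rewrite prednK.
  rewrite -[X in (_ < X)%N]Gpred ltnS; apply/leq_sizeP => i.
  rewrite leq_eqVlt => /orP[/eqP<-|lt].
    rewrite coefB -{1}sl -!lead_coefE (monicP ml) (monicP (sys_monic sys0)).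
    exact: subrr.
  by rewrite coefB !nth_default ?subrr // ?sl -Gpred.
split=> //; last by move=> i; rewrite -coef_lp (subr0_eq lpE).
move: E; rewrite lpE rmorph0 => /esym/eqP; rewrite mulf_eq0 subr_eq0.
by rewrite (negbTE (sys_x_neq0 sys0)) => /eqP.
Qed.

End Affine.

Theorem descent : exists psi x' y' z', [/\ system str psi x' y' z',
  fixed x', fixed y', fixed z' & forall i, la psi`_i = psi`_i].
Proof.
have [a [b [a0 fx1]]] := fixed_line.
have [c [A [c0]]] := fixed_coord a0 fx1.
rewrite /coord; case: eqP => [d1|_] fz0; last exact: descent_affine a0 c0 fx1 fz0.
exists 'X, (str a * x + str b), (str c * y + ev1 x A),
  ((str a * x + str b) * (str c * y + ev1 x A)).
split=> //; first exact: descent_plane.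
  by rewrite pi_fixM // fz0.
by move=> i; rewrite coefX; case: (i == 1%N); rewrite ?la_0 ?la_1.
Qed.

End Descent.

(** * The coordinate ring of a Danielewski surface *)

Section Domain.

Variables (A : comPzRingType) (A1 : (1 : A) != 0).
Variable (dom : forall a b : A, a * b = 0 -> a = 0 \/ b = 0).

(** The carrier of [A] itself; the proofs are parameters so that the integral domain structure can
    be attached to it. Inverses are chosen classically. *)
Definition domain of (1 : A) != 0 & (forall a b : A, a * b = 0 -> a = 0 \/ b = 0)
  : Type := A.
Local Notation S := (domain A1 dom).

HB.instance Definition _ := GRing.ComPzRing.on S.
HB.instance Definition _ := GRing.PzSemiRing_isNonZero.Build S A1.

Definition domain_unit : {pred S} := fun a => `[< exists b, b * a = 1 >].
Definition domain_inv (a : S) : S :=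
  if pselect (exists b, b * a = 1) is left e then sval (cid e) else a.

Fact domain_mulV : {in domain_unit, left_inverse 1 domain_inv *%R}.
Proof.
move=> a /asboolP ea; rewrite /domain_inv.
by case: pselect => // e; case: (cid e).
Qed.

Fact domain_unitP (a b : S) : b * a = 1 -> domain_unit a.
Proof. by move=> e; apply/asboolP; exists b. Qed.

Fact domain_inv_out : {in [predC domain_unit], domain_inv =1 id}.
Proof.
move=> a /asboolP na; rewrite /domain_inv.
by case: pselect => // e; case: na.
Qed.

HB.instance Definition _ :=
  GRing.ComNzRing_hasMulInverse.Build S domain_mulV domain_unitP domain_inv_out.

Fact domain_integral : GRing.integral_domain_axiom S.
Proof.
by move=> a b /dom[->|->]; rewrite eqxx ?orbT.
Qed.

HB.instance Definition _ := GRing.ComUnitRing_isIntegral.Build S domain_integral.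

End Domain.

Lemma mpoly_closed n (F : fieldType) (B : {mpoly F[n]} -> Prop) :
  (forall c, B c%:MP) -> (forall i, B 'X_i) ->
  (forall p q, B p -> B q -> B (p + q)) ->
  (forall p q, B p -> B q -> B (p * q)) -> forall p, B p.
Proof.
move=> BC BX BD BM p; rewrite [p]mpolyE.
apply: (big_ind B) => [||m _]; [by rewrite -mpolyC0 | exact: BD |].
rewrite -mul_mpolyC mpolyXE_id; apply: (BM _ _) => //.
apply: (big_ind B) => [||i _]; [by rewrite -mpolyC1 | exact: BM |].
elim: (m i) => [|j IH]; first by rewrite expr0 -mpolyC1.
by rewrite exprS; apply: BM.
Qed.

(** * Evaluation of polynomials in [X], [Y], [Z] and the ideal of the relation *)

Section Evaluation.

Variables (F : fieldType) (phi : {poly F}).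

Definition assign (T : Type) (x y z : T) (i : 'I_3) : T :=
  if i == inord 0 then x else if i == inord 1 then y else z.

Lemma assign0 T (x y z : T) : assign x y z (inord 0) = x.
Proof. by rewrite /assign eqxx. Qed.

Lemma assign1 T (x y z : T) : assign x y z (inord 1) = y.
Proof. by rewrite /assign -val_eqE /= !inordK // eqxx. Qed.

Lemma assign2 T (x y z : T) : assign x y z (inord 2) = z.
Proof. by rewrite /assign -!val_eqE /= !inordK. Qed.

Lemma I3P (i : 'I_3) : [\/ i = inord 0, i = inord 1 | i = inord 2].
Proof.
case: i => -[|[|[|//]]] lt; [apply: Or31 | apply: Or32 | apply: Or33];
  by apply: val_inj; rewrite /= inordK.
Qed.

Section Values.

Variables (T : idomainType) (str : {rmorphism F -> T}) (x y z : T).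

Definition ev3 : {mpoly F[3]} -> T := mmap str (assign x y z).
HB.instance Definition _ := GRing.RMorphism.copy ev3 (mmap str (assign x y z)).

Lemma ev3C c : ev3 c%:MP = str c. Proof. exact: mmapC. Qed.
Lemma ev3X : ev3 (varX F) = x. Proof. by rewrite /ev3 mmapX mmap1U assign0. Qed.
Lemma ev3Y : ev3 (varY F) = y. Proof. by rewrite /ev3 mmapX mmap1U assign1. Qed.
Lemma ev3Z : ev3 (varZ F) = z. Proof. by rewrite /ev3 mmapX mmap1U assign2. Qed.

End Values.

Local Notation C := (@mpolyC 3 F).

Lemma ev1_ev3 (T : idomainType) (str : {rmorphism F -> T}) x y z (f : {poly F}) t :
  ev3 str x y z (ev1 C t f) = ev1 str (ev3 str x y z t) f.
Proof.
elim/poly_ind: f => [|f c IH]; first by rewrite !rmorph0.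
by rewrite !rmorphD !rmorphM /= IH !ev1X !ev1C ev3C.
Qed.

Lemma ev2_ev3 (T : idomainType) (str : {rmorphism F -> T}) x y z
    (f : {poly {poly F}}) s t :
  ev3 str x y z (ev2 C s t f) =
  ev2 str (ev3 str x y z s) (ev3 str x y z t) f.
Proof.
elim/poly_ind: f => [|f c IH]; first by rewrite !rmorph0.
by rewrite !rmorphD !rmorphM /= IH !ev2X !ev2C ev1_ev3.
Qed.

Lemma XYphiE : XYphi phi = varX F * varY F - ev1 C (varZ F) phi.
Proof. by []. Qed.

Lemma idealP p : reflect (exists q, p = q * XYphi phi) (p \in XYphi_ideal phi).
Proof. exact: asboolP. Qed.

Lemma varX_dvd p : exists q,
  p = varX F * q + ev3 C 0 (varY F) (varZ F) p.
Proof.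
elim/mpoly_closed: p => [c|i|p q [p' ep] [q' eq]|p q [p' ep] [q' eq]].
- by exists 0; rewrite ev3C mulr0 add0r.
- case: (I3P i) => ->; [exists 1; rewrite [ev3 _ _ _ _ _]ev3X |
    exists 0; rewrite [ev3 _ _ _ _ _]ev3Y | exists 0; rewrite [ev3 _ _ _ _ _]ev3Z].
  + by rewrite mulr1 addr0.
  + by rewrite mulr0 add0r.
  by rewrite mulr0 add0r.
- exists (p' + q'); rewrite {1}ep {1}eq rmorphD /=; ring.
exists (p' * q + ev3 C 0 (varY F) (varZ F) p * q').
rewrite rmorphM /= {1}ep {1}[in LHS]eq [in X in p' * X]eq; ring.
Qed.

Hypothesis phi0 : phi != 0.

(** Setting [X = 0] in [X p = q (XY - phi(Z))] gives [q(0, Y, Z) phi(Z) = 0], so [X] divides [q]. *)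
Lemma ideal_varX p : varX F * p \in XYphi_ideal phi -> p \in XYphi_ideal phi.
Proof.
move=> /idealP[q E]; have [q' Eq] := varX_dvd q.
have := congr1 (ev3 C 0 (varY F) (varZ F)) E.
rewrite !rmorphM XYphiE rmorphB rmorphM /= ev1_ev3 ev3X ev3Z !mul0r sub0r.
move/esym/eqP; rewrite mulf_eq0 oppr_eq0 => /orP[/eqP q0|/eqP phiZ]; last first.
  have := congr1 (ev3 polyC 0 0 'X) phiZ; rewrite ev1_ev3 ev3Z rmorph0.
  have -> : ev1 polyC 'X phi = phi.
    elim/poly_ind: (phi) => [|f c IH]; first by rewrite rmorph0.
    by rewrite !rmorphD !rmorphM /= IH ev1X ev1C.
  by move/eqP; rewrite (negbTE phi0).
apply/idealP; exists q'; have X0 : varX F != 0.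
  by apply/eqP => /(congr1 (ev3 idfun 1 0 0))/eqP; rewrite ev3X rmorph0 oner_eq0.
by apply: (mulfI X0); rewrite E Eq q0 addr0 mulrA.
Qed.

Lemma clear_varX p : exists N P,
  varX F ^+ N * p - ev2 C (varX F) (varZ F) P \in XYphi_ideal phi.
Proof.
pose X := varX F.
elim/mpoly_closed: p => [c|i|p q [M [P /idealP[p' ep]]] [N [Q /idealP[q' eq]]]
  |p q [M [P /idealP[p' ep]]] [N [Q /idealP[q' eq]]]].
- exists 0%N, c%:P%:P; rewrite ev2C ev1C mul1r subrr.
  by apply/idealP; exists 0; rewrite mul0r.
- case: (I3P i) => ->; [exists 0%N, 'X%:P | exists 1%N, (map_poly polyC phi) |
    exists 0%N, 'X]; apply/idealP.
  + by exists 0; rewrite ev2C ev1X mul1r subrr mul0r.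
  + by exists 1; rewrite ev2_map mul1r.
  by exists 0; rewrite ev2X mul1r subrr mul0r.
- exists (M + N)%N, ('X^N%:P * P + 'X^M%:P * Q); apply/idealP.
  exists (X ^+ N * p' + X ^+ M * q').
  rewrite mulrDl -[_ * p' * _]mulrA -ep -[_ * q' * _]mulrA -eq.
  rewrite rmorphD !rmorphM /= !ev2C !rmorphXn /= !ev1X exprD; rewrite -/X; ring.
exists (M + N)%N, (P * Q); apply/idealP.
exists (X ^+ N * q * p' + ev2 C (varX F) (varZ F) P * q').
rewrite mulrDl -!mulrA -ep -eq rmorphM /= exprD; rewrite -/X; ring.
Qed.

(** Modulo the ideal, [X^N p] is a polynomial in [X] and [Z]; if [p] evaluates to 0, independence
    makes this polynomial 0, and [ideal_varX] removes [X^N]. *)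
Lemma ev3_ker (T : idomainType) (str : {rmorphism F -> T}) x y z :
  x * y = ev1 str z phi -> (forall P, ev2 str x z P = 0 -> P = 0) ->
  forall p, (p \in XYphi_ideal phi) = (ev3 str x y z p == 0).
Proof.
move=> rel free; have dir p : p \in XYphi_ideal phi -> ev3 str x y z p = 0.
  move=> /idealP[q ->]; rewrite XYphiE rmorphM rmorphB rmorphM /= ev1_ev3.
  by rewrite ev3X ev3Y ev3Z rel subrr mulr0.
move=> p; apply/idP/eqP => [|p0]; first exact: dir.
have [N [P NP]] := clear_varX p.
have := dir _ NP; rewrite rmorphB rmorphM /= p0 mulr0 sub0r ev2_ev3 ev3X ev3Z.
move/eqP; rewrite oppr_eq0 => /eqP/free P0.
move: NP; rewrite P0 rmorph0 subr0 => {P0}.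
by elim: N => [|N IH]; rewrite ?mul1r // exprS -mulrA => /ideal_varX.
Qed.

End Evaluation.

(** * From the quotient ring to coordinate systems and back *)

Section Presentation.

Variables (F : fieldType) (phi : {poly F}).
Hypothesis phi_gt1 : (1 < size phi)%N.

Local Notation V := {ideal_quot (XYphi_ideal phi)}.
Local Notation proj := (\pi_V%qT : {mpoly F[3]} -> V).
Local Notation C := (@mpolyC 3 F).

Let phi0 : phi != 0. Proof. by rewrite -size_poly_gt0 ltnW. Qed.

Lemma proj_eq p q : (proj p = proj q) <-> (p - q \in XYphi_ideal phi).
Proof.
by rewrite Quotient.idealrBE; split=> [->|/eqP].
Qed.

Lemma proj_eq0 p : (proj p = 0) <-> (p \in XYphi_ideal phi).
Proof. by rewrite -(rmorph0 proj) proj_eq subr0. Qed.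

(** The generic point of the surface, with [y = phi(z)/x] in the field of rational functions in [x]
    and [z]. With [ev3_ker] it embeds the quotient ring into a field. *)
Lemma fraction_free : exists (T : idomainType) (str : {rmorphism F -> T}) x y z,
  x * y = ev1 str z phi /\ (forall P, ev2 str x z P = 0 -> P = 0).
Proof.
pose T : idomainType := {fraction {poly {poly F}}}.
pose str : {rmorphism F -> T} := @tofrac _ \o (polyC \o polyC).
pose x : T := tofrac 'X%:P; pose z : T := tofrac 'X.
have x0 : x != 0 by rewrite tofrac_eq0 polyC_eq0 polyX_eq0.
exists T, str, x, (ev1 str z phi / x), z; split.
  by rewrite mulrC divfK.
have e1 (f : {poly F}) : ev1 str x f = tofrac f%:P.
  elim/poly_ind: f => [|f c IH]; first by rewrite !rmorph0.
  by rewrite !rmorphD !rmorphM /= IH ev1X ev1C.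
have e2 f : ev2 str x z f = tofrac f.
  elim/poly_ind: f => [|f c IH]; first by rewrite !rmorph0.
  by rewrite !rmorphD !rmorphM /= IH ev2X ev2C e1.
by move=> P; rewrite e2 => /eqP; rewrite tofrac_eq0 => /eqP.
Qed.

Lemma XYphi_domain (A : calg F) : calg_iso A (XYphi_calg phi) ->
  (1 : A) <> 0 /\ forall a b : A, a * b = 0 -> a = 0 \/ b = 0.
Proof.
move=> [f [/bij_inj fI _]]; have [T [str [x [y [z [rel free]]]]]] := fraction_free.
have ker p : (proj p = 0) <-> ev3 str x y z p = 0.
  by rewrite proj_eq0 (ev3_ker phi0 rel free); split=> /eqP.
have rep (a : A) : exists p, f a = proj p by exists (repr (f a)); rewrite reprK.
split=> [/(congr1 f)|a b /(congr1 f)].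
  rewrite rmorph1 rmorph0 -(rmorph1 proj) => /ker /eqP.
  by rewrite rmorph1 oner_eq0.
have [p fa] := rep a; have [q fb] := rep b.
rewrite rmorphM rmorph0 fa fb -rmorphM => /ker/eqP.
rewrite rmorphM mulf_eq0 => /orP[/eqP/ker|/eqP/ker] e0; [left | right];
  by apply: fI; rewrite rmorph0 ?fa ?fb.
Qed.

Section Transport.

Variables (S : idomainType) (str : {rmorphism F -> S}).

(** [phi] need not be monic here; dividing it and [y] by its leading coefficient restores this. *)
Lemma iso_system (f : {rmorphism S -> XYphi_calg phi}) :
  bijective f -> (forall c, f (str c) = calg_str (XYphi_calg phi) c) ->
  exists psi x y z, system str psi x y z.
Proof.
move=> [g fK gK] fC; have fI := can_inj fK.
have {}fC c : f (str c) = proj c%:MP by exact: fC.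
have lc0 : lead_coef phi != 0 by rewrite lead_coef_eq0.
pose x : S := g (proj (varX F)); pose y : S := g (proj (varY F)).
pose z : S := g (proj (varZ F)).
have fx : f x = proj (varX F) by exact: gK.
have fy : f y = proj (varY F) by exact: gK.
have fz : f z = proj (varZ F) by exact: gK.
have f1 t p P : f t = proj p -> f (ev1 str t P) = proj (ev1 C p P).
  move=> ft; elim/poly_ind: P => [|P c IH]; first by rewrite !rmorph0.
  by rewrite !rmorphD !rmorphM /= IH !ev1X !ev1C ft fC.
have f2 P : f (ev2 str x z P) = proj (ev2 C (varX F) (varZ F) P).
  elim/poly_ind: P => [|P c IH]; first by rewrite !rmorph0.
  by rewrite !rmorphD !rmorphM /= IH !ev2X !ev2C fz (f1 x (varX F)).
exists ((lead_coef phi)^-1 *: phi), x, (str (lead_coef phi)^-1 * y), z.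
split.
- by rewrite size_scale ?invr_eq0.
- by rewrite monicE lead_coefZ mulVf.
- rewrite ev1Z mulrCA; congr (_ * _); apply: fI.
  rewrite rmorphM fx fy (f1 z (varZ F)) // -rmorphM; apply/proj_eq/idealP.
  by exists 1; rewrite mul1r XYphiE.
- move=> B BC BG BD BM a.
  suff H p : forall b, f b = proj p -> B b by apply: (H (repr (f a))); rewrite reprK.
  elim/mpoly_closed: p => [c|i|p q Bp Bq|p q Bp Bq] b.
  + by rewrite -fC => /fI->.
  + case: (I3P i) => -> e.
    * by rewrite -(fK b) e; apply: BG; apply: Or31.
    * have -> : b = str (lead_coef phi) * (str (lead_coef phi)^-1 * y).
        rewrite mulrA -rmorphM divff // rmorph1 mul1r.
        by apply: fI; rewrite fy.
      by apply: BM => //; apply: BG; apply: Or32.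
    by rewrite -(fK b) e; apply: BG; apply: Or33.
  + move=> e; have -> : b = g (proj p) + g (proj q).
      by apply: fI; rewrite e !rmorphD /= !gK.
    by apply: BD; [apply: Bp | apply: Bq]; rewrite gK.
  move=> e; have -> : b = g (proj p) * g (proj q).
    by apply: fI; rewrite e !rmorphM /= !gK.
  by apply: BM; [apply: Bp | apply: Bq]; rewrite gK.
have [T [strT [x' [y' [z' [rel free]]]]]] := fraction_free.
move=> P P0; apply: (free P); have := f2 P; rewrite P0 rmorph0 => /esym/proj_eq0.
by rewrite (ev3_ker phi0 rel free) ev2_ev3 ev3X ev3Z => /eqP.
Qed.

Lemma ev3_surj x y z : system str phi x y z -> forall a, exists p, ev3 str x y z p = a.
Proof.
move=> sys; apply: (sys_gen sys (B := fun a => exists p, _ p = a)).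
- by move=> c; exists c%:MP; exact: ev3C.
- move=> b [] ->; [exists (varX F) | exists (varY F) | exists (varZ F)];
    [exact: ev3X | exact: ev3Y | exact: ev3Z].
- by move=> _ _ [p <-] [q <-]; exists (p + q); rewrite rmorphD.
by move=> _ _ [p <-] [q <-]; exists (p * q); rewrite rmorphM.
Qed.

Lemma system_iso x y z : system str phi x y z ->
  exists f : {rmorphism S -> XYphi_calg phi},
    bijective f /\ forall c, f (str c) = calg_str (XYphi_calg phi) c.
Proof.
move=> sys; pose e : {rmorphism {mpoly F[3]} -> S} := ev3 str x y z.
have ker p : (proj p = 0) <-> e p = 0.
  by rewrite proj_eq0 (ev3_ker phi0 (sys_rel sys) (sys_free sys)); split=> /eqP.
have e_surj : forall a, exists p, e p = a := ev3_surj sys.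
have proj_e p q : e p = e q <-> proj p = proj q.
  split=> [E|E]; first by apply/proj_eq/proj_eq0/ker; rewrite rmorphB E subrr.
  apply/eqP; rewrite -subr_eq0 -rmorphB; apply/eqP/ker/proj_eq0/proj_eq.
  exact: E.
pose s a := sval (cid (e_surj a)).
have sK a : e (s a) = a by exact: svalP (cid (e_surj a)).
pose f0 (a : S) : XYphi_calg phi := proj (s a).
have f0e p : f0 (e p) = proj p by apply/proj_e; rewrite sK.
have f0B : zmod_morphism f0.
  by move=> a b; rewrite -(sK a) -(sK b) -rmorphB !f0e rmorphB.
have f0M : monoid_morphism f0.
  split; first by rewrite -(rmorph1 e) f0e rmorph1.
  by move=> a b; rewrite -(sK a) -(sK b) -rmorphM !f0e rmorphM.
pose f : {rmorphism S -> XYphi_calg phi} := HB.pack f0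
  (GRing.isZmodMorphism.Build _ _ f0 f0B)
  (GRing.isMonoidMorphism.Build _ _ f0 f0M).
exists f; split.
  exists (fun v => e (repr v)) => [a|v]; rewrite /f /=.
    by rewrite -[in RHS](sK a); apply/proj_e; rewrite reprK.
  by rewrite f0e reprK.
by move=> c; rewrite /f /= -(ev3C str x y z c) f0e.
Qed.

End Transport.

End Presentation.

Lemma classD_system (F : fieldType) (A : calg F) : classD A ->
  exists (nz : (1 : A) != 0) (dom : forall a b : A, a * b = 0 -> a = 0 \/ b = 0)
         psi (x y z : domain nz dom),
    system (calg_str A : {rmorphism F -> domain nz dom}) psi x y z.
Proof.
move=> [phi [phi_gt1 iso]].
have [/eqP nz dom] := XYphi_domain phi_gt1 iso; exists nz, dom.
have [f [fbij fC]] := iso.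
exact: (@iso_system F phi phi_gt1 (domain nz dom) (calg_str A) f fbij fC).
Qed.

Lemma system_classD (F : fieldType) (A : calg F) (nz : (1 : A) != 0)
    (dom : forall a b : A, a * b = 0 -> a = 0 \/ b = 0)
    psi (x y z : domain nz dom) :
  system (calg_str A : {rmorphism F -> domain nz dom}) psi x y z -> classD A.
Proof.
move=> sys; have gt1 := sys_size sys; exists psi; split=> //.
by have [f [fbij fC]] := system_iso gt1 sys; exists f.
Qed.

(** * Scalar extension *)

Section Functional.

Variables (k K : fieldType) (iota : {rmorphism k -> K}).

(** A maximal subspace avoiding 1, by Zorn. For [x] outside it, maximality puts 1 in the span of the
    subspace and [x], so [x] is congruent to a scalar. *)
Lemma hyperplane : exists W : K -> Prop,
  [/\ W 0, ~ W 1, forall c a b, W a -> W b -> W (iota c * a + b) &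
      forall a, exists c, W (a - iota c)].
Proof.
pose lin (W : set K) :=
  ~ W 1 /\ forall c a b, W a -> W b -> W (iota c * a + b).
have [|W [[W1 WD] Wmax]] := @Zorn_bigcup K lin.
  move=> Fam Flin Ftot; split=> [[X FX X1]|c a b [X FX Xa] [Y FY Yb]].
    by case: (Flin _ FX).
  have [XY|YX] := Ftot _ _ FX FY; [exists Y | exists X] => //.
    by have [_ YD] := Flin _ FY; apply: YD => //; apply: XY.
  by have [_ XD] := Flin _ FX; apply: XD => //; apply: YX.
(* [lin] must admit the empty set, the union of the empty chain; so 0 is added afterwards. *)
pose W0 a := W a \/ a = 0.
have W0D c a b : W0 a -> W0 b -> W0 (iota c * a + b).
  have WZ u : W u -> W0 (iota c * u).
    move=> Wu; left; have := WD (c - 1) _ _ Wu Wu.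
    by rewrite rmorphB rmorph1 mulrBl mul1r subrK.
  move=> [Wa|->] [Wb|->]; rewrite ?mulr0 ?addr0 ?add0r; last by right.
  - by left; apply: WD.
  - exact: WZ.
  by left.
have W01 : ~ W0 1 by case=> // /eqP; rewrite oner_eq0.
exists W0; split=> //; first by right.
move=> x; case: (pselect (W x)) => [Wx|nWx].
  by exists 0; rewrite rmorph0 subr0; left.
pose W' : set K := [set u | exists2 w, W0 w & exists c, u = w + iota c * x]%classic.
have W'x : W' x by exists 0; [right | exists 1; rewrite rmorph1 mul1r add0r].
have ltW : (W `<` W')%classic.
  split=> [w Ww|W'W]; last by apply: nWx; apply: W'W.
  by exists w; [left | exists 0; rewrite rmorph0 mul0r addr0].
have : W' 1.
  apply: contrapT => nW'1; apply: (Wmax _ ltW); split=> //.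
  move=> c _ _ [w Ww [a ->]] [v Wv [b ->]].
  exists (iota c * w + v); first exact: W0D.
  by exists (c * a + b); rewrite rmorphD rmorphM; ring.
move=> [w Ww [c E]]; have c0 : c != 0.
  by apply: contra_notN W01 => /eqP c0; rewrite E c0 rmorph0 mul0r addr0.
have ic0 : iota c != 0 by rewrite fmorph_eq0.
exists c^-1; have -> : x - iota c^-1 = iota (- c^-1) * w + 0.
  apply: (mulfI ic0); rewrite addr0 rmorphN mulrBr mulrA mulrN -rmorphM mulfV //.
  by rewrite rmorph1 mulN1r {1}E; ring.
by apply: W0D => //; right.
Qed.

(** The projection onto [k] along the hyperplane. *)
Lemma functional : exists la : {additive K -> k},
  (forall c a, la (iota c * a) = c * la a) /\ la 1 = 1.
Proof.
have [W [W0 W1 WD Wex]] := hyperplane.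
have WB a b : W a -> W b -> W (a - b).
  move=> Wa Wb; have := WD (-1) _ _ Wb Wa.
  by rewrite rmorphN rmorph1 mulN1r addrC.
have WZ c a : W a -> W (iota c * a) by move=> Wa; rewrite -[_ * _]addr0; apply: WD.
pose la0 a := sval (cid (Wex a)).
have la0P a : W (a - iota (la0 a)) by exact: (svalP (cid (Wex a))).
have la0E a c : W (a - iota c) -> la0 a = c.
  move=> Wc; apply/eqP; rewrite -subr_eq0; apply/negPn/negP => e0; apply: W1.
  have := WZ (la0 a - c)^-1 _ (WB _ _ Wc (la0P a)).
  have -> : a - iota c - (a - iota (la0 a)) = iota (la0 a - c).
    by rewrite rmorphB; ring.
  by rewrite -rmorphM mulVf // rmorph1.
have la0B : zmod_morphism la0.
  move=> a b; apply: la0E; have := WB _ _ (la0P a) (la0P b).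
  by congr W; rewrite rmorphB; ring.
pose la : {additive K -> k} := HB.pack la0 (GRing.isZmodMorphism.Build _ _ la0 la0B).
exists la; split=> [c a|]; apply: la0E.
  by rewrite rmorphM -mulrBr; apply: WZ.
by rewrite rmorph1 subrr.
Qed.

End Functional.

Section Tensor.

Variables (k K : fieldType) (iota : {rmorphism k -> K}) (R : calg k).

Local Notation T := (tens iota R).
Local Notation proj := (\pi_T%qT : seq (K * R) -> T).
Local Notation str := (calg_str (tensor iota R)).

Lemma proj_cat s t : proj (s ++ t) = proj s + proj t.
Proof. exact: pi_tens_add. Qed.

Lemma proj_mul s t : proj (fmul s t) = proj s * proj t.
Proof. exact: pi_tens_mul. Qed.

Definition pure (r : R) : T := proj [:: (1, r)].

Fact pure_zmod : zmod_morphism pure.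
Proof.
move=> r s; apply/eqP; rewrite eq_sym subr_eq; apply/eqP.
rewrite /pure -proj_cat -[in LHS](subrK s r); exact/tens_piP/tens_Dr.
Qed.

Fact pure_monoid : monoid_morphism pure.
Proof.
split=> [|r s]; first exact: pi_tens_one.
by rewrite /pure -proj_mul /fmul /= mulr1.
Qed.

HB.instance Definition _ := GRing.isZmodMorphism.Build R T pure pure_zmod.
HB.instance Definition _ := GRing.isMonoidMorphism.Build R T pure pure_monoid.

Definition incl : {rmorphism R -> T} := pure.

Lemma proj_pair a r : proj [:: (a, r)] = str a * incl r.
Proof. by rewrite -[str a]/(proj [:: (a, 1)]) -proj_mul /fmul /= mulr1 mul1r. Qed.

Lemma incl_str c : incl (calg_str R c) = str (iota c).
Proof.
rewrite -[LHS]mul1r -(rmorph1 str) -proj_pair; apply: tens_piP.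
by have := tens_sym (tens_bal iota 1 c (1 : R)); rewrite mul1r mulr1.
Qed.

Lemma tens_sum (t : T) : exists s : seq (K * R), t = \sum_(p <- s) str p.1 * incl p.2.
Proof.
exists (repr t); rewrite -[LHS]reprK; elim: (repr t) => [|[a r] s IH].
  by rewrite big_nil; exact: pi_tens_zero.
by rewrite big_cons -cat1s proj_cat IH proj_pair.
Qed.

Lemma tens_ind (B : T -> Prop) : (forall u v, B u -> B v -> B (u + v)) ->
  (forall a r, B (str a * incl r)) -> forall t, B t.
Proof.
move=> BD BG t; have [s ->] := tens_sum t.
by apply: (big_ind B) => //; rewrite -(mul0r (incl 0)) -(rmorph0 str).
Qed.

Lemma tens_lift (V : zmodType) (g : K -> R -> V) :
  (forall a b r, g (a + b) r = g a r + g b r) ->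
  (forall a r s, g a (r + s) = g a r + g a s) ->
  (forall a c r, g (a * iota c) r = g a (calg_str R c * r)) ->
  exists h : {additive T -> V}, forall a r, h (str a * incl r) = g a r.
Proof.
move=> gDl gDr gbal; pose h1 (s : seq (K * R)) := \sum_(p <- s) g p.1 p.2.
have h1_cat s t : h1 (s ++ t) = h1 s + h1 t by exact: big_cat.
have h1_1 a r : h1 [:: (a, r)] = g a r by exact: big_seq1.
have h1_eq s t : tens_eq iota s t -> h1 s = h1 t.
  elim=> {s t} //.
  - by move=> s t u _ -> _ ->.
  - by move=> s1 s2 t1 t2 _ e1 _ e2; rewrite !h1_cat e1 e2.
  - by move=> s t; rewrite !h1_cat addrC.
  - move=> r; rewrite h1_1 [RHS]big_nil; have := gDl 0 0 r.
    by rewrite addr0 -[LHS]addr0 => /addrI ->.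
  - by move=> a b r; rewrite -[[:: _; _]]cat1s h1_cat !h1_1.
  - by move=> a r s; rewrite -[[:: _; _]]cat1s h1_cat !h1_1.
  by move=> a c r; rewrite !h1_1.
pose h0 (t : T) := h1 (repr t).
have h0E s : h0 (proj s) = h1 s by apply/h1_eq/repr_eq.
have h0D u v : h0 (u + v) = h0 u + h0 v.
  by rewrite -[u]reprK -[v]reprK -proj_cat !h0E h1_cat.
have h0B : zmod_morphism h0.
  by move=> u v; apply/eqP; rewrite eq_sym subr_eq -h0D subrK.
pose h : {additive T -> V} := HB.pack h0 (GRing.isZmodMorphism.Build _ _ h0 h0B).
by exists h => a r; rewrite -proj_pair /h /= h0E h1_1.
Qed.

End Tensor.


(** * Descent from [K] to [k] *)

Section Descend.

Variables (k K : fieldType) (chark : [pchar k] =i pred0).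
Variables (iota : {rmorphism k -> K}) (R : calg k).

Local Notation T := (tens iota R).
Local Notation strK := (calg_str (tensor iota R)).
Local Notation strk := (calg_str R).
Local Notation incl := (incl iota R).

Lemma tens_derivation (D : {additive R -> R}) : is_derivation D ->
  locally_nilpotent D -> (forall c, D (strk c) = 0) ->
  exists DK : {additive T -> T}, [/\ is_derivation DK, locally_nilpotent DK &
    forall a r, DK (strK a * incl r) = strK a * incl (D r)].
Proof.
move=> derD lnD Dk; pose g a r := strK a * incl (D r).
have [|||DK DKE] := @tens_lift k K iota R T g.
- by move=> a b r; rewrite /g rmorphD mulrDl.
- by move=> a r s; rewrite /g raddfD rmorphD mulrDr.
- move=> a c r; rewrite /g derD Dk mul0r add0r rmorphM.
  by rewrite rmorphM incl_str mulrA.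
have {}DKE a r : DK (strK a * incl r) = strK a * incl (D r) by exact: DKE.
exists DK; split=> //.
- elim/tens_ind=> [u v Du Dv w|a r].
    by rewrite mulrDl !raddfD Du Dv /= mulrDl; ring.
  elim/tens_ind=> [u v Du Dv|b s]; first by rewrite mulrDr !raddfD Du Dv /=; ring.
  rewrite mulrACA -!rmorphM !DKE derD rmorphD !rmorphM; ring.
elim/tens_ind=> [u v [n Dn] [m Dm]|a r].
  have mono i j w : iter i DK w = 0 -> iter (i + j) DK w = 0.
    move=> e; rewrite addnC; elim: j => [|j IH]; first exact: e.
    by rewrite addSn iterS IH raddf0.
  exists (n + m)%N; have iD i : iter i DK (u + v) = iter i DK u + iter i DK v.
    by elim: i => //= i ->; rewrite raddfD.
  by rewrite iD mono // addnC mono // addr0.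
have [n Dn] := lnD r; exists n.
have -> : iter n DK (strK a * incl r) = strK a * incl (iter n D r).
  by elim: (n) => //= i ->; rewrite DKE.
by rewrite Dn rmorph0 mulr0.
Qed.

Lemma retraction (la : {additive K -> k}) :
  (forall c a, la (iota c * a) = c * la a) -> la 1 = 1 ->
  exists Lam : {additive T -> R}, [/\
    forall a r, Lam (strK a * incl r) = strk (la a) * r,
    forall r t, Lam (incl r * t) = r * Lam t & forall r, Lam (incl r) = r].
Proof.
move=> laZ la1; have [|||Lam LamE] := @tens_lift k K iota R R (fun a r => strk (la a) * r).
- by move=> a b r; rewrite raddfD rmorphD mulrDl.
- by move=> a r s; rewrite mulrDr.
- by move=> a c r; rewrite [a * _]mulrC laZ rmorphM mulrA [_ * strk c]mulrC.
have {}LamE a r : Lam (strK a * incl r) = strk (la a) * r by exact: LamE.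
exists Lam; split=> // [r|r].
  elim/tens_ind=> [u v IHu IHv|a s]; first by rewrite mulrDr !raddfD IHu IHv mulrDr.
  by rewrite mulrCA -rmorphM !LamE mulrCA.
by rewrite -[incl r]mul1r -(rmorph1 strK) LamE la1 rmorph1 mul1r.
Qed.

Theorem classD_descent (D : {additive R -> R}) : is_derivation D ->
  locally_nilpotent D -> (exists r, D r <> 0) -> classD (tensor iota R) -> classD R.
Proof.
move=> derD lnD [r0 Dr0] /classD_system[nzT [domT [phi [x [y [z sys]]]]]].
have charK : [pchar K] =i pred0 by move=> p; rewrite (fmorph_pchar iota) chark.
have [la [laZ la1]] := functional iota.
have [Lam [LamE LamM LamI]] := retraction laZ la1.
have incl_inj : injective incl := can_inj LamI.
have nzR : (1 : R) != 0.
  apply/eqP => e; have /eqP := (nzT); apply.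
  by rewrite -(rmorph1 incl) e rmorph0.
have domR (a b : R) : a * b = 0 -> a = 0 \/ b = 0.
  move=> ab0; have : incl a * incl b = 0 by rewrite -rmorphM ab0 rmorph0.
  by case/domT => e; [left | right]; apply: incl_inj; rewrite e rmorph0.
pose S : idomainType := domain nzT domT; pose A : idomainType := domain nzR domR.
have Dk : forall c, D (strk c) = 0.
  exact: (@D_str k chark A (calg_str R) D derD lnD).
have [DK [derK lnK DKE]] := tens_derivation derD lnD Dk.
have DKI r : DK (incl r) = incl (D r).
  by have := DKE 1 r; rewrite rmorph1 !mul1r.
pose pi : {additive T -> T} := incl \o Lam.
have piM a b : pi (pi a * b) = pi a * pi b by rewrite /pi /= LamM rmorphM.
have pi1 : pi 1 = 1 by rewrite /pi /= -(rmorph1 incl) LamI.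
have piE a r : pi (strK a * incl r) = strK (iota (la a)) * incl r.
  by rewrite /pi /= LamE rmorphM incl_str.
have pi_str a : pi (strK a) = strK (iota (la a)).
  by have := piE a 1; rewrite rmorph1 !mulr1.
have piD t : pi (DK t) = DK (pi t).
  elim/tens_ind: t => [u v IHu IHv|a r]; first by rewrite !raddfD IHu IHv.
  by rewrite DKE !piE DKE.
pose span a b := exists r : seq (K * K), b = \sum_(k <- r) strK k.1 * pi (strK k.2 * a).
have spanD a u v : span a u -> span a v -> span a (u + v).
  by move=> [r ->] [s ->]; exists (r ++ s); rewrite big_cat.
have span1 a c e : span a (strK c * pi (strK e * a)).
  by exists [:: (c, e)]; rewrite big_seq1.
have span0 a : span a 0 by exists [::]; rewrite big_nil.
(* Induction on the number of terms of a representation [b]. If [c] is its first coefficient,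
   [b' = b - c pi(c^-1 b)] has one term fewer, because [la 1 = 1] cancels the first. Linearity of
   [pi] over its fixed points turns a combination for [b'] into one for [b]. *)
have pi_span a : span a a.
  have [s ->] := tens_sum a.
  have [n] := ubnP (size s); elim: n s => // n IH [|[c r] s] lt_sn.
    by rewrite big_nil.
  rewrite big_cons -[strK _ * incl _]/(strK c * incl r).
  case: (eqVneq c 0) => [->|c0]; first by rewrite rmorph0 mul0r add0r; apply: IH.
  set b := _ + _.
  pose f e := e - c * iota (la (c^-1 * e)).
  have bE : b = strK c * pi (strK c^-1 * b) +
      \sum_(p <- [seq (f p.1, p.2) | p <- s]) strK p.1 * incl p.2.
    rewrite /b mulrDr mulrA -rmorphM mulVf // raddfD piE.
    rewrite la1 !rmorph1 !mul1r mulrDr -addrA; congr (_ + _).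
    rewrite mulr_sumr raddf_sum mulr_sumr big_map -big_split; apply: eq_bigr => p _.
    rewrite -[RHS]/(strK c * pi (strK c^-1 * (strK p.1 * incl p.2)) +
      strK (f p.1) * incl p.2).
    rewrite [strK c^-1 * _]mulrA -rmorphM piE /f rmorphB rmorphM; ring.
  set b' := \sum_(p <- map _ _) _ in bE.
  have span' : span b' b' by apply: IH; rewrite size_map.
  rewrite {2}bE; apply: (spanD _ _ _ (span1 _ _ _)).
  have [q ->] := span'; apply: (big_ind (span b)) => // [|i _]; first exact: spanD.
  have -> : b' = b - strK c * pi (strK c^-1 * b).
    by apply/eqP; rewrite eq_sym subr_eq addrC; apply/eqP.
  have piS e w : pi (strK e * pi w) = strK (iota (la e)) * pi w.
    by rewrite mulrC piM mulrC pi_str.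
  rewrite mulrBr raddfB mulrBr; apply: (spanD _ _ _ (span1 _ _ _)).
  rewrite [strK i.2 * _]mulrA -rmorphM piS mulrA -rmorphM -mulNr -rmorphN.
  exact: span1.
have DK0 : exists a, DK a != 0.
  exists (incl r0); rewrite DKI; apply/eqP => e; apply: Dr0; apply: incl_inj.
  by rewrite e rmorph0.
have [phi' [x' [y' [z' [sys' Dx']]]]] :=
  @straighten K charK S (calg_str (tensor iota R)) DK derK lnK _ _ _ _ sys.
have [psi [x1 [y1 [z1 [sys1 fx fy fz fpsi]]]]] :=
  @descent K charK S (calg_str (tensor iota R)) DK derK lnK DK0 _ _ _ _ sys' Dx'
    (fun a => iota (la a)) pi piM pi1 pi_str pi_span piD.
pose psi0 : {poly k} := map_poly la psi; pose x0 : A := Lam x1.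
pose y0 : A := Lam y1; pose z0 : A := Lam z1.
have psiE : map_poly iota psi0 = psi by apply/polyP => i; rewrite !coef_map; exact: fpsi.
pose sA : {rmorphism k -> A} := calg_str R.
pose sS : {rmorphism K -> S} := calg_str (tensor iota R).
pose h : {rmorphism A -> S} := incl.
have h_str c : h (sA c) = sS (iota c) by exact: incl_str.
have [hx hy hz] : [/\ h x0 = x1, h y0 = y1 & h z0 = z1] by [].
have e1 (t : A) f : h (ev1 sA t f) = ev1 sS (h t) (map_poly iota f).
  elim/poly_ind: f => [|f c IH]; first by rewrite !rmorph0.
  by rewrite map_poly_MXaddC !ev1_MXaddC rmorphD rmorphM IH h_str.
have e2 f : h (ev2 sA x0 z0 f) = ev2 sS x1 z1 (map_poly (map_poly iota) f).
  elim/poly_ind: f => [|f c IH]; first by rewrite !rmorph0.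
  by rewrite map_poly_MXaddC !ev2_MXaddC rmorphD rmorphM IH e1 hx hz.
apply: (@system_classD k R nzR domR psi0 x0 y0 z0); split.
- by rewrite -(size_map_poly iota) psiE (sys_size sys1).
- by rewrite -(map_monic iota) psiE (sys_monic sys1).
- apply: incl_inj; rewrite -[RHS]/(h (ev1 sA z0 psi0)) -[LHS]/(h (x0 * y0)).
  by rewrite e1 psiE rmorphM hx hy hz (sys_rel sys1).
- move=> B Bs BG BD BM r.
  (* The [K]-span of [B] in the tensor product, encoded impredicatively. It is a subalgebra
     containing the coordinates, hence everything; [Lam] sends it back into [B], because [la] takes
     its values in [k]. *)
  pose B' t := forall G : T -> Prop, (forall u v, G u -> G v -> G (u + v)) ->
    (forall a r, B r -> G (strK a * incl r)) -> G t.
  have B'I a s : B s -> B' (strK a * incl s) by move=> Bs' G _; apply.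
  have B'1 s : B s -> B' (incl s).
    by rewrite -[incl s]mul1r -(rmorph1 strK); apply: B'I.
  suff B'_all t : B' t.
    have := B'_all (incl r) (fun t => B (Lam t)); rewrite LamI; apply.
      by move=> u v; rewrite raddfD; apply: BD.
    by move=> a s Bs'; rewrite LamE; apply: BM.
  apply: (sys_gen sys1 (B := B')) => [c|u|u v B'u B'v G GD GI|u v B'u B'v G GD GI].
  + by rewrite -[calg_str _ c]mulr1 -(rmorph1 incl); apply: B'I; rewrite -(rmorph1 strk).
  + case=> ->; [rewrite -hx | rewrite -hy | rewrite -hz]; apply: B'1; apply: BG;
      [exact: Or31 | exact: Or32 | exact: Or33].
  + exact: (GD _ _ (B'u G GD GI) (B'v G GD GI)).
  apply: (B'u (fun w => G (w * v))) => [w w' Gw Gw'|a s Bs'].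
    by rewrite mulrDl; apply: GD.
  apply: (B'v (fun w => G (strK a * incl s * w))) => [w w' Gw Gw'|a' s' Bs''].
    by rewrite mulrDr; apply: GD.
  by rewrite mulrACA -!rmorphM; apply: GI; apply: BM.
move=> P P0; have := e2 P; rewrite P0 rmorph0 => /esym/(sys_free sys1) P'0.
apply: (map_inj_poly (map_poly_inj iota)); first exact: rmorph0.
by rewrite P'0 map_poly0.
Qed.

End Descend.

(** * Replicas and the main theorem *)

Section Replica.

Variables (F : fieldType) (S : idomainType) (str : {rmorphism F -> S}).
Variables (phi : {poly F}) (x y z : S) (sys : system str phi x y z).

Local Notation e := (ev3 str x y z).
Local Notation C := (@mpolyC 3 F).

(* The vector field X d/dZ + phi'(Z) d/dY kills XY - phi(Z). *)
Definition replica_poly (p : {mpoly F[3]}) : S :=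
  x * e (mderiv (inord 2) p) + ev1 str z phi^`() * e (mderiv (inord 1) p).

Local Notation delta := replica_poly.

Lemma mderivXU n (i j : 'I_n) : mderiv i 'X_j = (i == j)%:R%:MP :> {mpoly F[n]}.
Proof.
rewrite mderivX mnm1E eq_sym; case: eqP => [->|_]; last by rewrite scale0r mpolyC0.
rewrite (_ : (U_(j) - U_(j))%MM = 0%MM) ?mpolyX0 ?scale1r ?mpolyC1 //.
by apply/mnmP => l; rewrite mnmBE mnm0E subnn.
Qed.

Lemma replica_polyB p q : delta (p - q) = delta p - delta q.
Proof. by rewrite /replica_poly !mderivB !rmorphB /=; ring. Qed.

Lemma replica_polyM p q : delta (p * q) = delta p * e q + e p * delta q.
Proof. by rewrite /replica_poly !mderivM !rmorphD !rmorphM /=; ring. Qed.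

Lemma replica_polyC c : delta c%:MP = 0.
Proof. by rewrite /replica_poly !mderivC rmorph0 !mulr0 addr0. Qed.

Let ne10 : (inord 1 == inord 0 :> 'I_3) = false.
Proof. by rewrite -val_eqE /= !inordK. Qed.
Let ne20 : (inord 2 == inord 0 :> 'I_3) = false.
Proof. by rewrite -val_eqE /= !inordK. Qed.
Let ne21 : (inord 2 == inord 1 :> 'I_3) = false.
Proof. by rewrite -val_eqE /= !inordK. Qed.

Lemma replica_polyX : delta (varX F) = 0.
Proof. by rewrite /replica_poly !mderivXU ne10 ne20 rmorph0 !mulr0 addr0. Qed.

Lemma replica_polyY : delta (varY F) = ev1 str z phi^`().
Proof.
by rewrite /replica_poly !mderivXU eqxx ne21 rmorph0 mulr0 rmorph1 mulr1 add0r.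
Qed.

Lemma replica_polyZ : delta (varZ F) = x.
Proof.
rewrite /replica_poly !mderivXU eqxx eq_sym ne21.
by rewrite rmorph0 mulr0 rmorph1 mulr1 addr0.
Qed.

Lemma replica_poly_ev1 f : delta (ev1 C (varZ F) f) = x * ev1 str z f^`().
Proof.
have deltaD p q : delta (p + q) = delta p + delta q.
  by rewrite /replica_poly !mderivD !rmorphD /=; ring.
elim/poly_ind: f => [|f c IH].
  by rewrite deriv0 !rmorph0 mulr0 -mpolyC0 replica_polyC.
rewrite ev1_MXaddC derivMXaddC rmorphD rmorphM /= ev1X deltaD replica_polyM IH.
by rewrite replica_polyZ replica_polyC ev1_ev3 ev3Z; ring.
Qed.

(** The kernel of evaluation is generated by the relation, which the field kills, so the field
    descends to [S]. Nilpotency is checked on generators: [x] goes to 0, [z] to [x], and [y] to a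
    polynomial in [z]. *)
Theorem replica : exists D : {additive S -> S},
  [/\ is_derivation D, locally_nilpotent D & D z = x].
Proof.
have phi0 : phi != 0 := monic_neq0 (sys_monic sys).
have ker p : e p = 0 -> delta p = 0.
  move=> p0; have : p \in XYphi_ideal phi.
    by rewrite (ev3_ker phi0 (sys_rel sys) (sys_free sys)) p0.
  move=> /idealP[q ->]; rewrite replica_polyM XYphiE.
  rewrite replica_polyB replica_polyM replica_polyX replica_polyY replica_poly_ev1.
  by rewrite rmorphB rmorphM /= ev1_ev3 ev3X ev3Y ev3Z (sys_rel sys); ring.
have e_surj := ev3_surj sys; pose s a := sval (cid (e_surj a)).
have sK a : e (s a) = a by exact: svalP (cid (e_surj a)).
pose D0 a := delta (s a).
have D0e p : D0 (e p) = delta p.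
  apply/eqP; rewrite -subr_eq0 -replica_polyB; apply/eqP/ker.
  by rewrite rmorphB /= sK subrr.
have D0B : zmod_morphism D0.
  by move=> a b; rewrite -(sK a) -(sK b) -rmorphB !D0e replica_polyB.
pose D : {additive S -> S} := HB.pack D0 (GRing.isZmodMorphism.Build _ _ D0 D0B).
have De p : D (e p) = delta p by exact: D0e.
have derD : is_derivation D.
  by move=> a b; rewrite -(sK a) -(sK b) -rmorphM !De replica_polyM.
have Dz : D z = x by rewrite -{1}(ev3Z str x y z) De replica_polyZ.
have Dx : D x = 0 by rewrite -{1}(ev3X str x y z) De replica_polyX.
have Dy : D y = ev1 str z phi^`() by rewrite -{1}(ev3Y str x y z) De replica_polyY.
have nstr c : nilp D (str c).
  by apply: nilp_ker; rewrite -(ev3C str x y z) De replica_polyC.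
have nz : nilp D z by exists 2; rewrite -[LHS]/(D (D z)) Dz Dx.
exists D; split=> //; apply: (sys_gen sys (B := nilp D)) => //.
- move=> a [] -> //; first exact: nilp_ker.
  have [n Dn] : nilp D (D y).
    by rewrite Dy; apply: closed_ev1 => //; [exact: nilpD | exact: nilpM].
  by exists n.+1; rewrite iterSr.
- exact: nilpD.
exact: nilpM.
Qed.

End Replica.

(** The retraction attached to the identity functional is inverse to the inclusion. *)
Lemma tensor_id (k : fieldType) (R : calg k) :
  calg_iso (tensor idfun R) R.
Proof.
have [Lam [LamE LamM LamI]] :=
  @retraction k k idfun R idfun (fun _ _ => erefl) erefl.
have LamK : cancel Lam (incl idfun R).
  elim/tens_ind=> [u v Ku Kv|a r]; first by rewrite raddfD rmorphD Ku Kv.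
  by rewrite LamE rmorphM incl_str.
have Lam_monoid : monoid_morphism Lam.
  split=> [|u v]; first by rewrite -(rmorph1 (incl idfun R)) LamI.
  by rewrite -{1}(LamK u) LamM.
pose f : {rmorphism tensor idfun R -> R} :=
  HB.pack (Lam : tensor idfun R -> R) (Algebra.Additive.on Lam)
    (GRing.isMonoidMorphism.Build _ _ _ Lam_monoid).
exists f; split; first by exists (incl idfun R).
move=> c; have := LamE c 1; rewrite rmorph1 !mulr1; exact.
Qed.


Lemma calg_iso_trans (F : fieldType) (A B E : calg F) :
  calg_iso A B -> calg_iso B E -> calg_iso A E.
Proof.
move=> [f [fbij fC]] [g [gbij gC]]; exists (g \o f); split; first exact: bij_comp.
by move=> c /=; rewrite fC gC.
Qed.

Theorem theorem2p3 (k : fieldType) (hk : [pchar k]%R =i pred0) (R : calg k) :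
  classD R <->
  (ML R <> [set: R]%classic /\
   exists (K : fieldType) (iota : {rmorphism k -> K}), classD (tensor iota R)).
Proof.
split=> [cD|[ML_neq [K [iota cDK]]]].
  have [nz [dom [psi [x [y [z sys]]]]]] := classD_system cD.
  have [D [derD lnD Dz]] := replica sys.
  split; last first.
    exists k, idfun; have [phi [gt1 iso]] := cD; exists phi; split=> //.
    exact: calg_iso_trans (tensor_id R) iso.
  move=> MLT; have /eqP := sys_x_neq0 sys; apply; rewrite -Dz.
  have : ML R z by rewrite MLT.
  exact.
have [D [derD [lnD Dr]]] : exists D : {additive R -> R},
    is_derivation D /\ locally_nilpotent D /\ exists r, D r <> 0.
  apply: contrapT => no; apply: ML_neq; apply/seteqP; split=> // r _ D derD lnD.
  by apply: contrapT => Dr; apply: no; exists D; do 2!split=> //; exists r.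
exact: (@classD_descent k K hk iota R D derD lnD Dr cDK).
Qed.
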